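(* Let $f:\mathbb{B}\to\mathbb{B}$ be a slice regular function and suppose that $f$ has a fixed point $q_0\in\mathbb{B}$. The following facts are equivalent: (1) $f$ coincides with the identity function; (2) the real differential of $f$ at $q_0$ is the identity; (3) the Cullen derivative $\partial_cf(q_0)$ equals $1$; (4) the spherical derivative $\partial_sf(q_0)$ equals $1$; (5) there is some $q\in\mathbb{B}$ at which $R_{q_0}f(q)$ equals $(1-\bar q_0*q)^{-*}*(1-\bar q_0*f(q))$.
   Context: $\mathbb{H}$ denotes the quaternions, $\mathbb{B}=\{q\in\mathbb{H}: |q|<1\}$, $\mathbb{S}=\{q\in\mathbb{H}: q^2=-1\}$, $L_I=\mathbb{R}+I\mathbb{R}$ for $I\in\mathbb{S}$. A function $f:\Omega\to\mathbb{H}$ on a domain $\Omega\subseteq\mathbb{H}$ is slice regular if for every $I\in\mathbb{S}$ its restriction to $\Omega\cap L_I$ is real differentiable and $\frac12\left(\frac{\partial}{\partial x}+I\frac{\partial}{\partial y}\right)f(x+Iy)=0$ there. On a ball $B(0,R)=\{|q|<R\}$ the regular functions are exactly the convergent power series $f(q)=\sum_n q^na_n$, $a_n\in\mathbb{H}$. The real differential is the differential of $f$ as a map between open subsets of $\mathbb{H}\cong\mathbb{R}^4$. Regular product: for $f(q)=\sum q^na_n$, $g(q)=\sum q^nb_n$, $f*g(q)=f(q)*g(q)=\sum_n q^n\sum_{k=0}^n a_kb_{n-k}$ (the letter $q$ always denotes the variable and other quaternions are treated as constant functions; so $\bar q_0*q=q\bar q_0$). Regular conjugate: $f^c(q)=\sum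 q^n\bar a_n$; symmetrization: $f^s=f*f^c=f^c*f$. Left regular quotient: $f^{-*}*g(q)=f^s(q)^{-1}(f^c*g)(q)$ wherever $f^s\neq0$. The function $1-\bar q_0*q$ has a reciprocal $(1-\bar q_0*q)^{-*}$ defined and regular on all of $\mathbb{B}$. Differential quotient: $R_{q_0}f(q)=(q-q_0)^{-*}*(f(q)-f(q_0))$, i.e. $R_{q_0}f$ is the unique regular function on $\mathbb{B}$ with $f(q)-f(q_0)=(q-q_0)*R_{q_0}f(q)$. Cullen derivative: $\partial_cf(x+Iy)=\frac12\left(\frac{\partial}{\partial x}-I\frac{\partial}{\partial y}\right)f(x+Iy)$, i.e. $\partial_c\left(\sum q^na_n\right)=\sum_{n\ge1} q^{n-1}na_n$; one has $\partial_cf(q_0)=R_{q_0}f(q_0)$. Spherical derivative: $\partial_sf(q_0)=R_{q_0}f(\bar q_0)$, which for nonreal $q_0$ equals $(2\,\mathrm{Im}(q_0))^{-1}(f(q_0)-f(\bar q_0))$. *)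

(* Defs.v *)
From Stdlib Require Import Reals ClassicalEpsilon.
From Coquelicot Require Import Coquelicot.

Open Scope R_scope.

(** (a, b, c, d) stands for a + b i + c j + d k.  As an iterated product, [quat]
    gets Coquelicot's product structure of a real normed module, whose norm is
    the Euclidean one. *)
Definition quat : Type := (R * R * R * R)%type.

Definition qre (q : quat) : R := fst (fst (fst q)).
Definition qi (q : quat) : R := snd (fst (fst q)).
Definition qj (q : quat) : R := snd (fst q).
Definition qk (q : quat) : R := snd q.

Definition RtoQ (r : R) : quat := (r, 0, 0, 0).

Definition qplus (p q : quat) : quat := plus p q.
Definition qminus (p q : quat) : quat := minus p q.
Definition qscal (r : R) (q : quat) : quat := scal r q.

Definition qmult (p q : quat) : quat :=
  (qre p * qre q - qi p * qi q - qj p * qj q - qk p * qk q,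
   qre p * qi q + qi p * qre q + qj p * qk q - qk p * qj q,
   qre p * qj q - qi p * qk q + qj p * qre q + qk p * qi q,
   qre p * qk q + qi p * qj q - qj p * qi q + qk p * qre q).

Definition qconj (q : quat) : quat := (qre q, - qi q, - qj q, - qk q).
Definition qim (q : quat) : quat := (0, qi q, qj q, qk q).
Definition qnorm (q : quat) : R :=
  sqrt (qre q ^ 2 + qi q ^ 2 + qj q ^ 2 + qk q ^ 2).
Definition qinv (q : quat) : quat := qscal (/ qnorm q ^ 2) (qconj q).

Fixpoint qpow (q : quat) (n : nat) : quat :=
  match n with
  | O => RtoQ 1
  | S m => qmult q (qpow q m)
  end.

Declare Scope quat_scope.
Delimit Scope quat_scope with quat.
Bind Scope quat_scope with quat.
Notation "p + q" := (qplus p q) : quat_scope.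
Notation "p - q" := (qminus p q) : quat_scope.
Notation "p * q" := (qmult p q) : quat_scope.
Notation "/ q" := (qinv q) : quat_scope.
Notation "q ^ n" := (qpow q n) : quat_scope.

Definition unit_ball (q : quat) : Prop := qnorm q < 1.

Definition imag_unit (I : quat) : Prop := (I * I)%quat = RtoQ (-1).

Definition slice (I : quat) (x y : R) : quat := (RtoQ x + I * RtoQ y)%quat.

(** Derivative of a quaternion-valued function of a real variable; as for
    [Derive], the value is meaningful where the function is differentiable. *)
Definition qDerive (g : R -> quat) (t : R) : quat :=
  (Derive (fun s => qre (g s)) t, Derive (fun s => qi (g s)) t,
   Derive (fun s => qj (g s)) t, Derive (fun s => qk (g s)) t).

Definition slice_dx (I : quat) (f : quat -> quat) (x y : R) : quat :=
  qDerive (fun t => f (slice I t y)) x.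
Definition slice_dy (I : quat) (f : quat -> quat) (x y : R) : quat :=
  qDerive (fun t => f (slice I x t)) y.

(** Functions on an open set [Omega] are represented by total functions, whose
    values outside [Omega] are irrelevant. *)
Definition slice_regular (Omega : quat -> Prop) (f : quat -> quat) : Prop :=
  forall I : quat, imag_unit I ->
  forall x y : R, Omega (slice I x y) ->
    ex_filterdiff (fun p : R * R => f (slice I (fst p) (snd p)))
      (locally (x, y)) /\
    qscal (1 / 2) (slice_dx I f x y + I * slice_dy I f x y) = RtoQ 0.

(** An imaginary unit [I] with [q = qre q + I |qim q|].  It is unique unless [q]
    is real, where it is arbitrarily set to [i]; the Cullen derivative of a
    slice regular function at a real point does not depend on this choice. *)
Definition slice_unit (q : quat) : quat :=
  if Req_EM_T (qnorm (qim q)) 0 then (0, 1, 0, 0)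
  else qscal (/ qnorm (qim q)) (qim q).

Definition cullen_derivative (f : quat -> quat) (q : quat) : quat :=
  let I := slice_unit q in
  let x := qre q in
  let y := qnorm (qim q) in
  qscal (1 / 2) (slice_dx I f x y - I * slice_dy I f x y).

Definition qSeries (u : nat -> quat) : quat :=
  (Series (fun n => qre (u n)), Series (fun n => qi (u n)),
   Series (fun n => qj (u n)), Series (fun n => qk (u n))).

Definition has_coefs (f : quat -> quat) (a : nat -> quat) : Prop :=
  forall q : quat, unit_ball q ->
    is_series (fun n => (q ^ n * a n)%quat : quat) (f q).

(** The (unique) power series coefficients of a slice regular function on the
    unit ball; arbitrary if [f] has no power series expansion there. *)
Definition coef (f : quat -> quat) : nat -> quat :=
  epsilon (inhabits (fun _ : nat => RtoQ 0)) (has_coefs f).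

(** Operations on slice regular functions on the unit ball. *)
Definition star (f g : quat -> quat) (q : quat) : quat :=
  qSeries (fun n =>
    (q ^ n *
     (sum_n (fun k => (coef f k * coef g (n - k)%nat)%quat : quat) n))%quat).

Definition reg_conj (f : quat -> quat) (q : quat) : quat :=
  qSeries (fun n => (q ^ n * qconj (coef f n))%quat).

Definition symmetrization (f : quat -> quat) : quat -> quat :=
  star f (reg_conj f).

(** The left regular quotient f^{-*} * g, meaningful where the symmetrization
    of [f] does not vanish. *)
Definition left_quotient (f g : quat -> quat) (q : quat) : quat :=
  (/ symmetrization f q * star (reg_conj f) g q)%quat.

(** [R_{q0} f], as the unique regular function on the whole unit ball with
    f - f(q0) = (q - q0) * R_{q0} f: the pointwise formula for
    (q - q0)^{-*} * (f - f(q0)) is undefined on the sphere of [q0]. *)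
Definition is_diff_quotient (q0 : quat) (f g : quat -> quat) : Prop :=
  slice_regular unit_ball g /\
  forall q : quat, unit_ball q ->
    (f q - f q0)%quat = star (fun p => (p - q0)%quat) g q.

Definition diff_quotient (q0 : quat) (f : quat -> quat) : quat -> quat :=
  epsilon (inhabits (fun _ : quat => RtoQ 0)) (is_diff_quotient q0 f).

Definition spherical_derivative (f : quat -> quat) (q0 : quat) : quat :=
  diff_quotient q0 f (qconj q0).

(** 1 - conj(q0) * f, with conj(q0) regarded as a constant function. *)
Definition one_minus_conj_star (q0 : quat) (f : quat -> quat) (q : quat) :
  quat := (RtoQ 1 - star (fun _ => qconj q0) f q)%quat.

(* Main.v *)
(** Put [k := R_{q0} f - 1], so that [f - q = (q - q0) * k] by [f q0 = q0].  Each of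
    (3), (4), (5) says that [k] vanishes at some point [q1] of the ball: [q1 = q0]
    for (3), [q1 = conj q0] for (4), and for (5) a conjugate [u^-1 q u] of [q] with
    [u = 1 - q q0], because
    the equation there reduces to [((1 - q q0) * k)(q) = 0].

    If [k q1 = 0], let [lambda_n = sum_{i<n} q1^i q0^(n-1-i)] represent the linear
    functional [(q - q0) * G |-> G q1], and put [w_n = conj lambda_(n+1)].  Then
    [sum lambda_n (f * w)_n = sum lambda_n (q * w)_n = |w|^2] in l^2, while
    [|f * w| <= |w|] since [f] is bounded by [1] (star multiplication by [f] is a
    contraction of l^2, by discrete Parseval).  Equality in Cauchy-Schwarz gives
    [f * w = q * w], hence [f = q].

    That a slice regular function on the ball is a power series follows from
    Cauchy's formula on each slice, proved from mere differentiability by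
    Goursat's bisection. *)

Require Import Defs.
From Stdlib Require Import Reals Lra Lia ClassicalEpsilon.
From Coquelicot Require Import Coquelicot.

(** * Quaternion algebra *)

(** The obstacle is that evaluation at a point is not multiplicative for the regular product, so the
    argument works on coefficient sequences, where that product is convolution. What survives
    evaluation is a zero of the left factor: [k q1 = 0] gives
    [(k * w)(q1) = sum_m q1^m k(q1) w_m = 0], so the functional kills [(f - q) * w] for every
    decaying [w].

    The functional has its shape because [D = (q - q0) * G] means [D_n = G_(n-1) - q0 G_n];
    summation by parts turns [sum lambda_n D_n] into [sum q1^n G_n] once
    [lambda_(n+1) - lambda_n q0 = q1^n]. Starting from [lambda_0 = 0] makes its value on [q * w]
    equal to [sum lambda_(n+1) w_n], and the choice of [w] makes this a sum of squares. Moreover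
    [w_0 = lambda_1 = 1], so [w] can be cancelled at the end. No relation between [q1] and [q0] is
    required, which is why one argument serves all three statements.

    No boundary values of [f] are at hand, so the contraction is obtained from polynomials, namely
    truncated dilations of [f], and the infinite sums are replaced by finite ones with an error
    tending to 0. *)

Lemma quat_ext (p q : quat) :
  qre p = qre q -> qi p = qi q -> qj p = qj q -> qk p = qk q -> p = q.
Proof.
destruct p as [[[a b] c] d]; destruct q as [[[a' b'] c'] d'].
unfold qre, qi, qj, qk; cbn; congruence.
Qed.

Lemma qre_plus p q : qre (p + q)%quat = qre p + qre q.
Proof. reflexivity. Qed.
Lemma qi_plus p q : qi (p + q)%quat = qi p + qi q.
Proof. reflexivity. Qed.
Lemma qj_plus p q : qj (p + q)%quat = qj p + qj q.
Proof. reflexivity. Qed.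
Lemma qk_plus p q : qk (p + q)%quat = qk p + qk q.
Proof. reflexivity. Qed.
Lemma qre_minus p q : qre (p - q)%quat = qre p - qre q.
Proof. reflexivity. Qed.
Lemma qi_minus p q : qi (p - q)%quat = qi p - qi q.
Proof. reflexivity. Qed.
Lemma qj_minus p q : qj (p - q)%quat = qj p - qj q.
Proof. reflexivity. Qed.
Lemma qk_minus p q : qk (p - q)%quat = qk p - qk q.
Proof. reflexivity. Qed.
Lemma qre_scal r q : qre (qscal r q) = r * qre q.
Proof. reflexivity. Qed.
Lemma qi_scal r q : qi (qscal r q) = r * qi q.
Proof. reflexivity. Qed.
Lemma qj_scal r q : qj (qscal r q) = r * qj q.
Proof. reflexivity. Qed.
Lemma qk_scal r q : qk (qscal r q) = r * qk q.
Proof. reflexivity. Qed.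
Lemma qre_mult p q : qre (p * q)%quat =
  qre p * qre q - qi p * qi q - qj p * qj q - qk p * qk q.
Proof. reflexivity. Qed.
Lemma qi_mult p q : qi (p * q)%quat =
  qre p * qi q + qi p * qre q + qj p * qk q - qk p * qj q.
Proof. reflexivity. Qed.
Lemma qj_mult p q : qj (p * q)%quat =
  qre p * qj q - qi p * qk q + qj p * qre q + qk p * qi q.
Proof. reflexivity. Qed.
Lemma qk_mult p q : qk (p * q)%quat =
  qre p * qk q + qi p * qj q - qj p * qi q + qk p * qre q.
Proof. reflexivity. Qed.
Lemma qre_conj q : qre (qconj q) = qre q.
Proof. reflexivity. Qed.
Lemma qi_conj q : qi (qconj q) = - qi q.
Proof. reflexivity. Qed.
Lemma qj_conj q : qj (qconj q) = - qj q.
Proof. reflexivity. Qed.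
Lemma qk_conj q : qk (qconj q) = - qk q.
Proof. reflexivity. Qed.
Lemma qre_RtoQ r : qre (RtoQ r) = r.
Proof. reflexivity. Qed.
Lemma qi_RtoQ r : qi (RtoQ r) = 0.
Proof. reflexivity. Qed.
Lemma qj_RtoQ r : qj (RtoQ r) = 0.
Proof. reflexivity. Qed.
Lemma qk_RtoQ r : qk (RtoQ r) = 0.
Proof. reflexivity. Qed.
Lemma qre_im q : qre (qim q) = 0.
Proof. reflexivity. Qed.
Lemma qi_im q : qi (qim q) = qi q.
Proof. reflexivity. Qed.
Lemma qj_im q : qj (qim q) = qj q.
Proof. reflexivity. Qed.
Lemma qk_im q : qk (qim q) = qk q.
Proof. reflexivity. Qed.

#[global] Hint Rewrite qre_plus qi_plus qj_plus qk_plus qre_minus qi_minus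
  qj_minus qk_minus qre_scal qi_scal qj_scal qk_scal qre_mult qi_mult qj_mult
  qk_mult qre_conj qi_conj qj_conj qk_conj qre_RtoQ qi_RtoQ qj_RtoQ qk_RtoQ
  qre_im qi_im qj_im qk_im : qcoord.

Ltac qring := apply quat_ext; autorewrite with qcoord; try ring.

Lemma qmult_assoc p q r : ((p * q) * r)%quat = (p * (q * r))%quat.
Proof. qring. Qed.
Lemma qmult_1_l p : (RtoQ 1 * p)%quat = p.
Proof. qring. Qed.
Lemma qmult_1_r p : (p * RtoQ 1)%quat = p.
Proof. qring. Qed.
Lemma qmult_0_l p : (RtoQ 0 * p)%quat = RtoQ 0.
Proof. qring. Qed.
Lemma qmult_0_r p : (p * RtoQ 0)%quat = RtoQ 0.
Proof. qring. Qed.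
Lemma qplus_0_l p : (RtoQ 0 + p)%quat = p.
Proof. qring. Qed.
Lemma qplus_0_r p : (p + RtoQ 0)%quat = p.
Proof. qring. Qed.
Lemma qmult_plus_distr_l p q r : (p * (q + r))%quat = (p * q + p * r)%quat.
Proof. qring. Qed.
Lemma qmult_plus_distr_r p q r : ((p + q) * r)%quat = (p * r + q * r)%quat.
Proof. qring. Qed.

Definition qdot (p q : quat) : R :=
  qre p * qre q + qi p * qi q + qj p * qj q + qk p * qk q.

Lemma qnorm_sqr q : qnorm q ^ 2 = qdot q q.
Proof.
unfold qnorm, qdot; rewrite pow2_sqrt; [ring|nra].
Qed.

Lemma qnorm_ge0 q : 0 <= qnorm q.
Proof. apply sqrt_pos. Qed.

Lemma qnorm_le_sqr q c : 0 <= c -> qdot q q <= c ^ 2 -> qnorm q <= c.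
Proof.
intros hc h; rewrite <- qnorm_sqr in h; pose proof (qnorm_ge0 q); nra.
Qed.

Lemma qnorm_mult p q : qnorm (p * q)%quat = qnorm p * qnorm q.
Proof.
unfold qnorm; rewrite <- sqrt_mult; [|nra|nra].
f_equal; autorewrite with qcoord; ring.
Qed.

Lemma qnorm_conj q : qnorm (qconj q) = qnorm q.
Proof. unfold qnorm; f_equal; autorewrite with qcoord; ring. Qed.

Lemma qnorm_scal r q : qnorm (qscal r q) = Rabs r * qnorm q.
Proof.
unfold qnorm; rewrite <- (sqrt_Rsqr_abs r), <- sqrt_mult; [|apply Rle_0_sqr|nra].
f_equal; autorewrite with qcoord; unfold Rsqr; ring.
Qed.

Lemma qnorm_RtoQ r : qnorm (RtoQ r) = Rabs r.
Proof.
unfold qnorm; rewrite <- (sqrt_Rsqr_abs r).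
f_equal; autorewrite with qcoord; unfold Rsqr; ring.
Qed.

Lemma qnorm_0 : qnorm (RtoQ 0) = 0.
Proof. rewrite qnorm_RtoQ; apply Rabs_R0. Qed.

Lemma qnorm_1 : qnorm (RtoQ 1) = 1.
Proof. rewrite qnorm_RtoQ; apply Rabs_R1. Qed.

Lemma qnorm_eq0 q : qnorm q = 0 -> q = RtoQ 0.
Proof.
intro h; pose proof (qnorm_sqr q) as e; rewrite h in e; unfold qdot in e.
qring; nra.
Qed.

Lemma qdot_le p q : qdot p q <= qnorm p * qnorm q.
Proof.
rewrite <- (qnorm_conj q), <- qnorm_mult.
replace (qdot p q) with (qre (p * qconj q)%quat)
  by (unfold qdot; autorewrite with qcoord; ring).
apply Rle_trans with (1 := Rle_abs _).
unfold qnorm; rewrite <- sqrt_Rsqr_abs; apply sqrt_le_1_alt.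
unfold Rsqr; nra.
Qed.

Lemma qnorm_triang p q : qnorm (p + q)%quat <= qnorm p + qnorm q.
Proof.
pose proof (qnorm_ge0 p); pose proof (qnorm_ge0 q).
apply qnorm_le_sqr; [lra|].
replace (qdot (p + q)%quat (p + q)%quat)
  with (qdot p p + 2 * qdot p q + qdot q q)
  by (unfold qdot; autorewrite with qcoord; ring).
rewrite <- !qnorm_sqr; pose proof (qdot_le p q); nra.
Qed.

Lemma qnorm_minus_sym p q : qnorm (p - q)%quat = qnorm (q - p)%quat.
Proof. unfold qnorm; f_equal; autorewrite with qcoord; ring. Qed.

Lemma qnorm_minus_triang p q : qnorm (p - q)%quat <= qnorm p + qnorm q.
Proof.
replace (p - q)%quat with (p + qscal (-1) q)%quat by qring.
apply Rle_trans with (1 := qnorm_triang _ _).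
rewrite qnorm_scal, (Rabs_left (-1)) by lra; lra.
Qed.

Lemma Rabs_qre_le q : Rabs (qre q) <= qnorm q.
Proof. unfold qnorm; rewrite <- sqrt_Rsqr_abs; apply sqrt_le_1_alt; unfold Rsqr; nra. Qed.
Lemma Rabs_qi_le q : Rabs (qi q) <= qnorm q.
Proof. unfold qnorm; rewrite <- sqrt_Rsqr_abs; apply sqrt_le_1_alt; unfold Rsqr; nra. Qed.
Lemma Rabs_qj_le q : Rabs (qj q) <= qnorm q.
Proof. unfold qnorm; rewrite <- sqrt_Rsqr_abs; apply sqrt_le_1_alt; unfold Rsqr; nra. Qed.
Lemma Rabs_qk_le q : Rabs (qk q) <= qnorm q.
Proof. unfold qnorm; rewrite <- sqrt_Rsqr_abs; apply sqrt_le_1_alt; unfold Rsqr; nra. Qed.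

Lemma qnorm_le_max q c : Rabs (qre q) <= c -> Rabs (qi q) <= c ->
  Rabs (qj q) <= c -> Rabs (qk q) <= c -> qnorm q <= 2 * c.
Proof.
intros h1 h2 h3 h4; pose proof (Rabs_pos (qre q)).
apply qnorm_le_sqr; [lra|unfold qdot].
apply Rabs_le_between in h1; apply Rabs_le_between in h2.
apply Rabs_le_between in h3; apply Rabs_le_between in h4; nra.
Qed.

Lemma qnorm_pow q n : qnorm (q ^ n)%quat = qnorm q ^ n.
Proof.
induction n as [|n IH]; cbn [qpow pow]; [apply qnorm_1|].
now rewrite qnorm_mult, IH.
Qed.

Lemma qpow_S_r q n : (q ^ S n)%quat = (q ^ n * q)%quat.
Proof.
induction n as [|n IH]; [cbn [qpow]; qring|].
change (q ^ S (S n))%quat with (q * q ^ S n)%quat.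
now rewrite IH at 1; rewrite <- qmult_assoc.
Qed.

Lemma qpow_add q m n : (q ^ (m + n))%quat = (q ^ m * q ^ n)%quat.
Proof.
induction m as [|m IH]; cbn [qpow Nat.add]; [now rewrite qmult_1_l|].
now rewrite IH, qmult_assoc.
Qed.

Lemma qmult_conj_r q : (q * qconj q)%quat = RtoQ (qnorm q ^ 2).
Proof. rewrite qnorm_sqr; unfold qdot; qring. Qed.

Lemma qinv_r q : q <> RtoQ 0 -> (q * / q)%quat = RtoQ 1.
Proof.
intro h; unfold qinv.
replace (q * qscal (/ qnorm q ^ 2) (qconj q))%quat
  with (qscal (/ qnorm q ^ 2) (q * qconj q)%quat) by qring.
rewrite qmult_conj_r; qring; field; intro e; apply h, qnorm_eq0, e.
Qed.

Lemma qinv_l q : q <> RtoQ 0 -> (/ q * q)%quat = RtoQ 1.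
Proof.
intro h; rewrite <- (qinv_r q h); unfold qinv; qring.
Qed.

Lemma qmult_eq0 p q : (p * q)%quat = RtoQ 0 -> p <> RtoQ 0 -> q = RtoQ 0.
Proof.
intros h hp; rewrite <- (qmult_1_l q), <- (qinv_l p hp), qmult_assoc, h.
apply qmult_0_r.
Qed.

(** Moves a factor standing between a power and its coefficient to the far left, at the price of
    conjugating the point. This is what turns a regular product into a value of its right factor. *)
Lemma qpow_conjugation u q n : u <> RtoQ 0 ->
  (u * (/ u * q * u) ^ n)%quat = (q ^ n * u)%quat.
Proof.
intro hu; induction n as [|n IH]; [cbn [qpow]; qring|].
cbn [qpow].
rewrite <- !qmult_assoc, (qinv_r u hu), qmult_1_l, (qmult_assoc q u), IH.
now rewrite <- qmult_assoc.
Qed.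

(** * Finite sums and convolution *)

Fixpoint rsum (u : nat -> R) (n : nat) : R :=
  match n with O => 0 | S m => rsum u m + u m end.

Fixpoint qsum (u : nat -> quat) (n : nat) : quat :=
  match n with O => RtoQ 0 | S m => (qsum u m + u m)%quat end.

Lemma rsum_ext u v n : (forall k, (k < n)%nat -> u k = v k) -> rsum u n = rsum v n.
Proof.
induction n as [|n IH]; intro h; cbn [rsum]; [easy|].
rewrite IH, (h n); auto with arith.
Qed.

Lemma qsum_ext u v n : (forall k, (k < n)%nat -> u k = v k) -> qsum u n = qsum v n.
Proof.
induction n as [|n IH]; intro h; cbn [qsum]; [easy|].
rewrite IH, (h n); auto with arith.
Qed.

Lemma rsum_le u v n : (forall k, (k < n)%nat -> u k <= v k) -> rsum u n <= rsum v n.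
Proof.
induction n as [|n IH]; intro h; cbn [rsum]; [lra|].
apply Rplus_le_compat; auto with arith.
Qed.

Lemma rsum_ge0 u n : (forall k, 0 <= u k) -> 0 <= rsum u n.
Proof.
intro h; induction n as [|n IH]; cbn [rsum]; [lra|specialize (h n); lra].
Qed.

Lemma rsum_mono u m n : (forall k, 0 <= u k) -> (m <= n)%nat -> rsum u m <= rsum u n.
Proof.
intros h l; induction l as [|n l IH]; cbn [rsum]; [lra|specialize (h n); lra].
Qed.

Lemma rsum_plus u v n : rsum (fun k => u k + v k) n = rsum u n + rsum v n.
Proof. induction n as [|n IH]; cbn [rsum]; [ring|rewrite IH; ring]. Qed.

Lemma rsum_scal c u n : rsum (fun k => c * u k) n = c * rsum u n.
Proof. induction n as [|n IH]; cbn [rsum]; [ring|rewrite IH; ring]. Qed.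

Lemma rsum_const c n : rsum (fun _ => c) n = INR n * c.
Proof.
induction n as [|n IH]; [cbn; ring|].
cbn [rsum]; rewrite IH, S_INR; ring.
Qed.

Lemma rsum_switch (u : nat -> nat -> R) m n :
  rsum (fun i => rsum (u i) n) m = rsum (fun j => rsum (fun i => u i j) m) n.
Proof.
induction m as [|m IH]; cbn [rsum].
- induction n as [|n IH]; cbn [rsum]; [easy|rewrite <- IH; ring].
- now rewrite IH, rsum_plus.
Qed.

Lemma qsum_plus u v n : qsum (fun k => u k + v k)%quat n = (qsum u n + qsum v n)%quat.
Proof. induction n as [|n IH]; cbn [qsum]; [qring|rewrite IH; qring]. Qed.

Lemma qsum_minus u v n : qsum (fun k => u k - v k)%quat n = (qsum u n - qsum v n)%quat.
Proof. induction n as [|n IH]; cbn [qsum]; [qring|rewrite IH; qring]. Qed.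

Lemma qsum_mult_l c u n : qsum (fun k => c * u k)%quat n = (c * qsum u n)%quat.
Proof. induction n as [|n IH]; cbn [qsum]; [qring|rewrite IH; qring]. Qed.

Lemma qsum_mult_r c u n : qsum (fun k => u k * c)%quat n = (qsum u n * c)%quat.
Proof. induction n as [|n IH]; cbn [qsum]; [qring|rewrite IH; qring]. Qed.

Lemma qsum_0 u n : (forall k, (k < n)%nat -> u k = RtoQ 0) -> qsum u n = RtoQ 0.
Proof.
induction n as [|n IH]; intro h; cbn [qsum]; [easy|].
rewrite IH, (h n); auto with arith; qring.
Qed.

Lemma qsum_split u m n :
  qsum u (m + n) = (qsum u m + qsum (fun k => u (m + k)%nat) n)%quat.
Proof.
induction n as [|n IH]; [rewrite Nat.add_0_r; cbn [qsum]; qring|].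
rewrite Nat.add_succ_r; cbn [qsum]; rewrite IH; qring.
Qed.

Lemma qsum_S_l u n : qsum u (S n) = (u O + qsum (fun k => u (S k)) n)%quat.
Proof. change (S n) with (1 + n)%nat; rewrite qsum_split; cbn [qsum Nat.add]; qring. Qed.

Lemma qnorm_qsum u n : qnorm (qsum u n) <= rsum (fun k => qnorm (u k)) n.
Proof.
induction n as [|n IH]; cbn [qsum rsum]; [rewrite qnorm_0; lra|].
apply Rle_trans with (1 := qnorm_triang _ _); lra.
Qed.

Lemma qsum_switch (u : nat -> nat -> quat) m n :
  qsum (fun i => qsum (u i) n) m = qsum (fun j => qsum (fun i => u i j) m) n.
Proof.
induction m as [|m IH]; cbn [qsum].
- rewrite qsum_0; auto.
- now rewrite IH, qsum_plus.
Qed.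

Lemma qdot_qsum_l u q n : qdot (qsum u n) q = rsum (fun k => qdot (u k) q) n.
Proof.
induction n as [|n IH]; cbn [qsum rsum];
  [|rewrite <- IH]; unfold qdot; autorewrite with qcoord; ring.
Qed.

Lemma qdot_qsum_r u q n : qdot q (qsum u n) = rsum (fun k => qdot q (u k)) n.
Proof.
induction n as [|n IH]; cbn [qsum rsum];
  [|rewrite <- IH]; unfold qdot; autorewrite with qcoord; ring.
Qed.

(** Coefficients of the regular product; the bound is [S n] because [qsum] excludes its upper
    index. *)
Definition qconv (a b : nat -> quat) (n : nat) : quat :=
  qsum (fun k => a k * b (n - k)%nat)%quat (S n).

(** * The Toeplitz contraction for polynomials *)

Lemma qpow_mul q m n : ((q ^ m) ^ n)%quat = (q ^ (m * n))%quat.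
Proof.
induction n as [|n IH]; cbn [qpow]; [now rewrite Nat.mul_0_r|].
now rewrite IH, <- qpow_add, Nat.mul_succ_r, Nat.add_comm.
Qed.

Lemma qpow_1_l n : (RtoQ 1 ^ n)%quat = RtoQ 1.
Proof. induction n as [|n IH]; cbn [qpow]; [easy|rewrite IH; qring]. Qed.

Lemma qsum_geom z n : ((z - RtoQ 1) * qsum (fun j => z ^ j) n)%quat = (z ^ n - RtoQ 1)%quat.
Proof.
induction n as [|n IH]; cbn [qsum qpow]; [qring|].
rewrite qmult_plus_distr_l, IH; qring.
Qed.

Lemma qdot_mult_r p q z :
  qdot (p * z)%quat (q * z)%quat = qnorm z ^ 2 * qdot p q.
Proof. rewrite qnorm_sqr; unfold qdot; autorewrite with qcoord; ring. Qed.

Definition primitive_root (N : nat) (z : quat) : Prop :=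
  qnorm z = 1 /\ (z ^ N)%quat = RtoQ 1 /\
  forall n, (0 < n < N)%nat -> (z ^ n)%quat <> RtoQ 1.

(** Multiplying the sum by the nonzero [z ^ n - 1] telescopes it to [z ^ (n * N) - 1 = 0]. *)
Lemma primitive_root_sum N z n : primitive_root N z -> (0 < n < N)%nat ->
  qsum (fun j => (z ^ j) ^ n)%quat N = RtoQ 0.
Proof.
intros [_ [hN hz]] hn.
apply qmult_eq0 with (p := (z ^ n - RtoQ 1)%quat).
- rewrite (qsum_ext _ (fun j => (z ^ n) ^ j)%quat).
  + rewrite qsum_geom, qpow_mul, Nat.mul_comm, <- qpow_mul, hN, qpow_1_l; qring.
  + intros k _; now rewrite !qpow_mul, Nat.mul_comm.
- intro e; apply (hz n hn).
  replace (z ^ n)%quat with ((z ^ n - RtoQ 1) + RtoQ 1)%quat by qring.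
  rewrite e; qring.
Qed.

(** The powers stand to the right of the coefficients, where multiplication by a unit quaternion is
    an isometry. The cross term of indices [n < M] is therefore the inner product of [F n] with
    [F M * (z ^ j) ^ (M - n)], and summing over [j] kills it since [0 < M - n < N]. *)
Lemma discrete_parseval N z (F : nat -> quat) M : primitive_root N z -> (M <= N)%nat ->
  rsum (fun j => qnorm (qsum (fun n => F n * (z ^ j) ^ n)%quat M) ^ 2) N =
  INR N * rsum (fun n => qnorm (F n) ^ 2) M.
Proof.
intros hz; assert (hz1 := proj1 hz).
induction M as [|M IH]; intro hM.
{ cbn [rsum qsum]; rewrite qnorm_0, rsum_const; ring. }
cbn [rsum qsum].
rewrite (rsum_ext _ (fun j =>
   (qnorm (qsum (fun n => F n * (z ^ j) ^ n)%quat M) ^ 2 + qnorm (F M) ^ 2)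
   + 2 * rsum (fun n => qdot (F n) (F M * (z ^ j) ^ (M - n)))%quat M)).
- rewrite !rsum_plus, IH, rsum_const by lia.
  rewrite rsum_scal, rsum_switch.
  rewrite (rsum_ext (fun n => rsum _ N) (fun _ => 0)), (rsum_const 0); [ring|].
  intros n hn; rewrite <- qdot_qsum_r, qsum_mult_l, (primitive_root_sum N z);
    [|easy|lia].
  rewrite qmult_0_r; unfold qdot; autorewrite with qcoord; ring.
- intros j _; rewrite (rsum_ext _ (fun n => qdot (F n * (z ^ j) ^ n)
    (F M * (z ^ j) ^ M)))%quat.
  + rewrite <- qdot_qsum_l.
    replace (qnorm (F M)) with (qnorm (F M * (z ^ j) ^ M)%quat).
    * rewrite !qnorm_sqr; unfold qdot; autorewrite with qcoord; ring.
    * rewrite qnorm_mult, !qnorm_pow, hz1, !pow1; ring.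
  + intros n hn.
    replace ((z ^ j) ^ M)%quat with ((z ^ j) ^ (M - n) * (z ^ j) ^ n)%quat.
    * rewrite <- qmult_assoc, qdot_mult_r, !qnorm_pow, hz1, !pow1; ring.
    * rewrite <- qpow_add; f_equal; lia.
Qed.

Lemma imag_unit_re J : imag_unit J -> qre J = 0.
Proof.
intro h; pose proof (f_equal qre h) as h0; pose proof (f_equal qi h) as h1.
pose proof (f_equal qj h) as h2; pose proof (f_equal qk h) as h3.
autorewrite with qcoord in *.
destruct (Req_dec (qre J) 0) as [e|e]; [easy|exfalso].
assert (qi J = 0) by (apply Rmult_eq_reg_l with (qre J); lra).
assert (qj J = 0) by (apply Rmult_eq_reg_l with (qre J); lra).
assert (qk J = 0) by (apply Rmult_eq_reg_l with (qre J); lra).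
nra.
Qed.

Lemma imag_unit_sqr J : imag_unit J -> qi J ^ 2 + qj J ^ 2 + qk J ^ 2 = 1.
Proof.
intro h; pose proof (imag_unit_re J h) as h0; pose proof (f_equal qre h) as h1.
autorewrite with qcoord in h1; rewrite h0 in h1; lra.
Qed.

Lemma imag_unit_intro J : qre J = 0 -> qi J ^ 2 + qj J ^ 2 + qk J ^ 2 = 1 -> imag_unit J.
Proof. intros h0 h1; unfold imag_unit; qring; rewrite h0; lra. Qed.

Lemma qnorm_slice I x y : imag_unit I -> qnorm (slice I x y) = sqrt (x ^ 2 + y ^ 2).
Proof.
intro h; unfold qnorm, slice; f_equal; autorewrite with qcoord.
rewrite (imag_unit_re I h); pose proof (imag_unit_sqr I h).
replace (x ^ 2 + y ^ 2) with (x ^ 2 + (qi I ^ 2 + qj I ^ 2 + qk I ^ 2) * y ^ 2)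
  by (rewrite H; ring).
ring.
Qed.

Lemma slice_mult I x y x' y' : imag_unit I ->
  (slice I x y * slice I x' y')%quat = slice I (x * x' - y * y') (x * y' + y * x').
Proof.
intro h; unfold slice.
replace ((RtoQ x + I * RtoQ y) * (RtoQ x' + I * RtoQ y'))%quat
  with (RtoQ (x * x') + I * RtoQ (x * y' + y * x') + (I * I) * RtoQ (y * y'))%quat
  by qring.
rewrite h; qring.
Qed.

Lemma slice_moivre I t n : imag_unit I ->
  (slice I (cos t) (sin t) ^ n)%quat = slice I (cos (INR n * t)) (sin (INR n * t)).
Proof.
intro h; induction n as [|n IH].
- cbn [qpow INR]; rewrite Rmult_0_l, cos_0, sin_0; unfold slice; qring.
- cbn [qpow]; rewrite IH, slice_mult, S_INR by easy.
  rewrite Rmult_plus_distr_r, Rmult_1_l, cos_plus, sin_plus; f_equal; ring.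
Qed.

Lemma qnorm_slice_cos_sin I t : imag_unit I -> qnorm (slice I (cos t) (sin t)) = 1.
Proof.
intro h; rewrite qnorm_slice by easy.
replace (cos t ^ 2 + sin t ^ 2) with 1; [apply sqrt_1|].
pose proof (sin2_cos2 t) as e; unfold Rsqr in e; lra.
Qed.

Lemma cos_lt_1 t : 0 < t < 2 * PI -> cos t < 1.
Proof.
intro h; replace t with (2 * (t / 2)) by field; rewrite cos_2a_sin.
assert (0 < sin (t / 2)) by (apply sin_gt_0; lra); nra.
Qed.

Lemma imag_unit_i : imag_unit (0, 1, 0, 0).
Proof. apply imag_unit_intro; cbn; ring. Qed.

(** The angle is exposed, rather than just the root, because [right_sum_bound] speaks of points in
    the form [slice I (cos t) (sin t)]. *)
Lemma primitive_root_exists N : (0 < N)%nat -> exists t, 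
  primitive_root N (slice (0, 1, 0, 0) (cos t) (sin t)).
Proof.
intro hN; assert (0 < INR N) by now apply lt_0_INR.
exists (2 * PI / INR N); pose proof imag_unit_i as hi; pose proof PI_RGT_0.
split; [now apply qnorm_slice_cos_sin|]; split.
- rewrite slice_moivre by easy.
  replace (INR N * (2 * PI / INR N)) with (2 * PI) by (field; lra).
  rewrite cos_2PI, sin_2PI; unfold slice; qring.
- intros n hn e; rewrite slice_moivre in e by easy.
  apply (f_equal qre) in e; unfold slice in e; autorewrite with qcoord in e.
  cbn [qre qi qj qk fst snd] in e.
  assert (cos (INR n * (2 * PI / INR N)) < 1); [|lra].
  assert (0 < INR n) by (apply lt_0_INR; lia).
  assert (INR n < INR N) by (apply lt_INR; lia).
  apply cos_lt_1; split.
  + apply Rmult_lt_0_compat; [easy|apply Rdiv_lt_0_compat; lra].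
  + replace (INR n * (2 * PI / INR N)) with (2 * PI * (INR n / INR N)) by (field; lra).
    assert (INR n / INR N < 1); [|nra].
    apply Rmult_lt_reg_r with (INR N); [easy|].
    unfold Rdiv; rewrite Rmult_assoc, Rinv_l by lra; lra.
Qed.

Lemma slice_sum_split I t (a : nat -> quat) K : imag_unit I ->
  qsum (fun k => slice I (cos t) (sin t) ^ k * a k)%quat K =
  (qsum (fun k => qscal (cos (INR k * t)) (a k)) K +
   I * qsum (fun k => qscal (sin (INR k * t)) (a k)) K)%quat.
Proof.
intro h; rewrite <- qsum_mult_l, <- qsum_plus; apply qsum_ext; intros k _.
rewrite slice_moivre by easy; unfold slice; qring.
Qed.

(* Right multiplication of [b * p] by [I] is left multiplication by another
   imaginary unit, so the sum with powers on the right is a value of the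
   polynomial at a conjugate point. *)
Lemma right_sum_bound (a : nat -> quat) K B I t p : imag_unit I ->
  (forall q, qnorm q <= 1 -> qnorm (qsum (fun k => q ^ k * a k)%quat K) <= B) ->
  qnorm (qsum (fun k => a k * (p * slice I (cos t) (sin t) ^ k))%quat K)
    <= B * qnorm p.
Proof.
intros hI hB.
set (al := qsum (fun k => qscal (cos (INR k * t)) (a k)) K).
set (be := qsum (fun k => qscal (sin (INR k * t)) (a k)) K).
assert (e : qsum (fun k => a k * (p * slice I (cos t) (sin t) ^ k))%quat K
   = (al * p + be * p * I)%quat).
{ unfold al, be; rewrite <- !qsum_mult_r, <- qsum_plus; apply qsum_ext.
  intros k _; rewrite slice_moivre by easy; unfold slice; qring. }
(* For [u = be * p] nonzero, [J] is the conjugate [u * I * / u]; for [u = 0] both sides vanish and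
   any unit will do. *)
assert (exists J, imag_unit J /\ (be * p * I)%quat = (J * (be * p))%quat)
  as [J [hJ eJ]].
{ set (u := (be * p)%quat).
  destruct (Req_dec (qnorm u) 0) as [e0|e0].
  - apply qnorm_eq0 in e0; exists I; rewrite e0, qmult_0_l, qmult_0_r; auto.
  - assert (hu : u <> RtoQ 0) by (intro h; apply e0; rewrite h; apply qnorm_0).
    exists (u * I * / u)%quat; split.
    + unfold imag_unit in *.
      rewrite !qmult_assoc, <- (qmult_assoc (/ u)%quat u), (qinv_l u hu), qmult_1_l.
      rewrite <- (qmult_assoc I I), hI.
      replace (u * (RtoQ (-1) * / u))%quat with (qscal (-1) (u * / u)%quat) by qring.
      rewrite (qinv_r u hu); qring.
    + rewrite !qmult_assoc, (qinv_l u hu); qring. }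
rewrite e, eJ, <- qmult_assoc, <- qmult_plus_distr_r, qnorm_mult.
apply Rmult_le_compat_r; [apply qnorm_ge0|].
unfold al, be; rewrite <- slice_sum_split by easy; apply hB.
rewrite qnorm_slice_cos_sin; [lra|easy].
Qed.

Definition qtrunc (n : nat) (w : nat -> quat) (k : nat) : quat :=
  if (k <? n)%nat then w k else RtoQ 0.

(** Coefficients of [q^k * w]. *)
Definition qshift (k : nat) (w : nat -> quat) (n : nat) : quat :=
  if (k <=? n)%nat then w (n - k)%nat else RtoQ 0.

Lemma qsum_qshift k w z L :
  qsum (fun n => qshift k w n * z ^ n)%quat (k + L) =
  (qsum (fun n => w n * z ^ n) L * z ^ k)%quat.
Proof.
rewrite qsum_split, qsum_0, qplus_0_l, <- qsum_mult_r.
- apply qsum_ext; intros n _; unfold qshift.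
  destruct (Nat.leb_spec k (k + n)); [|lia].
  rewrite (Nat.add_comm k), Nat.add_sub, qpow_add; qring.
- intros n hn; unfold qshift; destruct (Nat.leb_spec k n); [lia|apply qmult_0_l].
Qed.

Lemma qsum_qtrunc n w (g : nat -> quat) L : (n <= L)%nat ->
  qsum (fun k => qtrunc n w k * g k)%quat L = qsum (fun k => w k * g k)%quat n.
Proof.
intro h; replace L with (n + (L - n))%nat by lia.
rewrite qsum_split, (qsum_0 _ (L - n)), qplus_0_r.
- apply qsum_ext; intros k hk; unfold qtrunc; destruct (Nat.ltb_spec k n); [easy|lia].
- intros k _; unfold qtrunc; destruct (Nat.ltb_spec (n + k) n); [lia|apply qmult_0_l].
Qed.

(** The first [n] coefficients of a product depend only on the first [n] of [w], so [w] may be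
    truncated to a polynomial. Parseval on roots of unity then reduces the inequality to a pointwise
    one, which is [right_sum_bound]. *)
Lemma toeplitz_polynomial (a w : nat -> quat) K B n : (n <= K)%nat ->
  (forall q, qnorm q <= 1 -> qnorm (qsum (fun k => q ^ k * a k)%quat K) <= B) ->
  rsum (fun m => qnorm (qconv a w m) ^ 2) n <= B ^ 2 * rsum (fun m => qnorm (w m) ^ 2) n.
Proof.
intros hnK hB.
(* For [n = 0] both sums are empty; otherwise [K > 0], as the roots of unity require. *)
destruct n as [|n']; [cbn [rsum]; lra|]; set (n := S n') in *.
set (F := fun m => qsum (fun k => a k * qshift k (qtrunc n w) m)%quat K).
(* [F] vanishes from index [K + n <= K + K] on, so [N] sample points recover all of its coefficients
   without aliasing. *)
set (N := (K + K)%nat).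
destruct (primitive_root_exists N) as [t ht]; [lia|].
set (z := slice (0, 1, 0, 0) (cos t) (sin t)) in *.
assert (hN : 0 < INR N) by (apply lt_0_INR; lia).
assert (hB0 : 0 <= B).
{ apply Rle_trans with (1 := qnorm_ge0 _) (2 := hB (RtoQ 0) ltac:(rewrite qnorm_0; lra)). }
assert (hF : rsum (fun m => qnorm (F m) ^ 2) N <= B ^ 2 * rsum (fun m => qnorm (w m) ^ 2) n).
{ apply Rmult_le_reg_l with (INR N); [easy|].
  rewrite <- (discrete_parseval N z F N) by auto.
  rewrite <- Rmult_assoc, (Rmult_comm (INR N)), Rmult_assoc.
  rewrite <- (discrete_parseval N z w n) by (auto; lia).
  rewrite <- rsum_scal; apply rsum_le; intros j _.
  rewrite <- Rpow_mult_distr; apply pow_incr; split; [apply qnorm_ge0|].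
  set (W := qsum (fun m => w m * (z ^ j) ^ m)%quat n).
  replace (qsum (fun m => F m * (z ^ j) ^ m)%quat N)
    with (qsum (fun k => a k * (W * (z ^ j) ^ k))%quat K).
  - unfold z; rewrite slice_moivre by apply imag_unit_i.
    apply right_sum_bound; [apply imag_unit_i|easy].
  - unfold F; rewrite (qsum_ext (fun m => _ * (z ^ j) ^ m)%quat
     (fun m => qsum (fun k => (a k * qshift k (qtrunc n w) m) * (z ^ j) ^ m)%quat K))
     by (intros; now rewrite qsum_mult_r).
    rewrite qsum_switch; apply qsum_ext; intros k hk.
    rewrite (qsum_ext (fun m => _ * (z ^ j) ^ m)%quat
      (fun m => a k * (qshift k (qtrunc n w) m * (z ^ j) ^ m))%quat)
      by (intros; apply qmult_assoc).
    rewrite qsum_mult_l; f_equal.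
    replace N with (k + (N - k))%nat by lia.
    rewrite qsum_qshift, qsum_qtrunc by lia; easy. }
(* Below [n] the coefficients of [F] are those of [qconv a w]; the remaining squares are dropped. *)
apply Rle_trans with (2 := hF).
apply Rle_trans with (rsum (fun m => qnorm (F m) ^ 2) n).
- right; apply rsum_ext; intros m hm; do 2 f_equal; unfold F, qconv.
  replace K with (S m + (K - S m))%nat by lia.
  rewrite qsum_split, (qsum_0 _ (K - S m)), qplus_0_r.
  + apply qsum_ext; intros k hk; unfold qshift, qtrunc.
    destruct (Nat.leb_spec k m); [|lia].
    destruct (Nat.ltb_spec (m - k) n); [easy|lia].
  + intros k _; unfold qshift; destruct (Nat.leb_spec (S m + k) m); [lia|apply qmult_0_r].
- apply rsum_mono; [|lia]; intro; apply pow2_ge_0.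
Qed.

(** * Power series *)

Lemma norm_qnorm (q : quat) : norm q = qnorm q.
Proof.
change (norm q) with (sqrt (sqrt (sqrt (Rabs (qre q) ^ 2 + Rabs (qi q) ^ 2) ^ 2
  + Rabs (qj q) ^ 2) ^ 2 + Rabs (qk q) ^ 2)).
rewrite !pow2_sqrt; rewrite !pow2_abs; [easy|nra|nra].
Qed.

Definition qlim (u : nat -> quat) (l : quat) : Prop :=
  forall eps, 0 < eps -> exists N, forall n, (N <= n)%nat -> qnorm (u n - l)%quat < eps.

Lemma qlim_filterlim (u : nat -> quat) (l : quat) :
  filterlim u eventually (locally l) <-> qlim u l.
Proof.
rewrite (filterlim_locally_ball_norm (U := prod_NormedModule _ _ _) u l); split.
- intros h eps heps; destruct (h (mkposreal eps heps)) as [N hN].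
  exists N; intros n hn; specialize (hN n hn).
  unfold ball_norm in hN; rewrite <- norm_qnorm; exact hN.
- intros h [eps heps]; destruct (h eps heps) as [N hN].
  exists N; intros n hn; specialize (hN n hn).
  unfold ball_norm; rewrite <- norm_qnorm in hN; exact hN.
Qed.

Lemma sum_n_qsum (u : nat -> quat) n : sum_n u n = qsum u (S n).
Proof.
induction n as [|n IH].
- rewrite sum_O; cbn [qsum]; qring.
- rewrite sum_Sn, IH; reflexivity.
Qed.

Lemma qlim_incr_1 u l : qlim (fun n => u (S n)) l <-> qlim u l.
Proof.
split; intros h eps heps; destruct (h eps heps) as [N hN].
- exists (S N); intros [|n] hn; [lia|apply hN; lia].
- exists N; intros n hn; apply hN; lia.
Qed.

Lemma is_series_qlim (u : nat -> quat) (l : quat) :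
  is_series (u : nat -> quat) l <-> qlim (qsum u) l.
Proof.
unfold is_series; rewrite <- qlim_incr_1, <- qlim_filterlim.
split; apply filterlim_ext; intro n; [|symmetry]; apply sum_n_qsum.
Qed.

Lemma qlim_ext u v l : (forall n, u n = v n) -> qlim u l -> qlim v l.
Proof.
intros e h eps heps; destruct (h eps heps) as [N hN]; exists N; intros n hn.
rewrite <- e; auto.
Qed.

Lemma qlim_const c : qlim (fun _ => c) c.
Proof.
intros eps heps; exists O; intros _ _.
replace (c - c)%quat with (RtoQ 0) by qring; now rewrite qnorm_0.
Qed.

Lemma qlim_plus u v l m : qlim u l -> qlim v m -> qlim (fun n => u n + v n)%quat (l + m)%quat.
Proof.
intros hu hv eps heps.
destruct (hu (eps / 2)) as [N hN]; [lra|].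
destruct (hv (eps / 2)) as [M hM]; [lra|].
exists (max N M); intros n hn.
replace (u n + v n - (l + m))%quat with ((u n - l) + (v n - m))%quat by qring.
apply Rle_lt_trans with (1 := qnorm_triang _ _).
specialize (hN n ltac:(lia)); specialize (hM n ltac:(lia)); lra.
Qed.

Lemma qlim_mult_l c u l : qlim u l -> qlim (fun n => c * u n)%quat (c * l)%quat.
Proof.
intros hu eps heps; pose proof (qnorm_ge0 c).
destruct (hu (eps / (qnorm c + 1))) as [N hN]; [apply Rdiv_lt_0_compat; lra|].
exists N; intros n hn.
replace (c * u n - c * l)%quat with (c * (u n - l))%quat by qring.
rewrite qnorm_mult; specialize (hN n hn); pose proof (qnorm_ge0 (u n - l)%quat).
replace eps with ((qnorm c + 1) * (eps / (qnorm c + 1))) by (field; lra).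
assert (qnorm c * qnorm (u n - l)%quat <= qnorm c * (eps / (qnorm c + 1))); [nra|].
assert (0 < eps / (qnorm c + 1)) by lra; nra.
Qed.

Lemma qlim_minus u v l m : qlim u l -> qlim v m -> qlim (fun n => u n - v n)%quat (l - m)%quat.
Proof.
intros hu hv.
replace (l - m)%quat with (l + RtoQ (-1) * m)%quat by qring.
apply qlim_ext with (fun n => u n + RtoQ (-1) * v n)%quat; [intro; qring|].
now apply qlim_plus; [|apply qlim_mult_l].
Qed.

Lemma qlim_norm_le u l c : qlim u l -> (exists N, forall n, (N <= n)%nat -> qnorm (u n) <= c) ->
  qnorm l <= c.
Proof.
intros h [N hN]; apply Rnot_lt_le; intro hlt.
destruct (h (qnorm l - c)) as [M hM]; [lra|].
specialize (hN (max N M) ltac:(lia)); specialize (hM (max N M) ltac:(lia)).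
pose proof (qnorm_minus_triang (u (max N M)) (u (max N M) - l)%quat) as e.
replace (u (max N M) - (u (max N M) - l))%quat with l in e by qring.
lra.
Qed.

Lemma qlim_unique u l m : qlim u l -> qlim u m -> l = m.
Proof.
intros h h'.
assert (e : (l - m)%quat = RtoQ 0).
{ apply qnorm_eq0; pose proof (qnorm_ge0 (l - m)%quat).
  assert (qnorm (l - m)%quat <= 0); [|lra].
  apply (qlim_norm_le _ _ 0 (qlim_minus _ _ _ _ h h')); exists O; intros n _.
  replace (u n - u n)%quat with (RtoQ 0) by qring; rewrite qnorm_0; lra. }
replace l with ((l - m) + m)%quat by qring; rewrite e; qring.
Qed.

Lemma is_lim_seq_of_le (u : nat -> R) l (v : nat -> quat) m :
  (forall n, Rabs (u n - l) <= qnorm (v n - m)%quat) -> qlim v m -> is_lim_seq u l.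
Proof.
intros h hv; apply is_lim_seq_spec; intros [eps heps].
destruct (hv eps heps) as [N hN]; exists N; intros n hn; cbn.
apply Rle_lt_trans with (1 := h n), hN, hn.
Qed.

Lemma qlim_coord u l : qlim u l ->
  is_lim_seq (fun n => qre (u n)) (qre l) /\ is_lim_seq (fun n => qi (u n)) (qi l) /\
  is_lim_seq (fun n => qj (u n)) (qj l) /\ is_lim_seq (fun n => qk (u n)) (qk l).
Proof.
intro h; repeat split; apply (is_lim_seq_of_le _ _ u l); auto; intro n.
- exact (Rabs_qre_le (u n - l)%quat).
- exact (Rabs_qi_le (u n - l)%quat).
- exact (Rabs_qj_le (u n - l)%quat).
- exact (Rabs_qk_le (u n - l)%quat).
Qed.

Lemma qlim_of_coord u l :
  is_lim_seq (fun n => qre (u n)) (qre l) -> is_lim_seq (fun n => qi (u n)) (qi l) ->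
  is_lim_seq (fun n => qj (u n)) (qj l) -> is_lim_seq (fun n => qk (u n)) (qk l) ->
  qlim u l.
Proof.
intros h1 h2 h3 h4 eps heps.
apply is_lim_seq_spec in h1, h2, h3, h4.
assert (he : 0 < eps / 4) by lra.
destruct (h1 (mkposreal _ he)) as [N1 H1]; destruct (h2 (mkposreal _ he)) as [N2 H2].
destruct (h3 (mkposreal _ he)) as [N3 H3]; destruct (h4 (mkposreal _ he)) as [N4 H4].
exists (N1 + N2 + N3 + N4)%nat; intros n hn.
specialize (H1 n ltac:(lia)); specialize (H2 n ltac:(lia)).
specialize (H3 n ltac:(lia)); specialize (H4 n ltac:(lia)); cbn in *.
apply Rle_lt_trans with (2 * (eps / 4)); [|lra].
apply qnorm_le_max; autorewrite with qcoord; now apply Rlt_le.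
Qed.

Lemma qre_qsum u n : qre (qsum u n) = rsum (fun k => qre (u k)) n.
Proof. induction n as [|n IH]; cbn [qsum rsum]; [reflexivity|rewrite <- IH; reflexivity]. Qed.
Lemma qi_qsum u n : qi (qsum u n) = rsum (fun k => qi (u k)) n.
Proof. induction n as [|n IH]; cbn [qsum rsum]; [reflexivity|rewrite <- IH; reflexivity]. Qed.
Lemma qj_qsum u n : qj (qsum u n) = rsum (fun k => qj (u k)) n.
Proof. induction n as [|n IH]; cbn [qsum rsum]; [reflexivity|rewrite <- IH; reflexivity]. Qed.
Lemma qk_qsum u n : qk (qsum u n) = rsum (fun k => qk (u k)) n.
Proof. induction n as [|n IH]; cbn [qsum rsum]; [reflexivity|rewrite <- IH; reflexivity]. Qed.

Lemma is_series_rsum (u : nat -> R) (l : R) : is_series u l <-> is_lim_seq (rsum u) l.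
Proof.
rewrite is_lim_seq_incr_1; unfold is_series.
assert (e : forall n, sum_n u n = rsum u (S n)).
{ intro n; induction n as [|n IH].
  - rewrite sum_O; symmetry; apply Rplus_0_l.
  - rewrite sum_Sn, IH; reflexivity. }
split; apply filterlim_ext; intro n; [|symmetry]; apply e.
Qed.

Lemma qSeries_of_qlim u l : qlim (qsum u) l -> qSeries u = l.
Proof.
intro h; apply qlim_coord in h as [h1 [h2 [h3 h4]]].
apply quat_ext; apply is_series_unique, is_series_rsum;
 [revert h1|revert h2|revert h3|revert h4]; apply is_lim_seq_ext; intro n.
- apply qre_qsum.
- apply qi_qsum.
- apply qj_qsum.
- apply qk_qsum.
Qed.

Lemma ex_series_geom_bound (u : nat -> R) C t : 0 <= t < 1 ->
  (forall n, Rabs (u n) <= C * t ^ n) -> ex_series u.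
Proof.
intros ht h; apply (ex_series_le (V := R_CompleteNormedModule) u (fun n => C * t ^ n) h).
apply (ex_series_scal_l C (fun n => t ^ n)), ex_series_geom.
rewrite Rabs_right; lra.
Qed.

Lemma rsum_geom_le C t n : 0 <= C -> 0 <= t < 1 ->
  rsum (fun k => C * t ^ k) n <= C / (1 - t).
Proof.
intros hC ht; rewrite (rsum_scal C (pow t)).
assert (e : (1 - t) * rsum (pow t) n = 1 - t ^ n).
{ induction n as [|n IH]; cbn [rsum pow]; [ring|].
  rewrite Rmult_plus_distr_l, IH; ring. }
apply Rmult_le_compat_l; [easy|].
apply Rmult_le_reg_l with (1 - t); [lra|].
rewrite e, Rinv_r by lra; pose proof (pow_le t n); lra.
Qed.

Lemma qSeries_geom u C t : 0 <= t < 1 -> (forall n, qnorm (u n) <= C * t ^ n) ->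
  qlim (qsum u) (qSeries u) /\ qnorm (qSeries u) <= C / (1 - t).
Proof.
intros ht h.
assert (hC : 0 <= C).
{ specialize (h O); pose proof (qnorm_ge0 (u O)); cbn [pow] in h; lra. }
assert (hl : qlim (qsum u) (qSeries u)).
{ assert (aux : forall pr : quat -> R, (forall q, Rabs (pr q) <= qnorm q) ->
    (forall n, pr (qsum u n) = rsum (fun k => pr (u k)) n) ->
    is_lim_seq (fun n => pr (qsum u n)) (Series (fun n => pr (u n)))).
  { intros pr h1 h2; apply is_lim_seq_ext with (rsum (fun k => pr (u k))).
    - intro; now rewrite h2.
    - apply is_series_rsum, Series_correct, (ex_series_geom_bound _ C t ht).
      intro n; apply Rle_trans with (1 := h1 _), h. }
  apply qlim_of_coord; apply aux; auto using Rabs_qre_le, Rabs_qi_le, Rabs_qj_le,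
    Rabs_qk_le, qre_qsum, qi_qsum, qj_qsum, qk_qsum. }
split; [easy|].
apply (qlim_norm_le _ _ _ hl); exists O; intros n _.
apply Rle_trans with (1 := qnorm_qsum u n).
apply Rle_trans with (2 := rsum_geom_le C t n hC ht), rsum_le; auto.
Qed.

Lemma qlim_tail_geom u l C t K : 0 <= t < 1 -> (forall n, qnorm (u n) <= C * t ^ n) ->
  qlim (qsum u) l -> qnorm (l - qsum u K)%quat <= C / (1 - t) * t ^ K.
Proof.
intros ht h hl.
assert (h' : forall n, qnorm (u (K + n)%nat) <= C * t ^ K * t ^ n).
{ intro n; rewrite Rmult_assoc, <- pow_add; auto. }
destruct (qSeries_geom (fun n => u (K + n)%nat) _ t ht h') as [h1 h2].
replace (l - qsum u K)%quat with (qSeries (fun n => u (K + n)%nat)).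
- apply Rle_trans with (1 := h2); right; field; lra.
- apply qSeries_of_qlim.
  assert (hl' : qlim (fun n => qsum u (K + n)) l).
  { intros eps heps; destruct (hl eps heps) as [N hN]; exists N; intros; apply hN; lia. }
  apply (qlim_ext (fun n => qsum u (K + n) - qsum u K)%quat).
  + intro n; rewrite qsum_split; qring.
  + apply qlim_minus; [easy|apply qlim_const].
Qed.

(** Says that the radius of convergence is at least 1, in a form that passes easily to the sequences
    built from [a]. *)
Definition subexponential (a : nat -> quat) : Prop :=
  forall s, 0 < s < 1 -> exists C, forall n, qnorm (a n) * s ^ n <= C.

(** The hypothesis is applied at the midpoint [s] of [r] and 1; the decay rate is then
    [t = r / s]. *)
Lemma subexponential_geom a r : subexponential a -> 0 <= r < 1 ->
  exists C t, 0 <= t < 1 /\ 0 <= C /\ forall n, qnorm (a n) * r ^ n <= C * t ^ n.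
Proof.
intros h hr; destruct (h ((1 + r) / 2)) as [C hC]; [lra|].
exists C, (r / ((1 + r) / 2)); split; [|split].
- split; [apply Rmult_le_pos; [lra|left; apply Rinv_0_lt_compat; lra]|].
  apply Rmult_lt_reg_r with ((1 + r) / 2); [lra|].
  unfold Rdiv at 1; rewrite Rmult_assoc, Rinv_l by lra; lra.
- specialize (hC O); pose proof (qnorm_ge0 (a O)); cbn [pow] in hC; lra.
- intro n.
  replace (r ^ n) with (((1 + r) / 2) ^ n * (r / ((1 + r) / 2)) ^ n).
  + rewrite <- Rmult_assoc; apply Rmult_le_compat_r; [|apply hC].
    apply pow_le, Rmult_le_pos; [lra|left; apply Rinv_0_lt_compat; lra].
  + rewrite <- Rpow_mult_distr; f_equal; field; lra.
Qed.

Lemma subexponential_term a r : subexponential a -> 0 <= r < 1 ->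
  exists C t, 0 <= t < 1 /\ 0 <= C /\
  forall q n, qnorm q <= r -> qnorm (q ^ n * a n)%quat <= C * t ^ n.
Proof.
intros h hr; destruct (subexponential_geom a r h hr) as [C [t [h1 [h2 h3]]]].
exists C, t; split; [easy|split; [easy|]]; intros q n hq.
apply Rle_trans with (2 := h3 n).
rewrite qnorm_mult, qnorm_pow, Rmult_comm.
apply Rmult_le_compat_l; [apply qnorm_ge0|apply pow_incr; split; [apply qnorm_ge0|easy]].
Qed.

Definition power_series (a : nat -> quat) (q : quat) : quat :=
  qSeries (fun n => q ^ n * a n)%quat.

Lemma power_series_lim a q : subexponential a -> qnorm q < 1 ->
  qlim (qsum (fun n => q ^ n * a n)%quat) (power_series a q).
Proof.
intros h hq.
destruct (subexponential_term a (qnorm q) h) as [C [t [h1 [h2 h3]]]];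
  [split; [apply qnorm_ge0|easy]|].
apply (qSeries_geom _ C t h1); intro n; apply h3, Rle_refl.
Qed.

Lemma power_series_bounded a r : subexponential a -> 0 <= r < 1 ->
  exists M, 0 <= M /\ forall q, qnorm q <= r -> qnorm (power_series a q) <= M.
Proof.
intros h hr; destruct (subexponential_term a r h hr) as [C [t [h1 [h2 h3]]]].
exists (C / (1 - t)); split.
- apply Rmult_le_pos; [easy|left; apply Rinv_0_lt_compat; lra].
- intros q hq; apply (qSeries_geom _ C t h1); intro n; now apply h3.
Qed.

Lemma has_coefs_lim f a q : has_coefs f a -> qnorm q < 1 ->
  qlim (qsum (fun n => q ^ n * a n)%quat) (f q).
Proof. intros h hq; apply is_series_qlim, h, hq. Qed.

Lemma coefs_bounded a s l : 0 < s ->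
  qlim (qsum (fun n => RtoQ s ^ n * a n)%quat) l ->
  exists C, forall n, qnorm (a n) * s ^ n <= C.
Proof.
intros hs hl; destruct (hl 1) as [N hN]; [lra|].
set (u := fun n => qnorm (a n) * s ^ n).
(* From index [N] on the partial sums stay within 1 of the limit, so a term, being a difference of
   two of them, has norm below 2. Each earlier term is at most the sum of the first [N]. *)
exists (2 + rsum u N); intro n; fold (u n).
assert (hu : forall k, 0 <= u k).
{ intro; apply Rmult_le_pos; [apply qnorm_ge0|apply pow_le; lra]. }
destruct (Nat.le_gt_cases N n) as [hn|hn].
- pose proof (rsum_ge0 u N hu).
  pose proof (hN n hn) as e1; pose proof (hN (S n) ltac:(lia)) as e2.
  cbn [qsum] in e2.
  set (S0 := qsum (fun n => RtoQ s ^ n * a n)%quat n) in *.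
  pose proof (qnorm_minus_triang (S0 + RtoQ s ^ n * a n - l) (S0 - l))%quat as e3.
  replace (S0 + RtoQ s ^ n * a n - l - (S0 - l))%quat
    with (RtoQ s ^ n * a n)%quat in e3 by qring.
  rewrite qnorm_mult, qnorm_pow, qnorm_RtoQ, Rabs_right, Rmult_comm in e3 by lra.
  fold (u n) in e3; lra.
- pose proof (rsum_mono u (S n) N hu ltac:(lia)) as e; cbn [rsum] in e.
  pose proof (rsum_ge0 u n hu); lra.
Qed.

Lemma has_coefs_subexponential f a : has_coefs f a -> subexponential a.
Proof.
intros h s hs; apply (coefs_bounded a s (f (RtoQ s))); [lra|].
apply has_coefs_lim; [easy|rewrite qnorm_RtoQ, Rabs_right; lra].
Qed.

Lemma has_coefs_power_series f a q : has_coefs f a -> qnorm q < 1 -> f q = power_series a q.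
Proof.
intros h hq; symmetry; apply qSeries_of_qlim; now apply has_coefs_lim.
Qed.

Lemma power_series_has_coefs a : subexponential a -> has_coefs (power_series a) a.
Proof. intros h q hq; now apply is_series_qlim, power_series_lim. Qed.

Lemma CV_radius_coefs_bounded (u : nat -> R) (a : nat -> quat) s C : 0 < s ->
  (forall n, qnorm (a n) * s ^ n <= C) -> (forall n, Rabs (u n) <= qnorm (a n)) ->
  Rbar_lt 0 (CV_radius u).
Proof.
intros hs hC hu; apply Rbar_lt_le_trans with s; [easy|].
apply CV_radius_bounded; exists C; intro n; apply Rle_trans with (2 := hC n).
rewrite Rabs_mult; rewrite (Rabs_right (s ^ n)); [|apply Rle_ge, pow_le; lra].
apply Rmult_le_compat_r; [apply pow_le; lra|apply hu].
Qed.

Lemma pseries_coef_eq (u v : nat -> R) d : 0 < d ->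
  Rbar_lt 0 (CV_radius u) -> Rbar_lt 0 (CV_radius v) ->
  (forall x, Rabs x < d -> PSeries u x = PSeries v x) -> forall n, u n = v n.
Proof.
intros hd hu hv h n.
apply Rmult_eq_reg_r with (INR (Factorial.fact n)); [|apply INR_fact_neq_0].
rewrite <- !Derive_n_coef by easy; apply Derive_n_ext_loc.
exists (mkposreal d hd); intros x hx; apply h.
change (Rabs (x - 0) < d) in hx; now rewrite Rminus_0_r in hx.
Qed.

Lemma RtoQ_pow x n : (RtoQ x ^ n)%quat = RtoQ (x ^ n).
Proof. induction n as [|n IH]; cbn [qpow pow]; [easy|rewrite IH; qring]. Qed.

(** At real points the powers are real scalars, so each coordinate is an ordinary real power series,
    whose coefficients are derivatives at 0. Agreement on a small real interval is enough, and all
    slices share the real axis. *)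
Lemma coefs_unique a b d : 0 < d ->
  (forall x, Rabs x < d -> exists l, qlim (qsum (fun n => RtoQ x ^ n * a n)%quat) l /\
     qlim (qsum (fun n => RtoQ x ^ n * b n)%quat) l) ->
  forall n, a n = b n.
Proof.
intros hd h n.
destruct (h (d / 2)) as [l [la lb]]; [rewrite Rabs_right; lra|].
apply coefs_bounded in la as [Ca hCa]; [|lra]; apply coefs_bounded in lb as [Cb hCb]; [|lra].
assert (aux : forall pr : quat -> R, (forall q, Rabs (pr q) <= qnorm q) ->
    (forall r q, pr (qscal r q) = r * pr q) ->
    (forall u, Series (fun n => pr (u n)) = pr (qSeries u)) ->
    pr (a n) = pr (b n)).
{ intros pr h1 h2 h3.
  apply (pseries_coef_eq (fun n => pr (a n)) (fun n => pr (b n)) d hd);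
    [apply (CV_radius_coefs_bounded _ a (d / 2) Ca); auto; lra
    |apply (CV_radius_coefs_bounded _ b (d / 2) Cb); auto; lra|].
  intros x hx; destruct (h x hx) as [m [ma mb]].
  apply qSeries_of_qlim in ma, mb.
  assert (e : forall c, PSeries (fun n => pr (c n)) x =
    pr (qSeries (fun n => RtoQ x ^ n * c n)%quat)).
  { intro c; rewrite <- h3; apply Series_ext; intro k.
    replace (RtoQ x ^ k * c k)%quat with (qscal (x ^ k) (c k))
      by (rewrite RtoQ_pow; qring).
    rewrite h2; ring. }
  now rewrite !e, ma, mb. }
apply quat_ext; apply aux; auto using Rabs_qre_le, Rabs_qi_le, Rabs_qj_le, Rabs_qk_le.
Qed.

Lemma has_coefs_unique f g a b : has_coefs f a -> has_coefs g b ->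
  (forall q, unit_ball q -> f q = g q) -> forall n, a n = b n.
Proof.
intros ha hb h; apply (coefs_unique a b 1); [lra|]; intros x hx.
assert (hq : qnorm (RtoQ x) < 1) by (rewrite qnorm_RtoQ; lra).
exists (f (RtoQ x)); split; [now apply has_coefs_lim|].
rewrite h by easy; now apply has_coefs_lim.
Qed.

(** Uniqueness makes the choice inside [coef] harmless: any known expansion may replace it. *)
Lemma coef_eq f a : has_coefs f a -> forall n, coef f n = a n.
Proof.
intro h; apply (has_coefs_unique f f); auto; unfold coef.
apply epsilon_spec; now exists a.
Qed.

(** * Formal division by q - q0 *)

(** The identity [f - c = (q - q0) * k] between regular functions, read coefficient by
    coefficient. *)
Definition quotient_coefs (q0 c : quat) (a k : nat -> quat) : Prop :=
  a O = (c - q0 * k O)%quat /\ forall n, a (S n) = (k n - q0 * k (S n))%quat.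

(** The recursion [k n = a (S n) + q0 * k (S n)] unrolled upwards without end. Solving it in this
    direction gives a convergent quotient without dividing by [q0]. *)
Definition tail_coef (q0 : quat) (a : nat -> quat) (n : nat) : quat :=
  qSeries (fun m => q0 ^ m * a (S n + m)%nat)%quat.

(** An estimate uniform in [n] and [m]: decay in [m] gives convergence of each tail, and the weight
    [s ^ n] controls the growth of the tails. *)
Lemma tail_coef_geom q0 a s : subexponential a -> qnorm q0 < s -> s < 1 ->
  exists C t, 0 <= t < 1 /\ 0 <= C /\
  forall n m, s ^ n * qnorm (q0 ^ m * a (n + m)%nat)%quat <= C * t ^ m.
Proof.
intros ha h1 h2; pose proof (qnorm_ge0 q0); destruct (ha s) as [C hC]; [lra|].
exists C, (qnorm q0 / s); split; [|split].
- split; [apply Rmult_le_pos; [lra|left; apply Rinv_0_lt_compat; lra]|].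
  apply Rmult_lt_reg_r with s; [lra|].
  unfold Rdiv; rewrite Rmult_assoc, Rinv_l by lra; lra.
- specialize (hC O); pose proof (qnorm_ge0 (a O)); cbn [pow] in hC; lra.
- intros n m; rewrite qnorm_mult, qnorm_pow.
  replace (s ^ n * (qnorm q0 ^ m * qnorm (a (n + m)%nat)))
   with ((qnorm (a (n + m)%nat) * s ^ (n + m)) * (qnorm q0 / s) ^ m).
  + apply Rmult_le_compat_r; [|apply hC].
    apply pow_le, Rmult_le_pos; [lra|left; apply Rinv_0_lt_compat; lra].
  + rewrite pow_add; unfold Rdiv; rewrite Rpow_mult_distr, pow_inv.
    field; apply pow_nonzero; lra.
Qed.

Lemma tail_coef_lim q0 a n : subexponential a -> qnorm q0 < 1 ->
  qlim (qsum (fun m => q0 ^ m * a (S n + m)%nat)%quat) (tail_coef q0 a n).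
Proof.
intros ha hq.
destruct (tail_coef_geom q0 a ((1 + qnorm q0) / 2) ha) as [C [t [ht [hC h]]]]; [lra|lra|].
assert (hs : 0 < ((1 + qnorm q0) / 2) ^ S n) by (apply pow_lt; pose proof (qnorm_ge0 q0); lra).
apply (qSeries_geom _ (C / ((1 + qnorm q0) / 2) ^ S n) t ht); intro m.
apply Rmult_le_reg_l with (1 := hs); apply Rle_trans with (1 := h _ _).
set (p := _ ^ S n) in *; right; field.
now apply Rgt_not_eq.
Qed.

Lemma tail_coef_subexponential q0 a : subexponential a -> qnorm q0 < 1 ->
  subexponential (tail_coef q0 a).
Proof.
intros ha hq s hs; pose proof (qnorm_ge0 q0) as h0.
(* The radius has to be at least [s], for the conclusion, and larger than [qnorm q0], for the
   geometric estimate. *)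
set (r := Rmax s ((1 + qnorm q0) / 2)).
assert (hr : s <= r /\ (1 + qnorm q0) / 2 <= r /\ r < 1).
{ unfold r; repeat split; [apply Rmax_l|apply Rmax_r|apply Rmax_lub_lt; lra]. }
destruct (tail_coef_geom q0 a r ha) as [C [t [ht [hC h]]]]; [lra|lra|].
exists (C / (1 - t) / r); intro n.
assert (hrn : 0 < r ^ S n) by (apply pow_lt; lra).
apply Rle_trans with (qnorm (tail_coef q0 a n) * r ^ n).
{ apply Rmult_le_compat_l; [apply qnorm_ge0|apply pow_incr; lra]. }
apply Rmult_le_reg_r with r; [lra|].
replace (C / (1 - t) / r * r) with (C / (1 - t)) by (field; lra).
replace (qnorm (tail_coef q0 a n) * r ^ n * r) with (qnorm (RtoQ (r ^ S n) * tail_coef q0 a n)%quat)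
  by (rewrite qnorm_mult, qnorm_RtoQ, Rabs_right by lra; cbn [pow]; ring).
apply (qlim_norm_le _ _ _ (qlim_mult_l (RtoQ (r ^ S n)) _ _ (tail_coef_lim q0 a n ha hq))).
exists O; intros m _; rewrite <- qsum_mult_l.
apply Rle_trans with (1 := qnorm_qsum _ m).
apply Rle_trans with (2 := rsum_geom_le C t m hC ht), rsum_le; intros j _.
rewrite qnorm_mult, qnorm_RtoQ, Rabs_right by lra; apply h.
Qed.

Lemma qlim_qsum_S_l u l : qlim (qsum (fun m => u (S m))) l -> qlim (qsum u) (u O + l)%quat.
Proof.
intro h; apply qlim_incr_1.
apply qlim_ext with (fun n => u O + qsum (fun m => u (S m)) n)%quat.
- intro n; symmetry; apply qsum_S_l.
- apply qlim_plus; [apply qlim_const|easy].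
Qed.

Lemma tail_coef_quotient q0 a : subexponential a -> qnorm q0 < 1 ->
  quotient_coefs q0 (power_series a q0) a (tail_coef q0 a).
Proof.
intros ha hq.
assert (h : forall (b : nat -> quat) l, qlim (qsum (fun m => q0 ^ m * b (S m))%quat) l ->
   qlim (qsum (fun m => q0 ^ m * b m)%quat) (b O + q0 * l)%quat).
{ intros b l hb; rewrite <- (qmult_1_l (b O)).
  apply (qlim_qsum_S_l (fun m => q0 ^ m * b m)%quat).
  apply qlim_ext with (2 := qlim_mult_l q0 _ _ hb); intro n.
  rewrite <- qsum_mult_l; apply qsum_ext; intros; cbn [qpow]; now rewrite qmult_assoc. }
split; [|intro n].
- rewrite (qlim_unique _ _ _ (power_series_lim a q0 ha hq)
    (h a (tail_coef q0 a O) (tail_coef_lim q0 a O ha hq))); qring.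
- assert (e := h (fun m => a (S n + m)%nat) (tail_coef q0 a (S n))).
  cbn beta in e; rewrite Nat.add_0_r in e.
  rewrite (qlim_unique _ _ _ (tail_coef_lim q0 a n ha hq) (e ltac:(
    apply qlim_ext with (2 := tail_coef_lim q0 a (S n) ha hq); intro m;
    apply qsum_ext; intros; do 2 f_equal; lia))); qring.
Qed.

(** At points commuting with [q0], the constant can be moved past the powers of [q], and the regular
    product with [q - q0] becomes the pointwise one. *)
Lemma quotient_coefs_eval q0 c a k q : quotient_coefs q0 c a k ->
  subexponential a -> subexponential k -> qnorm q < 1 -> (q * q0)%quat = (q0 * q)%quat ->
  (power_series a q - c)%quat = ((q - q0) * power_series k q)%quat.
Proof.
intros [h0 hS] ha hk hq hc.
pose proof (power_series_lim k q hk hq) as lk.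
pose proof (power_series_lim a q ha hq) as la.
assert (hqn : forall n, (q ^ n * q0)%quat = (q0 * q ^ n)%quat).
{ intro n; induction n as [|n IH]; cbn [qpow]; [qring|].
  now rewrite qmult_assoc, IH, <- qmult_assoc, hc, qmult_assoc. }
apply (qlim_unique (fun n => qsum (fun n => q ^ n * a n)%quat (S n) - c)%quat).
- apply qlim_minus; [|apply qlim_const]; now apply (qlim_incr_1 (qsum _)).
- apply qlim_ext with (fun n => q * qsum (fun n => q ^ n * k n) n -
    q0 * qsum (fun n => q ^ n * k n) (S n))%quat.
  + intro n; rewrite !qsum_S_l; cbn [qpow]; rewrite h0.
    rewrite (qsum_ext (fun m => q * q ^ m * a (S m))%quat
      (fun m => q * (q ^ m * k m) - q0 * (q * q ^ m * k (S m)))%quat).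
    * rewrite qsum_minus, !qsum_mult_l; qring.
    * intros m _; rewrite hS.
      replace (q0 * (q * q ^ m * k (S m)))%quat with ((q ^ S m * q0) * k (S m))%quat
        by (rewrite hqn; cbn [qpow]; qring).
      cbn [qpow]; qring.
  + replace ((q - q0) * power_series k q)%quat
      with (q * power_series k q - q0 * power_series k q)%quat by qring.
    apply qlim_minus; apply qlim_mult_l; [easy|now apply (qlim_incr_1 (qsum _))].
Qed.

Lemma qscal_qsum r u n : qsum (fun k => qscal r (u k)) n = qscal r (qsum u n).
Proof. induction n as [|n IH]; cbn [qsum]; [qring|rewrite IH; qring]. Qed.

(** * The Toeplitz contraction and rigidity *)

Lemma limit_at_0_ge0 (g : R -> R) : continuous g 0 ->
  (forall e, 0 < e < 1 -> 0 <= g e) -> 0 <= g 0.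
Proof.
intros hc h; apply Rnot_lt_le; intro hlt.
destruct (proj1 (filterlim_locally _ _) hc (mkposreal (- g 0) ltac:(lra))) as [d hd].
set (e := Rmin (d / 2) (1 / 2)).
assert (he : 0 < e < 1 /\ e < d).
{ pose proof (cond_pos d); pose proof (Rmin_l (d / 2) (1 / 2)).
  pose proof (Rmin_r (d / 2) (1 / 2)).
  assert (0 < e) by (apply Rmin_glb_lt; lra); unfold e in *; lra. }
assert (hb : ball 0 d e).
{ change (Rabs (e - 0) < d); rewrite Rminus_0_r, Rabs_right; lra. }
apply hd in hb; change (Rabs (g e - g 0) < - g 0) in hb.
apply Rabs_def2 in hb; specialize (h e (proj1 he)); lra.
Qed.

(** The polynomial case is applied to a partial sum of [f (r q)] with [r = 1 - e], which is bounded
    by [1 + e] on the closed ball. Weighting both [a] and [w] by [r ^ k] multiplies the coefficient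
    of index [m] of the product by [r ^ m], which is at least [r ^ n] for [m < n]. Since [n] is
    fixed, letting [e] tend to 0 removes both losses. *)
Lemma toeplitz_contraction f a : has_coefs f a ->
  (forall q, unit_ball q -> qnorm (f q) <= 1) -> forall w n,
  rsum (fun m => qnorm (qconv a w m) ^ 2) n <= rsum (fun m => qnorm (w m) ^ 2) n.
Proof.
intros hfa hf w n.
set (X := rsum (fun m => qnorm (qconv a w m) ^ 2) n).
set (W := rsum (fun m => qnorm (w m) ^ 2) n).
assert (hX : 0 <= X) by (apply rsum_ge0; intro; apply pow2_ge_0).
assert (hW : 0 <= W) by (apply rsum_ge0; intro; apply pow2_ge_0).
assert (main : forall e, 0 < e < 1 -> 0 <= (1 + e) ^ 2 * W - (1 - e) ^ (2 * n) * X).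
{ intros e he; set (r := 1 - e).
  pose proof (has_coefs_subexponential f a hfa) as ha.
  destruct (subexponential_term a r ha) as [C [t [ht [hC0 hC]]]]; [unfold r; lra|].
  (* The truncation error is at most [e], uniformly on the ball of radius [r]. *)
  assert (exists K0, forall K, (K0 <= K)%nat -> C / (1 - t) * t ^ K <= e) as [K0 hK0].
  { assert (hl : is_lim_seq (fun K => C / (1 - t) * t ^ K) (C / (1 - t) * 0)).
    { apply (is_lim_seq_scal_l _ (C / (1 - t)) 0), is_lim_seq_geom.
      rewrite Rabs_right; lra. }
    apply is_lim_seq_spec in hl; destruct (hl (mkposreal e ltac:(lra))) as [N hN].
    exists N; intros K hK; specialize (hN K hK); cbn in hN.
    rewrite Rmult_0_r, Rminus_0_r in hN; apply Rabs_def2 in hN; lra. }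
  set (K := max K0 n).
  assert (hB : forall q, qnorm q <= 1 ->
    qnorm (qsum (fun k => q ^ k * qscal (r ^ k) (a k))%quat K) <= 1 + e).
  { intros q hq; set (p := qscal r q).
    assert (hp : qnorm p <= r).
    { unfold p; rewrite qnorm_scal, Rabs_right by (unfold r; lra).
      assert (0 < r) by (unfold r; lra); nra. }
    assert (hp1 : qnorm p < 1) by (unfold r in *; lra).
    rewrite (qsum_ext _ (fun k => p ^ k * a k)%quat).
    - replace (qsum (fun k => p ^ k * a k)%quat K) with
        (f p - (f p - qsum (fun k => p ^ k * a k) K))%quat by qring.
      apply Rle_trans with (1 := qnorm_minus_triang _ _).
      apply Rplus_le_compat; [now apply hf|].
      apply Rle_trans with (2 := hK0 K ltac:(lia)).
      apply qlim_tail_geom; [easy|intro m; now apply hC|now apply has_coefs_lim].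
    - intros k _; replace (p ^ k)%quat with (qscal (r ^ k) (q ^ k)%quat); [qring|].
      unfold p; induction k as [|k IH]; cbn [qpow pow]; [qring|rewrite <- IH; qring]. }
  pose proof (toeplitz_polynomial (fun k => qscal (r ^ k) (a k))
    (fun k => qscal (r ^ k) (w k)) K (1 + e) n ltac:(lia) hB) as hT.
  assert (r ^ (2 * n) * X <= (1 + e) ^ 2 * W); [|lra].
  assert (hr : 0 <= r <= 1) by (unfold r; lra).
  apply Rle_trans with (rsum (fun m => qnorm (qconv (fun k => qscal (r ^ k) (a k))
          (fun k => qscal (r ^ k) (w k)) m) ^ 2) n).
  - unfold X; rewrite <- rsum_scal; apply rsum_le; intros m hm.
    replace (qconv (fun k => qscal (r ^ k) (a k)) _ m) with (qscal (r ^ m) (qconv a w m)).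
    + rewrite qnorm_scal, Rabs_right by (apply Rle_ge, pow_le; lra).
      rewrite Rpow_mult_distr, <- pow_mult, (Nat.mul_comm m).
      apply Rmult_le_compat_r; [apply pow2_ge_0|].
      replace (2 * n)%nat with (2 * m + 2 * (n - m))%nat by lia.
      rewrite pow_add; pose proof (pow_le r (2 * m) (proj1 hr)).
      pose proof (pow_incr r 1 (2 * (n - m)) hr) as h1; rewrite pow1 in h1; nra.
    + unfold qconv; rewrite <- qscal_qsum; apply qsum_ext; intros k hk.
      replace (r ^ m) with (r ^ k * r ^ (m - k)) by (rewrite <- pow_add; f_equal; lia).
      qring.
  - apply Rle_trans with (1 := hT); apply Rmult_le_compat_l; [apply pow2_ge_0|].
    apply rsum_le; intros m _; apply pow_incr; split; [apply qnorm_ge0|].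
    rewrite qnorm_scal, Rabs_right by (apply Rle_ge, pow_le; lra).
    pose proof (pow_incr r 1 m hr) as h1; rewrite pow1 in h1.
    pose proof (qnorm_ge0 (w m)); nra. }
assert (h0 : 0 <= (fun e => (1 + e) ^ 2 * W - (1 - e) ^ (2 * n) * X) 0).
{ apply (limit_at_0_ge0 (fun e => (1 + e) ^ 2 * W - (1 - e) ^ (2 * n) * X)); [|exact main].
  apply (ex_derive_continuous (V := R_NormedModule)); auto_derive; easy. }
cbn beta in h0; rewrite Rminus_0_r, Rplus_0_r, !pow1 in h0; lra.
Qed.

(** Associativity of the regular product, [((q - q0) * k) * w = (q - q0) * (k * w)]. *)
Lemma quotient_coefs_conv q0 d k w : quotient_coefs q0 (RtoQ 0) d k ->
  quotient_coefs q0 (RtoQ 0) (qconv d w) (qconv k w).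
Proof.
intros [h0 hS]; split.
- unfold qconv; cbn [qsum]; rewrite h0; qring.
- intro n; unfold qconv.
  rewrite (qsum_S_l _ (S n)), (qsum_S_l (fun j => k j * _)%quat (S n)), h0.
  rewrite (qsum_ext (fun j => d (S j) * w (S n - S j)%nat)%quat
    (fun j => k j * w (n - j)%nat - q0 * (k (S j) * w (S n - S j)%nat))%quat).
  + rewrite qsum_minus, qsum_mult_l; qring.
  + intros j hj; rewrite hS; cbn [Nat.sub]; qring.
Qed.

(** The values solve the Sylvester equations [q1 * x - x * q0 = q1^n - q0^n]. The recursion needs no
    division, so [q1 = q0] is not a special case: there it gives [n q0^(n-1)]. *)
Fixpoint sylvester (q0 q1 : quat) (n : nat) : quat :=
  match n with
  | O => RtoQ 0
  | S m => (sylvester q0 q1 m * q0 + q1 ^ m)%quat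
  end.

(* [sylvester q0 q1] represents the functional sending [(q - q0) * G] to [G q1]. *)
Lemma sylvester_telescope q0 q1 D G K : quotient_coefs q0 (RtoQ 0) D G ->
  qsum (fun n => sylvester q0 q1 n * D n)%quat (S K) =
  (qsum (fun n => q1 ^ n * G n) K - sylvester q0 q1 K * (q0 * G K))%quat.
Proof.
intros [h0 hS]; induction K as [|K IH].
- cbn [qsum sylvester]; qring.
- change (qsum ?u (S (S K))) with (qsum u (S K) + u (S K))%quat.
  rewrite IH, hS; cbn [qsum sylvester]; qring.
Qed.

(** The true size is of order [n r^(n-1)]; enlarging the ratio to [s] absorbs the factor [n]. The
    constant is the one for which [c s^(n+1) = c s^n r + s^n], which makes the induction close. *)
Lemma sylvester_bound q0 q1 r s n : qnorm q0 <= r -> qnorm q1 <= r -> r < s ->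
  qnorm (sylvester q0 q1 n) <= / (s - r) * s ^ n.
Proof.
intros h0 h1 hs; pose proof (qnorm_ge0 q0).
assert (hi : 0 < / (s - r)) by (apply Rinv_0_lt_compat; lra).
induction n as [|n IH]; cbn [sylvester].
- rewrite qnorm_0; cbn [pow]; lra.
- apply Rle_trans with (1 := qnorm_triang _ _); rewrite qnorm_mult, qnorm_pow.
  assert (qnorm q1 ^ n <= s ^ n) by (apply pow_incr; split; [apply qnorm_ge0|lra]).
  assert (e : / (s - r) * s ^ S n = / (s - r) * s ^ n * r + s ^ n)
    by (cbn [pow]; field; lra).
  rewrite e; pose proof (qnorm_ge0 (sylvester q0 q1 n)); nra.
Qed.

Lemma qsum_rev u n : qsum (fun k => u (n - k)%nat) (S n) = qsum u (S n).
Proof.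
induction n as [|n IH]; [easy|].
rewrite qsum_S_l; cbn [Nat.sub]; rewrite IH; cbn [qsum]; qring.
Qed.

(** Two enumerations of the pairs with [j + m < K], by diagonals and by columns. *)
Lemma qsum_triangle (T : nat -> nat -> quat) K :
  qsum (fun n => qsum (fun j => T j (n - j)%nat) (S n)) K =
  qsum (fun m => qsum (fun j => T j m) (K - m)) K.
Proof.
rewrite (qsum_ext _ (fun n => qsum (fun m => T (n - m)%nat m) (S n))).
2:{ intros n _; rewrite <- (qsum_rev (fun m => T (n - m)%nat m)); apply qsum_ext.
    intros j hj; f_equal; lia. }
induction K as [|K IH]; [easy|].
change (qsum ?u (S K)) with (qsum u K + u K)%quat; cbn beta; rewrite IH.
rewrite (qsum_ext (fun m => qsum _ (S K - m))
  (fun m => qsum (fun j => T j m) (K - m) + T (K - m)%nat m)%quat).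
- rewrite qsum_plus; replace (S K - K)%nat with 1%nat by lia.
  cbn [qsum]; rewrite Nat.sub_diag; qring.
- intros m hm; rewrite Nat.sub_succ_l by lia; easy.
Qed.

(** With [v = sqrt t], one factor [v ^ n] absorbs the linear growth, because
    [(n + 1) v^n <= 1 + v + ... + v^n]; the other one supplies the decay. *)
Lemma succ_mul_geom_lim t : 0 <= t < 1 -> is_lim_seq (fun n => INR (S n) * t ^ n) 0.
Proof.
intro ht; set (v := sqrt t).
assert (hv : 0 <= v < 1).
{ split; [apply sqrt_pos|]; unfold v; rewrite <- sqrt_1; apply sqrt_lt_1; lra. }
assert (hvv : v * v = t) by (apply sqrt_sqrt; lra).
apply is_lim_seq_le_le with (u := fun _ => 0) (w := fun n => 1 / (1 - v) * v ^ n).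
- intro n; split; [apply Rmult_le_pos; [apply pos_INR|apply pow_le; lra]|].
  rewrite <- hvv, Rpow_mult_distr, <- Rmult_assoc.
  apply Rmult_le_compat_r; [apply pow_le; lra|].
  apply Rle_trans with (2 := rsum_geom_le 1 v (S n) ltac:(lra) hv).
  rewrite <- rsum_const; apply rsum_le; intros k hk; rewrite Rmult_1_l.
  replace n with (k + (n - k))%nat by lia; rewrite pow_add.
  pose proof (pow_le v k (proj1 hv)).
  pose proof (pow_incr v 1 (n - k) ltac:(lra)) as h1; rewrite pow1 in h1; nra.
- apply is_lim_seq_const.
- replace (Finite 0) with (Rbar_mult (1 / (1 - v)) 0) by (cbn; f_equal; ring).
  apply is_lim_seq_scal_l, is_lim_seq_geom; rewrite Rabs_right; lra.
Qed.

(* The defect of the functional represented by [sylvester q0 q1] on truncations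
   of [(q - q0) * k * w], when [k q1 = 0]. *)
Lemma sylvester_defect q0 q1 d k w C s : quotient_coefs q0 (RtoQ 0) d k ->
  subexponential k -> qnorm q0 < 1 -> qnorm q1 < 1 -> power_series k q1 = RtoQ 0 ->
  0 <= s < 1 -> (forall n, qnorm (w n) <= C * s ^ n) ->
  exists M t, 0 <= t < 1 /\ forall K,
    qnorm (qsum (fun n => sylvester q0 q1 n * qconv d w n)%quat (S K))
      <= M * (INR (S K) * t ^ K).
Proof.
intros hd hk h0 h1 hk1 hs hw.
pose proof (qnorm_ge0 q0) as hq0; pose proof (qnorm_ge0 q1) as hq1.
assert (hC : 0 <= C).
{ specialize (hw O); pose proof (qnorm_ge0 (w O)); cbn [pow] in hw; lra. }
set (r := Rmax (qnorm q0) (qnorm q1)).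
assert (hr : qnorm q0 <= r /\ qnorm q1 <= r /\ r < 1).
{ unfold r; repeat split; [apply Rmax_l|apply Rmax_r|now apply Rmax_lub_lt]. }
(* [v] is a growth rate for [sylvester], and [/ y] with [v < y < 1] one for [k]; their product
   [z = v / y] is still below 1 and governs the boundary term of the telescoping. *)
set (v := (1 + r) / 2).
assert (hv : r < v < 1) by (unfold v; lra).
set (y := (1 + v) / 2).
assert (hy : v < y < 1) by (unfold y; lra).
destruct (hk y) as [C1 hC1]; [lra|].
assert (hC1' : 0 <= C1).
{ specialize (hC1 O); pose proof (qnorm_ge0 (k O)); cbn [pow] in hC1; lra. }
destruct (subexponential_term k r hk) as [C2 [t2 [ht2 [hC2 hC2']]]]; [lra|].
(* Since the whole series vanishes, a partial sum is minus a tail and decays geometrically. *)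
assert (hS : forall L, qnorm (qsum (fun n => q1 ^ n * k n)%quat L) <= C2 / (1 - t2) * t2 ^ L).
{ intro L; pose proof (power_series_lim k q1 hk h1) as hl; rewrite hk1 in hl.
  pose proof (qlim_tail_geom _ _ C2 t2 L ht2 (fun n => hC2' q1 n (proj1 (proj2 hr))) hl) as e.
  rewrite qnorm_minus_sym in e.
  replace (qsum _ L - RtoQ 0)%quat with (qsum (fun n => q1 ^ n * k n)%quat L) in e by qring.
  exact e. }
set (z := v / y).
assert (hz : 0 <= z < 1).
{ split; [apply Rmult_le_pos; [lra|left; apply Rinv_0_lt_compat; lra]|].
  apply Rmult_lt_reg_r with y; [lra|].
  unfold z, Rdiv; rewrite Rmult_assoc, Rinv_l by lra; lra. }
set (t := Rmax (Rmax s t2) z).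
assert (ht : s <= t /\ t2 <= t /\ z <= t /\ t < 1).
{ unfold t; pose proof (Rmax_l (Rmax s t2) z); pose proof (Rmax_r (Rmax s t2) z).
  pose proof (Rmax_l s t2); pose proof (Rmax_r s t2).
  repeat split; try lra; repeat apply Rmax_lub_lt; lra. }
set (M1 := C2 / (1 - t2) * C).
set (M2 := / (v - r) * C1 * C).
assert (hM0 : 0 <= C2 / (1 - t2)).
{ apply Rmult_le_pos; [easy|left; apply Rinv_0_lt_compat; lra]. }
exists (M1 + M2), t; split; [lra|]; intro K.
rewrite (sylvester_telescope _ _ _ _ _ (quotient_coefs_conv _ _ _ w hd)).
apply Rle_trans with (1 := qnorm_minus_triang _ _).
rewrite Rmult_plus_distr_r; apply Rplus_le_compat.
(* The partial sum of [k * w] at [q1] is regrouped by the index [m] of [w]: the inner sums become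
   partial sums of [k] at [q1] of length [K - m], so [hS] and the decay of [w] together give [t ^ K]
   for each of the [K] values of [m]. *)
- rewrite (qsum_ext _ (fun n =>
    qsum (fun j => q1 ^ (n - j) * (q1 ^ j * k j) * w (n - j)%nat)%quat (S n))).
  2:{ intros n _; unfold qconv; rewrite <- qsum_mult_l; apply qsum_ext; intros j hj.
      rewrite <- !qmult_assoc, <- qpow_add; do 3 f_equal; lia. }
  rewrite (qsum_triangle (fun j m => q1 ^ m * (q1 ^ j * k j) * w m)%quat).
  apply Rle_trans with (1 := qnorm_qsum _ _).
  apply Rle_trans with (rsum (fun _ => M1 * t ^ K) K).
  + apply rsum_le; intros m hm.
    rewrite qsum_mult_r, qsum_mult_l, !qnorm_mult, qnorm_pow.
    apply Rle_trans with ((1 * (C2 / (1 - t2) * t ^ (K - m))) * (C * t ^ m)).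
    * apply Rmult_le_compat; try apply qnorm_ge0.
      -- apply Rmult_le_pos; [apply pow_le; lra|apply qnorm_ge0].
      -- apply Rmult_le_compat; [apply pow_le; lra|apply qnorm_ge0| |].
         ++ rewrite <- (pow1 m); apply pow_incr; lra.
         ++ apply Rle_trans with (1 := hS _), Rmult_le_compat_l; [easy|].
            apply pow_incr; lra.
      -- apply Rle_trans with (1 := hw _), Rmult_le_compat_l; [easy|].
         apply pow_incr; lra.
    * right; unfold M1; replace (t ^ K) with (t ^ (K - m) * t ^ m)
        by (rewrite <- pow_add; f_equal; lia); ring.
  + rewrite rsum_const, S_INR.
    assert (0 <= M1 * t ^ K); [|pose proof (pos_INR K); nra].
    apply Rmult_le_pos; [now apply Rmult_le_pos|apply pow_le; lra].
(* Each of the [S K] products has bounded weight, as [y ^ K <= y ^ j] and [w] is bounded by [C]. *)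
- assert (hG : y ^ K * qnorm (qconv k w K) <= INR (S K) * (C1 * C)).
  { rewrite <- rsum_const; unfold qconv.
    apply Rle_trans with (rsum (fun j => y ^ K * qnorm (k j * w (K - j)%nat)%quat) (S K)).
    - rewrite rsum_scal; apply Rmult_le_compat_l; [apply pow_le; lra|apply qnorm_qsum].
    - apply rsum_le; intros j hj; rewrite qnorm_mult.
      assert (e1 : y ^ K <= y ^ j).
      { replace K with (j + (K - j))%nat by lia; rewrite pow_add.
        pose proof (pow_le y j ltac:(lra)).
        pose proof (pow_incr y 1 (K - j) ltac:(lra)) as e; rewrite pow1 in e; nra. }
      assert (e2 : qnorm (w (K - j)%nat) <= C).
      { apply Rle_trans with (1 := hw _).
        pose proof (pow_incr s 1 (K - j) ltac:(lra)) as e; rewrite pow1 in e; nra. }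
      rewrite <- Rmult_assoc; apply Rmult_le_compat; [|apply qnorm_ge0| |easy].
      + apply Rmult_le_pos; [apply pow_le; lra|apply qnorm_ge0].
      + apply Rle_trans with (2 := hC1 j); rewrite Rmult_comm.
        apply Rmult_le_compat_l; [apply qnorm_ge0|easy]. }
  rewrite !qnorm_mult.
  apply Rle_trans with ((/ (v - r) * v ^ K) * (1 * qnorm (qconv k w K))).
  + apply Rmult_le_compat; [apply qnorm_ge0| | |].
    * apply Rmult_le_pos; apply qnorm_ge0.
    * apply (sylvester_bound _ _ r); lra.
    * apply Rmult_le_compat_r; [apply qnorm_ge0|lra].
  + replace (v ^ K) with (z ^ K * y ^ K)
      by (rewrite <- Rpow_mult_distr; f_equal; unfold z; field; lra).
    assert (hi : 0 <= / (v - r)) by (left; apply Rinv_0_lt_compat; lra).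
    apply Rle_trans with (/ (v - r) * z ^ K * (INR (S K) * (C1 * C))).
    * replace (/ (v - r) * (z ^ K * y ^ K) * (1 * qnorm (qconv k w K)))
        with (/ (v - r) * z ^ K * (y ^ K * qnorm (qconv k w K))) by ring.
      apply Rmult_le_compat_l; [apply Rmult_le_pos; [easy|apply pow_le; lra]|easy].
    * unfold M2.
      replace (/ (v - r) * C1 * C * (INR (S K) * t ^ K))
        with (/ (v - r) * t ^ K * (INR (S K) * (C1 * C))) by ring.
      apply Rmult_le_compat_r.
      -- apply Rmult_le_pos; [apply pos_INR|now apply Rmult_le_pos].
      -- apply Rmult_le_compat_l; [easy|apply pow_incr; lra].
Qed.

Definition id_coef (n : nat) : quat := match n with 1%nat => RtoQ 1 | _ => RtoQ 0 end.

Lemma qconv_id_coef w n :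
  qconv id_coef w n = match n with O => RtoQ 0 | S m => w m end.
Proof.
unfold qconv; destruct n as [|n]; [cbn [qsum id_coef]; qring|].
rewrite !qsum_S_l; cbn [id_coef]; rewrite qsum_0.
- replace (S n - 1)%nat with n by lia; qring.
- intros; apply qmult_0_l.
Qed.

Lemma qconv_minus_l a b w n :
  qconv (fun k => a k - b k)%quat w n = (qconv a w n - qconv b w n)%quat.
Proof. unfold qconv; rewrite <- qsum_minus; apply qsum_ext; intros; qring. Qed.

(** The system is triangular with the invertible [w O] on the diagonal. *)
Lemma qconv_eq0 d w : w O <> RtoQ 0 -> (forall n, qconv d w n = RtoQ 0) ->
  forall n, d n = RtoQ 0.
Proof.
intros hw h n; induction n as [n IH] using (well_founded_induction Wf_nat.lt_wf).
specialize (h n); unfold qconv in h; cbn [qsum] in h.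
rewrite qsum_0, qplus_0_l, Nat.sub_diag in h.
- rewrite <- (qmult_1_r (d n)), <- (qinv_r _ hw), <- qmult_assoc, h; apply qmult_0_l.
- intros k hk; rewrite IH by easy; apply qmult_0_l.
Qed.

(* For [w n := conj (lambda (n + 1))], with [lambda := sylvester q0 q1], the
   functional equation [sum lambda_n (a * w)_n = sum |w_n|^2] is the equality case
   of Cauchy-Schwarz, which forces [a * w] to be the shift of [w]. *)
Lemma rigidity a q0 q1 k :
  (forall w n, rsum (fun m => qnorm (qconv a w m) ^ 2) n <= rsum (fun m => qnorm (w m) ^ 2) n) ->
  quotient_coefs q0 (RtoQ 0) (fun n => a n - id_coef n)%quat k -> subexponential k ->
  qnorm q0 < 1 -> qnorm q1 < 1 -> power_series k q1 = RtoQ 0 ->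
  forall n, a n = id_coef n.
Proof.
intros hT hd hk h0 h1 hk1.
pose proof (qnorm_ge0 q0) as hq0.
set (d := fun n => (a n - id_coef n)%quat).
set (r := Rmax (qnorm q0) (qnorm q1)).
assert (hr : qnorm q0 <= r /\ qnorm q1 <= r /\ r < 1).
{ unfold r; repeat split; [apply Rmax_l|apply Rmax_r|now apply Rmax_lub_lt]. }
set (s := (1 + r) / 2).
assert (hs : r < s < 1) by (unfold s; lra).
set (v := fun n => qconj (sylvester q0 q1 n)).
set (w := fun n => v (S n)).
assert (hv : forall n, qnorm (v n) <= / (s - r) * s ^ n).
{ intro n; unfold v; rewrite qnorm_conj; apply sylvester_bound; lra. }
assert (hi : 0 < / (s - r)) by (apply Rinv_0_lt_compat; lra).
assert (hw : forall n, qnorm (w n) <= / (s - r) * s ^ n).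
{ intro n; apply Rle_trans with (1 := hv (S n)), Rmult_le_compat_l; [lra|].
  cbn [pow]; pose proof (pow_le s n ltac:(lra)); nra. }
destruct (sylvester_defect q0 q1 d k w _ s hd hk h0 h1 hk1 ltac:(lra) hw) as [M [t [ht hE]]].
(* [v O = 0], so [v] is the coefficient sequence of [q * w]. *)
assert (hdw : forall n, qconv d w n = (qconv a w n - v n)%quat).
{ intro n; unfold d; rewrite qconv_minus_l, qconv_id_coef; destruct n as [|n]; [|easy].
  unfold v; cbn [sylvester]; qring. }
(* Expanding [|x|^2 = |x + v|^2 - |v|^2 - 2 <v, x>] with [x = d * w] makes [qre E] appear, because
   [<v_n, x_n>] is the real part of [lambda_n x_n]. The contraction bounds the first sum by that of
   [w], which exceeds the sum for [v] only by its last square [qnorm (v (S K)) ^ 2]. *)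
assert (hsum : forall K, rsum (fun n => qnorm (qconv d w n) ^ 2) (S K) <=
   qnorm (v (S K)) ^ 2 + 2 * (M * (INR (S K) * t ^ K))).
{ intro K; specialize (hE K).
  set (E := qsum (fun n => sylvester q0 q1 n * qconv d w n)%quat (S K)) in *.
  assert (e : rsum (fun n => qnorm (qconv d w n) ^ 2) (S K) =
    rsum (fun n => qnorm (qconv a w n) ^ 2) (S K) - rsum (fun n => qnorm (v n) ^ 2) (S K)
    - 2 * qre E).
  { unfold E; generalize (S K); intro L; induction L as [|L IH]; cbn [rsum qsum].
    - rewrite qre_RtoQ; ring.
    - rewrite IH, hdw, qre_plus, !qnorm_sqr; unfold v, qdot; autorewrite with qcoord; ring. }
  assert (e' : rsum (fun n => qnorm (w n) ^ 2) (S K) =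
    rsum (fun n => qnorm (v n) ^ 2) (S K) + qnorm (v (S K)) ^ 2 - qnorm (v O) ^ 2).
  { generalize (S K); intro L; induction L as [|L IH]; cbn [rsum]; [ring|].
    rewrite IH; unfold w; ring. }
  assert (hv0 : qnorm (v O) = 0) by (unfold v; rewrite qnorm_conj; apply qnorm_0).
  rewrite hv0 in e'; specialize (hT w (S K)).
  pose proof (Rabs_qre_le E) as hre; apply Rabs_le_between in hre; lra. }
assert (hlim : is_lim_seq (fun K => qnorm (v (S K)) ^ 2 + 2 * (M * (INR (S K) * t ^ K))) 0).
{ replace (Finite 0) with (Finite (0 + 0)) by (f_equal; ring).
  apply is_lim_seq_plus'.
  - apply is_lim_seq_le_le with (u := fun _ => 0)
      (w := fun n => (/ (s - r)) ^ 2 * s * s * (s * s) ^ n).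
    + intro n; split; [apply pow2_ge_0|].
      replace (_ * (s * s) ^ n) with ((/ (s - r) * s ^ S n) ^ 2)
        by (rewrite (Rpow_mult_distr s s); cbn [pow]; ring).
      apply pow_incr; split; [apply qnorm_ge0|apply hv].
    + apply is_lim_seq_const.
    + replace (Finite 0) with (Rbar_mult ((/ (s - r)) ^ 2 * s * s) 0) by (cbn; f_equal; ring).
      apply is_lim_seq_scal_l, is_lim_seq_geom; rewrite Rabs_right; nra.
  - replace (Finite 0) with (Finite (2 * (M * 0))) by (f_equal; ring).
    apply (is_lim_seq_scal_l _ 2 (M * 0)), (is_lim_seq_scal_l _ M 0).
    now apply succ_mul_geom_lim. }
(* A single square is at most every later partial sum, and these are bounded by a sequence tending
   to 0. *)
assert (hz : forall n, qconv d w n = RtoQ 0).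
{ intro n; apply qnorm_eq0.
  assert (qnorm (qconv d w n) ^ 2 <= 0);
    [|pose proof (qnorm_ge0 (qconv d w n)); nra].
  apply (is_lim_seq_le_loc (fun _ => qnorm (qconv d w n) ^ 2)
    (fun K => qnorm (v (S K)) ^ 2 + 2 * (M * (INR (S K) * t ^ K)))
    (qnorm (qconv d w n) ^ 2) 0).
  - exists n; intros K hK; apply Rle_trans with (2 := hsum K).
    apply Rle_trans with (rsum (fun n => qnorm (qconv d w n) ^ 2) (S n)).
    + cbn [rsum]; assert (0 <= rsum (fun n => qnorm (qconv d w n) ^ 2) n); [|lra].
      apply rsum_ge0; intro; apply pow2_ge_0.
    + apply rsum_mono; [intro; apply pow2_ge_0|lia].
  - apply is_lim_seq_const.
  - exact hlim. }
assert (hw0 : w O <> RtoQ 0).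
{ unfold w, v; cbn [sylvester qpow]; intro e; apply (f_equal qre) in e.
  autorewrite with qcoord in e; lra. }
intro n; replace (a n) with (d n + id_coef n)%quat by (unfold d; qring).
rewrite (qconv_eq0 d w hw0 hz); qring.
Qed.

(** * Goursat's bisection argument *)

Definition half_interval (J I : R * R) : Prop :=
  J = (fst I, (fst I + snd I) / 2) \/ J = ((fst I + snd I) / 2, snd I).

Lemma nested_halves (I : nat -> R * R) : fst (I O) <= snd (I O) ->
  (forall n, half_interval (I (S n)) (I n)) ->
  exists x, forall n, fst (I n) <= x <= snd (I n) /\
    fst (I O) <= fst (I n) /\ snd (I n) <= snd (I O) /\
    snd (I n) - fst (I n) = (snd (I O) - fst (I O)) / 2 ^ n.
Proof.
intros h0 hS.
assert (len : forall n, snd (I n) - fst (I n) = (snd (I O) - fst (I O)) / 2 ^ n).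
{ intro n; induction n as [|n IH]; [cbn [pow]; field|].
  replace (_ / 2 ^ S n) with ((snd (I O) - fst (I O)) / 2 ^ n / 2)
    by (cbn [pow]; field; apply pow_nonzero; lra).
  rewrite <- IH; destruct (hS n) as [e|e]; rewrite e; cbn [fst snd]; field. }
assert (hle : forall n, fst (I n) <= snd (I n)).
{ intro n; specialize (len n).
  assert (0 <= (snd (I O) - fst (I O)) / 2 ^ n); [|lra].
  apply Rmult_le_pos; [lra|left; apply Rinv_0_lt_compat, pow_lt; lra]. }
assert (step : forall n, fst (I n) <= fst (I (S n)) /\ snd (I (S n)) <= snd (I n)).
{ intro n; specialize (hle n); destruct (hS n) as [e|e]; rewrite e; cbn [fst snd]; lra. }
assert (mono : forall m n, (m <= n)%nat -> fst (I m) <= fst (I n) /\ snd (I n) <= snd (I m)).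
{ intros m n l; induction l as [|n l IH]; [lra|specialize (step n); lra]. }
destruct (completeness (fun x => exists n, x = fst (I n))) as [x [hx1 hx2]].
- exists (snd (I O)); intros y [n ->]; specialize (mono O n ltac:(lia)).
  specialize (hle n); lra.
- now exists (fst (I O)), O.
- exists x; intro n; split; [split|].
  + apply hx1; now exists n.
  + apply hx2; intros y [m ->].
    destruct (mono n (max m n) ltac:(lia)); destruct (mono m (max m n) ltac:(lia)).
    specialize (hle (max m n)); lra.
  + destruct (mono O n ltac:(lia)); auto.
Qed.

(** Stated for an abstract function of rectangles, additive in each side and small to second order
    near every point, because it will be used in polar coordinates rather than for an integral
    around a rectangle of the plane. A rectangle violating the bound [eps * (sum of sides)^2] has a
    quarter violating it too; the common point of the nested rectangles contradicts the local
    estimate. *)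
Lemma goursat_bisection (E : R * R -> R * R -> quat) (I0 J0 : R * R) :
  fst I0 <= snd I0 -> fst J0 <= snd J0 ->
  (forall t1 t2 t3 J, fst I0 <= t1 <= t2 -> t2 <= t3 <= snd I0 ->
    fst J0 <= fst J <= snd J -> snd J <= snd J0 ->
    E (t1, t3) J = (E (t1, t2) J + E (t2, t3) J)%quat) ->
  (forall I u1 u2 u3, fst J0 <= u1 <= u2 -> u2 <= u3 <= snd J0 ->
    fst I0 <= fst I <= snd I -> snd I <= snd I0 ->
    E I (u1, u3) = (E I (u1, u2) + E I (u2, u3))%quat) ->
  (forall t u eps, fst I0 <= t <= snd I0 -> fst J0 <= u <= snd J0 -> 0 < eps ->
    exists delta, 0 < delta /\ forall I J,
      fst I <= t <= snd I -> fst J <= u <= snd J ->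
      fst I0 <= fst I -> snd I <= snd I0 -> fst J0 <= fst J -> snd J <= snd J0 ->
      snd I - fst I < delta -> snd J - fst J < delta ->
      qnorm (E I J) <= eps * (snd I - fst I + (snd J - fst J)) ^ 2) ->
  E I0 J0 = RtoQ 0.
Proof.
intros hI0 hJ0 addI addJ loc; apply qnorm_eq0.
destruct (Rle_lt_or_eq_dec _ _ (qnorm_ge0 (E I0 J0))) as [hpos|e]; [exfalso|now symmetry].
set (L := snd I0 - fst I0 + (snd J0 - fst J0)).
(* Chosen so that the initial rectangle is strictly bad; the added 1 covers a degenerate rectangle
   with [L = 0]. *)
set (eps := qnorm (E I0 J0) / (2 * (L ^ 2 + 1))).
assert (heps : 0 < eps) by (apply Rdiv_lt_0_compat; [easy|nra]).
set (bad := fun R : (R * R) * (R * R) =>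
  (fst I0 <= fst (fst R) <= snd (fst R) /\ snd (fst R) <= snd I0 /\
   fst J0 <= fst (snd R) <= snd (snd R) /\ snd (snd R) <= snd J0) /\
  eps * (snd (fst R) - fst (fst R) + (snd (snd R) - fst (snd R))) ^ 2
    < qnorm (E (fst R) (snd R))).
assert (bad0 : bad (I0, J0)).
{ split; cbn [fst snd]; [lra|].
  fold L; unfold eps; apply Rmult_lt_reg_r with (2 * (L ^ 2 + 1)); [nra|].
  replace (qnorm (E I0 J0) / (2 * (L ^ 2 + 1)) * L ^ 2 * (2 * (L ^ 2 + 1)))
    with (qnorm (E I0 J0) * L ^ 2) by (field; nra).
  nra. }
assert (split : forall R, bad R -> exists R', (half_interval (fst R') (fst R) /\
   half_interval (snd R') (snd R)) /\ bad R').
{ intros [[t1 t3] [u1 u3]] [hin hR]; cbn [fst snd] in *.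
  set (t2 := (t1 + t3) / 2); set (u2 := (u1 + u3) / 2).
  assert (ht : t1 <= t2 <= t3) by (unfold t2; lra).
  assert (hu : u1 <= u2 <= u3) by (unfold u2; lra).
  assert (e : E (t1, t3) (u1, u3) = ((E (t1, t2) (u1, u2) + E (t1, t2) (u2, u3)) +
    (E (t2, t3) (u1, u2) + E (t2, t3) (u2, u3)))%quat).
  { rewrite (addI t1 t2 t3), !(addJ _ u1 u2 u3); cbn [fst snd]; try lra; easy. }
  (* Halving both sides divides the bound by 4, as many as there are quarters, so not all four
     quarters can satisfy it. *)
  set (c := eps * ((t3 - t1 + (u3 - u1)) / 2) ^ 2).
  assert (hc : 4 * c < qnorm (E (t1, t3) (u1, u3))) by (unfold c; lra).
  assert (hq : forall I J, half_interval I (t1, t3) -> half_interval J (u1, u3) ->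
     c < qnorm (E I J) -> exists R', (half_interval (fst R') (t1, t3) /\
     half_interval (snd R') (u1, u3)) /\ bad R').
  { intros I J hI hJ hlt; exists (I, J); cbn [fst snd]; split; [easy|].
    unfold bad; cbn [fst snd].
    replace (snd I - fst I + (snd J - fst J)) with ((t3 - t1 + (u3 - u1)) / 2).
    - split; [|exact hlt].
      destruct hI as [-> | ->]; destruct hJ as [-> | ->]; cbn [fst snd]; lra.
    - destruct hI as [-> | ->]; destruct hJ as [-> | ->]; cbn [fst snd]; field. }
  assert (tri := qnorm_triang (E (t1, t2) (u1, u2) + E (t1, t2) (u2, u3))%quat
    (E (t2, t3) (u1, u2) + E (t2, t3) (u2, u3))%quat).
  rewrite <- e in tri.
  pose proof (qnorm_triang (E (t1, t2) (u1, u2)) (E (t1, t2) (u2, u3))).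
  pose proof (qnorm_triang (E (t2, t3) (u1, u2)) (E (t2, t3) (u2, u3))).
  destruct (Rlt_dec c (qnorm (E (t1, t2) (u1, u2)))) as [h|h1];
    [refine (hq _ _ _ _ h); [now left|now left]|].
  destruct (Rlt_dec c (qnorm (E (t1, t2) (u2, u3)))) as [h|h2];
    [refine (hq _ _ _ _ h); [now left|now right]|].
  destruct (Rlt_dec c (qnorm (E (t2, t3) (u1, u2)))) as [h|h3];
    [refine (hq _ _ _ _ h); [now right|now left]|].
  destruct (Rlt_dec c (qnorm (E (t2, t3) (u2, u3)))) as [h|h4];
    [refine (hq _ _ _ _ h); [now right|now right]|].
  lra. }
set (next := fun R : {R | bad R} =>
  let s := constructive_indefinite_description _ (split (proj1_sig R) (proj2_sig R)) in
  exist bad (proj1_sig s) (proj2 (proj2_sig s))).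
set (Q := fix Q n := match n with O => exist bad (I0, J0) bad0 | S n => next (Q n) end).
assert (hQ : forall n, half_interval (fst (proj1_sig (Q (S n)))) (fst (proj1_sig (Q n))) /\
  half_interval (snd (proj1_sig (Q (S n)))) (snd (proj1_sig (Q n)))).
{ intro n; change (Q (S n)) with (next (Q n)); unfold next.
  destruct constructive_indefinite_description as [R' [h1 h2]]; exact h1. }
destruct (nested_halves (fun n => fst (proj1_sig (Q n))) hI0 (fun n => proj1 (hQ n)))
  as [t ht].
destruct (nested_halves (fun n => snd (proj1_sig (Q n))) hJ0 (fun n => proj2 (hQ n)))
  as [u hu].
cbn beta in ht, hu.
change (fst (proj1_sig (Q O))) with I0 in ht.
change (snd (proj1_sig (Q O))) with J0 in hu.
destruct (loc t u eps) as [delta [hd hdelta]]; [|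
  |easy|].
{ specialize (ht O); change (fst (proj1_sig (Q O))) with I0 in ht; lra. }
{ specialize (hu O); change (snd (proj1_sig (Q O))) with J0 in hu; lra. }
assert (exists n, forall l, 0 <= l <= L -> l / 2 ^ n < delta) as [n hn].
{ assert (hl : is_lim_seq (fun n => L * (/ 2) ^ n) (L * 0)).
  { apply (is_lim_seq_scal_l _ L 0), is_lim_seq_geom; rewrite Rabs_right; lra. }
  rewrite Rmult_0_r in hl; apply is_lim_seq_spec in hl.
  destruct (hl (mkposreal delta hd)) as [n hn]; exists n; intros l hl'.
  specialize (hn n (Nat.le_refl n)); cbn in hn; rewrite Rminus_0_r in hn.
  apply Rabs_def2 in hn; rewrite pow_inv in hn.
  assert (0 < / 2 ^ n) by (apply Rinv_0_lt_compat, pow_lt; lra).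
  unfold Rdiv; nra. }
specialize (ht n); specialize (hu n).
destruct (proj2_sig (Q n)) as [_ hbad].
apply (Rlt_not_le _ _ hbad), hdelta; try lra.
- rewrite (proj2 (proj2 (proj2 ht))); apply hn; unfold L; lra.
- rewrite (proj2 (proj2 (proj2 hu))); apply hn; unfold L; lra.
Qed.

(** * Integrals of quaternion-valued functions *)

Definition qcont (g : R -> quat) (s : R) : Prop :=
  continuous (fun t => qre (g t)) s /\ continuous (fun t => qi (g t)) s /\
  continuous (fun t => qj (g t)) s /\ continuous (fun t => qk (g t)) s.

Definition qcont_on (g : R -> quat) (a b : R) : Prop := forall s, a <= s <= b -> qcont g s.

Lemma continuous_eps (u : R -> R) s : continuous u s <->
  forall eps, 0 < eps -> exists delta, 0 < delta /\
    forall t, Rabs (t - s) < delta -> Rabs (u t - u s) < eps.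
Proof.
split.
- intros h eps he; destruct (proj1 (filterlim_locally _ _) h (mkposreal eps he)) as [d hd].
  exists d; split; [apply cond_pos|exact hd].
- intros h; apply filterlim_locally; intros [eps he]; destruct (h eps he) as [d [hd h']].
  exists (mkposreal d hd); exact h'.
Qed.

Lemma qcont_eps g s : (forall eps, 0 < eps -> exists delta, 0 < delta /\
    forall t, Rabs (t - s) < delta -> qnorm (g t - g s)%quat < eps) -> qcont g s.
Proof.
intro h; repeat split; apply continuous_eps; intros eps he; destruct (h eps he) as [d [hd h']];
  exists d; split; try easy; intros t ht; apply Rle_lt_trans with (2 := h' t ht).
- exact (Rabs_qre_le (g t - g s)%quat).
- exact (Rabs_qi_le (g t - g s)%quat).
- exact (Rabs_qj_le (g t - g s)%quat).
- exact (Rabs_qk_le (g t - g s)%quat).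
Qed.

Lemma qcont_const c s : qcont (fun _ => c) s.
Proof. repeat split; apply continuous_const. Qed.

Lemma qcont_plus g h s : qcont g s -> qcont h s -> qcont (fun t => g t + h t)%quat s.
Proof.
intros [g1 [g2 [g3 g4]]] [h1 [h2 [h3 h4]]]; repeat split.
- now apply (continuous_plus (V := R_NormedModule) (fun t => qre (g t))).
- now apply (continuous_plus (V := R_NormedModule) (fun t => qi (g t))).
- now apply (continuous_plus (V := R_NormedModule) (fun t => qj (g t))).
- now apply (continuous_plus (V := R_NormedModule) (fun t => qk (g t))).
Qed.

Lemma qcont_minus g h s : qcont g s -> qcont h s -> qcont (fun t => g t - h t)%quat s.
Proof.
intros [g1 [g2 [g3 g4]]] [h1 [h2 [h3 h4]]]; repeat split.
- now apply (continuous_minus (V := R_NormedModule) (fun t => qre (g t))).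
- now apply (continuous_minus (V := R_NormedModule) (fun t => qi (g t))).
- now apply (continuous_minus (V := R_NormedModule) (fun t => qj (g t))).
- now apply (continuous_minus (V := R_NormedModule) (fun t => qk (g t))).
Qed.

Lemma qcont_mult g h s : qcont g s -> qcont h s -> qcont (fun t => g t * h t)%quat s.
Proof.
assert (p : forall u v : R -> R, continuous u s -> continuous v s ->
  continuous (fun t => u t + v t) s)
  by (intros u v; apply (continuous_plus (V := R_NormedModule) u v)).
assert (m : forall u v : R -> R, continuous u s -> continuous v s ->
  continuous (fun t => u t - v t) s)
  by (intros u v; apply (continuous_minus (V := R_NormedModule) u v)).
assert (x : forall u v : R -> R, continuous u s -> continuous v s ->
  continuous (fun t => u t * v t) s)
  by (intros u v; apply (continuous_mult (K := R_AbsRing) u v)).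
intros [g1 [g2 [g3 g4]]] [h1 [h2 [h3 h4]]]; repeat split; unfold qmult;
  cbn [qre qi qj qk fst snd].
- apply m; [apply m; [apply m|]|]; apply x; easy.
- apply m; [apply p; [apply p|]|]; apply x; easy.
- apply p; [apply p; [apply m|]|]; apply x; easy.
- apply p; [apply m; [apply p|]|]; apply x; easy.
Qed.

Lemma qcont_slice I u v s : continuous u s -> continuous v s ->
  qcont (fun t => slice I (u t) (v t)) s.
Proof.
intros hu hv; apply qcont_plus; [|apply qcont_mult; [apply qcont_const|]];
 repeat split; first [exact hu|exact hv|apply continuous_const].
Qed.

Lemma qcont_ext g h s : (forall t, g t = h t) -> qcont g s -> qcont h s.
Proof.
intros e [h1 [h2 [h3 h4]]]; split; [|split; [|split]].
- apply (continuous_ext (fun t => qre (g t))); [intro; now rewrite e|easy].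
- apply (continuous_ext (fun t => qi (g t))); [intro; now rewrite e|easy].
- apply (continuous_ext (fun t => qj (g t))); [intro; now rewrite e|easy].
- apply (continuous_ext (fun t => qk (g t))); [intro; now rewrite e|easy].
Qed.

Definition qRInt (g : R -> quat) (a b : R) : quat :=
  (RInt (fun t => qre (g t)) a b, RInt (fun t => qi (g t)) a b,
   RInt (fun t => qj (g t)) a b, RInt (fun t => qk (g t)) a b).

Lemma qcont_on_ex g a b : a <= b -> qcont_on g a b ->
  ex_RInt (fun t => qre (g t)) a b /\ ex_RInt (fun t => qi (g t)) a b /\
  ex_RInt (fun t => qj (g t)) a b /\ ex_RInt (fun t => qk (g t)) a b.
Proof.
intros hab h; repeat split; apply (ex_RInt_continuous (V := R_CompleteNormedModule));
 intros z hz; rewrite Rmin_left, Rmax_right in hz by easy; apply (h z hz).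
Qed.

Lemma qRInt_Chasles g a b c : a <= b <= c -> qcont_on g a c ->
  qRInt g a c = (qRInt g a b + qRInt g b c)%quat.
Proof.
intros hb h.
destruct (qcont_on_ex g a b) as [h1 [h2 [h3 h4]]]; [lra|intros s hs; apply h; lra|].
destruct (qcont_on_ex g b c) as [k1 [k2 [k3 k4]]]; [lra|intros s hs; apply h; lra|].
apply quat_ext; symmetry; apply (RInt_Chasles (V := R_CompleteNormedModule)); easy.
Qed.

Lemma qRInt_ext g h a b : a <= b -> (forall s, a <= s <= b -> g s = h s) ->
  qRInt g a b = qRInt h a b.
Proof.
intros hab e; apply quat_ext; apply RInt_ext; intros s hs;
 rewrite Rmin_left, Rmax_right in hs by easy; now rewrite e by lra.
Qed.

Lemma qRInt_plus g h a b : a <= b -> qcont_on g a b -> qcont_on h a b ->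
  qRInt (fun t => g t + h t)%quat a b = (qRInt g a b + qRInt h a b)%quat.
Proof.
intros hab hg hh.
destruct (qcont_on_ex g a b hab hg) as [h1 [h2 [h3 h4]]].
destruct (qcont_on_ex h a b hab hh) as [k1 [k2 [k3 k4]]].
apply quat_ext.
- now apply (RInt_plus (V := R_CompleteNormedModule) (fun t => qre (g t))).
- now apply (RInt_plus (V := R_CompleteNormedModule) (fun t => qi (g t))).
- now apply (RInt_plus (V := R_CompleteNormedModule) (fun t => qj (g t))).
- now apply (RInt_plus (V := R_CompleteNormedModule) (fun t => qk (g t))).
Qed.

Lemma qRInt_minus g h a b : a <= b -> qcont_on g a b -> qcont_on h a b ->
  qRInt (fun t => g t - h t)%quat a b = (qRInt g a b - qRInt h a b)%quat.
Proof.
intros hab hg hh.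
destruct (qcont_on_ex g a b hab hg) as [h1 [h2 [h3 h4]]].
destruct (qcont_on_ex h a b hab hh) as [k1 [k2 [k3 k4]]].
apply quat_ext.
- now apply (RInt_minus (V := R_CompleteNormedModule) (fun t => qre (g t))).
- now apply (RInt_minus (V := R_CompleteNormedModule) (fun t => qi (g t))).
- now apply (RInt_minus (V := R_CompleteNormedModule) (fun t => qj (g t))).
- now apply (RInt_minus (V := R_CompleteNormedModule) (fun t => qk (g t))).
Qed.

Lemma RInt_ext_fun (u v : R -> R) a b : (forall t, u t = v t) -> RInt u a b = RInt v a b.
Proof. intro h; apply RInt_ext; intros; apply h. Qed.

Lemma RInt_lin4 (u1 u2 u3 u4 : R -> R) c1 c2 c3 c4 a b :
  ex_RInt u1 a b -> ex_RInt u2 a b -> ex_RInt u3 a b -> ex_RInt u4 a b ->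
  RInt (fun t => c1 * u1 t + c2 * u2 t + c3 * u3 t + c4 * u4 t) a b =
  c1 * RInt u1 a b + c2 * RInt u2 a b + c3 * RInt u3 a b + c4 * RInt u4 a b.
Proof.
intros h1 h2 h3 h4; apply is_RInt_unique.
apply (is_RInt_plus (V := R_NormedModule));
  [apply (is_RInt_plus (V := R_NormedModule));
   [apply (is_RInt_plus (V := R_NormedModule))|]|];
  apply (is_RInt_scal (V := R_NormedModule));
  now apply (RInt_correct (V := R_CompleteNormedModule)).
Qed.

Lemma qRInt_mult_l c g a b : a <= b -> qcont_on g a b ->
  qRInt (fun t => c * g t)%quat a b = (c * qRInt g a b)%quat.
Proof.
intros hab hg.
destruct (qcont_on_ex g a b hab hg) as [h1 [h2 [h3 h4]]].
apply quat_ext; [rewrite qre_mult|rewrite qi_mult|rewrite qj_mult|rewrite qk_mult];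
 unfold qRInt; cbn [qre qi qj qk fst snd].
- replace (_ - _) with (qre c * RInt (fun t => qre (g t)) a b +
    (- qi c) * RInt (fun t => qi (g t)) a b + (- qj c) * RInt (fun t => qj (g t)) a b +
    (- qk c) * RInt (fun t => qk (g t)) a b) by ring.
  rewrite <- RInt_lin4 by easy; apply RInt_ext_fun; intro t; rewrite qre_mult; ring.
- replace (_ - _) with (qi c * RInt (fun t => qre (g t)) a b +
    qre c * RInt (fun t => qi (g t)) a b + (- qk c) * RInt (fun t => qj (g t)) a b +
    qj c * RInt (fun t => qk (g t)) a b) by ring.
  rewrite <- RInt_lin4 by easy; apply RInt_ext_fun; intro t; rewrite qi_mult; ring.
- transitivity (qj c * RInt (fun t => qre (g t)) a b +
    qk c * RInt (fun t => qi (g t)) a b + qre c * RInt (fun t => qj (g t)) a b +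
    (- qi c) * RInt (fun t => qk (g t)) a b); [|ring].
  rewrite <- RInt_lin4 by easy; apply RInt_ext_fun; intro t; rewrite qj_mult; ring.
- transitivity (qk c * RInt (fun t => qre (g t)) a b +
    (- qj c) * RInt (fun t => qi (g t)) a b + qi c * RInt (fun t => qj (g t)) a b +
    qre c * RInt (fun t => qk (g t)) a b); [|ring].
  rewrite <- RInt_lin4 by easy; apply RInt_ext_fun; intro t; rewrite qk_mult; ring.
Qed.

Lemma qRInt_slice_mult_r I u v D a b : a <= b ->
  (forall s, a <= s <= b -> continuous u s) -> (forall s, a <= s <= b -> continuous v s) ->
  qRInt (fun t => slice I (u t) (v t) * D)%quat a b =
  (slice I (RInt u a b) (RInt v a b) * D)%quat.
Proof.
intros hab hu hv.
assert (exu : ex_RInt u a b).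
{ apply (ex_RInt_continuous (V := R_CompleteNormedModule)); intros z hz.
  rewrite Rmin_left, Rmax_right in hz by easy; auto. }
assert (exv : ex_RInt v a b).
{ apply (ex_RInt_continuous (V := R_CompleteNormedModule)); intros z hz.
  rewrite Rmin_left, Rmax_right in hz by easy; auto. }
assert (lin : forall c d, RInt (fun t => c * u t + d * v t) a b =
    c * RInt u a b + d * RInt v a b).
{ intros c d; apply is_RInt_unique, (is_RInt_plus (V := R_NormedModule));
  apply (is_RInt_scal (V := R_NormedModule));
  now apply (RInt_correct (V := R_CompleteNormedModule)). }
assert (e : forall x y, (slice I x y * D)%quat =
  (qscal x D + qscal y (I * D))%quat) by (intros; unfold slice; qring).
rewrite e; apply quat_ext; autorewrite with qcoord;
 rewrite 2!(Rmult_comm (RInt _ _ _)), <- lin; apply RInt_ext_fun; intro s; cbn beta;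
 rewrite e; autorewrite with qcoord; ring.
Qed.

(** The factor 2 comes from bounding the four coordinates separately. *)
Lemma qnorm_qRInt_le g a b M : a <= b -> qcont_on g a b ->
  (forall s, a <= s <= b -> qnorm (g s) <= M) -> qnorm (qRInt g a b) <= 2 * (M * (b - a)).
Proof.
intros hab hg hM.
destruct (qcont_on_ex g a b hab hg) as [h1 [h2 [h3 h4]]].
assert (aux : forall u : R -> R, ex_RInt u a b ->
  (forall s, a <= s <= b -> Rabs (u s) <= M) -> Rabs (RInt u a b) <= M * (b - a)).
{ intros u hu hb; rewrite Rmult_comm; now apply abs_RInt_le_const. }
apply qnorm_le_max; apply aux; try easy; intros s hs; apply Rle_trans with (2 := hM s hs).
- apply Rabs_qre_le.
- apply Rabs_qi_le.
- apply Rabs_qj_le.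
- apply Rabs_qk_le.
Qed.

Lemma qcont_on_bounded g a b : a <= b -> qcont_on g a b ->
  exists M, 0 < M /\ forall s, a <= s <= b -> qnorm (g s) <= M.
Proof.
intros hab hg.
assert (aux : forall u : R -> R, (forall s, a <= s <= b -> continuous u s) ->
  exists M, 0 < M /\ forall s, a <= s <= b -> Rabs (u s) <= M).
{ intros u hu.
  assert (ex : ex_RInt u a b).
  { apply (ex_RInt_continuous (V := R_CompleteNormedModule)); intros z hz.
    rewrite Rmin_left, Rmax_right in hz by easy; auto. }
  destruct (ex_RInt_ub _ _ _ ex) as [M hM]; exists (Rabs M + 1).
  split; [pose proof (Rabs_pos M); lra|]; intros s hs.
  rewrite Rmin_left, Rmax_right in hM by easy.
  pose proof (Rle_abs M); apply Rle_trans with M; [exact (hM s hs)|lra]. }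
destruct (aux (fun t => qre (g t))) as [M1 [p1 H1]]; [intros; now apply hg|].
destruct (aux (fun t => qi (g t))) as [M2 [p2 H2]]; [intros; now apply hg|].
destruct (aux (fun t => qj (g t))) as [M3 [p3 H3]]; [intros; now apply hg|].
destruct (aux (fun t => qk (g t))) as [M4 [p4 H4]]; [intros; now apply hg|].
exists (2 * (M1 + M2 + M3 + M4)); split; [lra|]; intros s hs.
specialize (H1 s hs); specialize (H2 s hs); specialize (H3 s hs); specialize (H4 s hs).
cbn beta in *; apply qnorm_le_max; lra.
Qed.

Lemma qRInt_qsum (g : nat -> R -> quat) a b N : a <= b -> (forall n, qcont_on (g n) a b) ->
  qcont_on (fun t => qsum (fun n => g n t) N) a b /\
  qRInt (fun t => qsum (fun n => g n t) N) a b = qsum (fun n => qRInt (g n) a b) N.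
Proof.
intros hab hg; induction N as [|N [IH1 IH2]]; cbn [qsum].
- split; [intros s _; apply qcont_const|].
  rewrite (qRInt_ext _ (fun _ => RtoQ 0 * RtoQ 0)%quat) by (try easy; intros; qring).
  rewrite qRInt_mult_l by (try easy; intros s _; apply qcont_const); apply qmult_0_l.
- split.
  + intros s hs; apply qcont_plus; [now apply IH1|now apply hg].
  + rewrite <- IH2; now apply qRInt_plus.
Qed.

(** * Cauchy's formula on a slice *)

(** Complex differentiability along the plane of [I]: differentiability and the Cauchy-Riemann
    equation in one condition, with the derivative [D] to the right of the increment. *)
Definition slice_diff (I : quat) (f : quat -> quat) (x y : R) (D : quat) : Prop :=
  forall eps, 0 < eps -> exists delta, 0 < delta /\ forall x' y',
    Rabs (x' - x) < delta -> Rabs (y' - y) < delta ->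
    qnorm (f (slice I x' y') - f (slice I x y) - slice I (x' - x) (y' - y) * D)%quat
      <= eps * (Rabs (x' - x) + Rabs (y' - y)).

Lemma qnorm_slice_le I x y : imag_unit I -> qnorm (slice I x y) <= Rabs x + Rabs y.
Proof.
intro h; rewrite qnorm_slice by easy.
pose proof (Rabs_pos x); pose proof (Rabs_pos y).
rewrite <- (sqrt_Rsqr (Rabs x + Rabs y)) by lra; apply sqrt_le_1_alt.
rewrite <- (pow2_abs x), <- (pow2_abs y); unfold Rsqr; nra.
Qed.

Lemma slice_diff_continuous I f x y D : imag_unit I -> slice_diff I f x y D ->
  forall eps, 0 < eps -> exists delta, 0 < delta /\ forall x' y',
    Rabs (x' - x) < delta -> Rabs (y' - y) < delta ->
    qnorm (f (slice I x' y') - f (slice I x y))%quat < eps.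
Proof.
intros hI h eps he; destruct (h 1 ltac:(lra)) as [d [hd hd']].
pose proof (qnorm_ge0 D) as hD.
set (c := eps / (2 * (qnorm D + 1))).
assert (hc : 0 < c) by (apply Rdiv_lt_0_compat; lra).
exists (Rmin d c); split; [now apply Rmin_glb_lt|]; intros x' y' hx hy.
pose proof (Rmin_l d c); pose proof (Rmin_r d c).
specialize (hd' x' y' ltac:(lra) ltac:(lra)).
set (e := (f (slice I x' y') - f (slice I x y))%quat) in *.
set (z := slice I (x' - x) (y' - y)) in *.
replace e with ((e - z * D) + z * D)%quat by qring.
apply Rle_lt_trans with (1 := qnorm_triang _ _); rewrite qnorm_mult.
pose proof (qnorm_slice_le I (x' - x) (y' - y) hI) as hz; fold z in hz.
assert (hs : Rabs (x' - x) + Rabs (y' - y) < 2 * c) by lra.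
assert (eps = 2 * c * (qnorm D + 1)) by (unfold c; field; lra).
nra.
Qed.

Lemma slice_diff_qcont I f u v s D : imag_unit I -> slice_diff I f (u s) (v s) D ->
  continuous u s -> continuous v s -> qcont (fun t => f (slice I (u t) (v t))) s.
Proof.
intros hI h hu hv; apply qcont_eps; intros eps he.
destruct (slice_diff_continuous _ _ _ _ _ hI h eps he) as [d [hd hd']].
destruct (proj1 (continuous_eps u s) hu d hd) as [d1 [h1 h1']].
destruct (proj1 (continuous_eps v s) hv d hd) as [d2 [h2 h2']].
exists (Rmin d1 d2); split; [now apply Rmin_glb_lt|]; intros t ht.
pose proof (Rmin_l d1 d2); pose proof (Rmin_r d1 d2).
apply hd'; [apply h1'|apply h2']; lra.
Qed.

Lemma unit_ball_slice I x y : imag_unit I -> unit_ball (slice I x y) <-> x ^ 2 + y ^ 2 < 1.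
Proof.
intro hI; unfold unit_ball; rewrite qnorm_slice by easy; split; intro h.
- apply Rnot_le_lt; intro h'; apply (Rlt_not_le _ _ h).
  rewrite <- sqrt_1; now apply sqrt_le_1_alt.
- rewrite <- sqrt_1; apply sqrt_lt_1_alt; nra.
Qed.

Lemma slice_plus I x y x' y' : (slice I x y + slice I x' y')%quat = slice I (x + x') (y + y').
Proof. unfold slice; qring. Qed.

Lemma slice_minus I x y x' y' : (slice I x y - slice I x' y')%quat = slice I (x - x') (y - y').
Proof. unfold slice; qring. Qed.

Section CauchyFormula.

Variables (I : quat) (f : quat -> quat) (ax ay r : R).
Hypothesis hI : imag_unit I.
Hypothesis hf : forall x y, x ^ 2 + y ^ 2 < 1 -> exists D, slice_diff I f x y D.
Hypothesis hr : 0 < r < 1.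
Hypothesis ha : ax ^ 2 + ay ^ 2 < r ^ 2.

(* With [a := slice I ax ay], [h t u] is [f (a + t * (c u - a))] and [m u] is the
   Cauchy kernel [c u / (c u - a)]. *)
Let X t u := ax + t * (r * cos u - ax).
Let Y t u := ay + t * (r * sin u - ay).
Let h t u := f (slice I (X t u) (Y t u)).
Let N u := (r * cos u - ax) ^ 2 + (r * sin u - ay) ^ 2.
Let c u := slice I (r * cos u) (r * sin u).
Let m u := slice I
  ((r * cos u * (r * cos u - ax) + r * sin u * (r * sin u - ay)) / N u)
  ((r * sin u * (r * cos u - ax) - r * cos u * (r * sin u - ay)) / N u).

Lemma cauchy_circle_sqr u : (r * cos u) ^ 2 + (r * sin u) ^ 2 = r ^ 2.
Proof.
pose proof (sin2_cos2 u) as e; unfold Rsqr in e.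
replace (_ + _) with (r ^ 2 * (sin u * sin u + cos u * cos u)) by ring.
rewrite e; ring.
Qed.

Lemma cauchy_N_pos u : 0 < N u.
Proof.
unfold N; pose proof (cauchy_circle_sqr u).
destruct (Req_dec (r * cos u - ax) 0) as [e1|e1];
  [|pose proof (Rsqr_pos_lt _ e1) as e; unfold Rsqr in e;
   pose proof (pow2_ge_0 (r * sin u - ay)); lra].
destruct (Req_dec (r * sin u - ay) 0) as [e2|e2];
  [|pose proof (Rsqr_pos_lt _ e2) as e; unfold Rsqr in e;
   pose proof (pow2_ge_0 (r * cos u - ax)); lra].
replace (r * cos u) with ax in * by lra; replace (r * sin u) with ay in * by lra; lra.
Qed.

Lemma cauchy_kernel_mult u : (m u * slice I (r * cos u - ax) (r * sin u - ay))%quat = c u.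
Proof.
unfold m, c; rewrite slice_mult by easy; pose proof (cauchy_N_pos u).
f_equal; unfold N in *; field; lra.
Qed.

Lemma cauchy_X_continuous t u : continuous (X t) u.
Proof. apply (ex_derive_continuous (V := R_NormedModule)); unfold X; auto_derive; easy. Qed.
Lemma cauchy_Y_continuous t u : continuous (Y t) u.
Proof. apply (ex_derive_continuous (V := R_NormedModule)); unfold Y; auto_derive; easy. Qed.
Lemma cauchy_X_continuous_l t u : continuous (fun t => X t u) t.
Proof. apply (ex_derive_continuous (V := R_NormedModule)); unfold X; auto_derive; easy. Qed.
Lemma cauchy_Y_continuous_l t u : continuous (fun t => Y t u) t.
Proof. apply (ex_derive_continuous (V := R_NormedModule)); unfold Y; auto_derive; easy. Qed.

Lemma cauchy_kernel_qcont u : qcont m u.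
Proof.
assert (hN := Rgt_not_eq _ _ (cauchy_N_pos u)); unfold N in hN.
apply qcont_slice; apply (ex_derive_continuous (V := R_NormedModule)); unfold N;
  auto_derive; intro e; apply hN; rewrite <- e; ring.
Qed.

Lemma cauchy_in_disc t u : 0 <= t <= 1 -> X t u ^ 2 + Y t u ^ 2 < 1.
Proof.
intro ht; pose proof (cauchy_circle_sqr u) as e; unfold X, Y.
set (p := r * cos u) in *; set (q := r * sin u) in *.
assert (ax * p + ay * q <= r ^ 2)
  by (pose proof (pow2_ge_0 (ax - p)); pose proof (pow2_ge_0 (ay - q)); lra).
replace (_ + _) with ((1 - t) ^ 2 * (ax ^ 2 + ay ^ 2) + t ^ 2 * (p ^ 2 + q ^ 2) +
  2 * t * (1 - t) * (ax * p + ay * q)) by ring.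
rewrite e; assert (r ^ 2 < 1) by nra.
assert ((1 - t) ^ 2 * (ax ^ 2 + ay ^ 2) <= (1 - t) ^ 2 * r ^ 2)
  by (apply Rmult_le_compat_l; [apply pow2_ge_0|lra]).
assert (2 * t * (1 - t) * (ax * p + ay * q) <= 2 * t * (1 - t) * r ^ 2)
  by (apply Rmult_le_compat_l; [apply Rmult_le_pos; lra|easy]).
assert ((1 - t) ^ 2 * r ^ 2 + t ^ 2 * r ^ 2 + 2 * t * (1 - t) * r ^ 2 = r ^ 2) by ring.
lra.
Qed.

Lemma cauchy_h_qcont t u : 0 <= t <= 1 -> qcont (h t) u.
Proof.
intro ht; destruct (hf (X t u) (Y t u)) as [D hD]; [now apply cauchy_in_disc|].
apply (slice_diff_qcont I f (X t) (Y t) u D); auto using cauchy_X_continuous, cauchy_Y_continuous.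
Qed.

Lemma cauchy_h_qcont_l t u : 0 <= t <= 1 -> qcont (fun t => h t u) t.
Proof.
intro ht; destruct (hf (X t u) (Y t u)) as [D hD]; [now apply cauchy_in_disc|].
apply (slice_diff_qcont I f (fun t => X t u) (fun t => Y t u) t D);
  auto using cauchy_X_continuous_l, cauchy_Y_continuous_l.
Qed.

Lemma Rabs_cos_minus u v : Rabs (cos u - cos v) <= Rabs (u - v).
Proof.
destruct (MVT_abs cos (fun x => - sin x) v u) as [x [hx _]].
- intros; apply derivable_pt_lim_cos.
- rewrite hx, Rabs_Ropp; pose proof (SIN_bound x) as b.
  rewrite <- (Rmult_1_l (Rabs (u - v))) at 2.
  apply Rmult_le_compat_r; [apply Rabs_pos|now apply Rabs_le].
Qed.

Lemma Rabs_sin_minus u v : Rabs (sin u - sin v) <= Rabs (u - v).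
Proof.
destruct (MVT_abs sin cos v u) as [x [hx _]].
- intros; apply derivable_pt_lim_sin.
- rewrite hx; pose proof (COS_bound x) as b.
  rewrite <- (Rmult_1_l (Rabs (u - v))) at 2.
  apply Rmult_le_compat_r; [apply Rabs_pos|now apply Rabs_le].
Qed.

Lemma cauchy_XY_lipschitz t u t' u' : 0 <= t <= 1 ->
  Rabs (X t' u' - X t u) <= 2 * Rabs (t' - t) + Rabs (u' - u) /\
  Rabs (Y t' u' - Y t u) <= 2 * Rabs (t' - t) + Rabs (u' - u).
Proof.
intro ht.
assert (aux : forall a p q, a ^ 2 < 1 -> -1 <= p <= 1 -> Rabs (p - q) <= Rabs (u' - u) ->
  Rabs ((a + t' * (r * p - a)) - (a + t * (r * q - a))) <= 2 * Rabs (t' - t) + Rabs (u' - u)).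
{ intros a p q h1 h2 h3.
  replace (_ - _) with ((t' - t) * (r * p - a) + t * r * (p - q)) by ring.
  apply Rle_trans with (1 := Rabs_triang _ _).
  apply Rplus_le_compat; rewrite Rabs_mult.
  - rewrite Rmult_comm; apply Rmult_le_compat_r; [apply Rabs_pos|].
    assert (-1 < a < 1) by (split; nra); assert (-1 <= r * p <= 1) by (split; nra).
    apply Rabs_le; lra.
  - rewrite Rabs_right by (apply Rle_ge, Rmult_le_pos; lra); pose proof (Rabs_pos (p - q)).
    assert (0 <= t * r <= 1) by nra; nra. }
split; apply aux; try apply COS_bound; try apply SIN_bound;
  try apply Rabs_cos_minus; try apply Rabs_sin_minus; nra.
Qed.

(** Up to a constant unit factor, the integral of [(z - a)^-1 f(z) dz] around the image of the
    rectangle [T x U] under [z = a + t (c u - a)]. Along [u] the factor [t] cancels and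
    [dz / (z - a)] is [I * m u du]; along [t] it is [dt / t]. Taking out [I] leaves the kernel [m u]
    in the first integral and [I / t] in the second. *)
Let E (T U : R * R) := (
  qRInt (fun u => m u * (h (snd T) u - h (fst T) u)) (fst U) (snd U) +
  qRInt (fun t => slice I 0 (/ t) * (h t (snd U) - h t (fst U))) (fst T) (snd T))%quat.

Lemma cauchy_int1_qcont t1 t2 u : 0 <= t1 <= 1 -> 0 <= t2 <= 1 ->
  qcont (fun u => m u * (h t2 u - h t1 u))%quat u.
Proof.
intros h1 h2; apply qcont_mult; [apply cauchy_kernel_qcont|].
apply qcont_minus; now apply cauchy_h_qcont.
Qed.

Lemma cauchy_inv_qcont t : 0 < t -> qcont (fun t => slice I 0 (/ t)) t.
Proof.
intro ht; apply (qcont_slice I (fun _ => 0)); [apply continuous_const|].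
apply (ex_derive_continuous (V := R_NormedModule)); auto_derive; lra.
Qed.

Lemma cauchy_int2_qcont u1 u2 t : 0 < t <= 1 ->
  qcont (fun t => slice I 0 (/ t) * (h t u2 - h t u1))%quat t.
Proof.
intros ht; apply qcont_mult; [now apply cauchy_inv_qcont|].
apply qcont_minus; apply cauchy_h_qcont_l; lra.
Qed.

Lemma RInt_cos_scal u1 u2 : RInt (fun u => r * cos u) u1 u2 = r * (sin u2 - sin u1).
Proof.
apply is_RInt_unique; replace (r * (sin u2 - sin u1)) with (r * sin u2 - r * sin u1) by ring.
apply (is_RInt_derive (V := R_CompleteNormedModule) (fun u => r * sin u)).
- intros x _; auto_derive; [easy|ring].
- intros x _; apply (ex_derive_continuous (V := R_NormedModule)); auto_derive; easy.
Qed.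

Lemma RInt_sin_scal u1 u2 : RInt (fun u => r * sin u) u1 u2 = r * (cos u1 - cos u2).
Proof.
apply is_RInt_unique;
  replace (r * (cos u1 - cos u2)) with ((- r * cos u2) - (- r * cos u1)) by ring.
apply (is_RInt_derive (V := R_CompleteNormedModule) (fun u => - r * cos u)).
- intros x _; auto_derive; [easy|ring].
- intros x _; apply (ex_derive_continuous (V := R_NormedModule)); auto_derive; easy.
Qed.

Lemma qRInt_close g g' u1 u2 K : u1 <= u2 -> qcont_on g u1 u2 -> qcont_on g' u1 u2 ->
  (forall s, u1 <= s <= u2 -> qnorm (g s - g' s)%quat <= K) ->
  qnorm (qRInt g u1 u2 - qRInt g' u1 u2)%quat <= 2 * (K * (u2 - u1)).
Proof.
intros hu hg hg' hK; rewrite <- qRInt_minus by easy.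
apply qnorm_qRInt_le; auto; intros s hs; apply qcont_minus; auto.
Qed.

(* For the affine part of [f] at a point, the two integrals cancel exactly, so
   only the error term of the differential contributes. *)
Lemma cauchy_local M t0 : 0 < t0 < 1 -> 0 < M ->
  (forall u, 0 <= u <= 2 * PI -> qnorm (m u) <= M) ->
  forall t u eps, t0 <= t <= 1 -> 0 <= u <= 2 * PI -> 0 < eps ->
  exists delta, 0 < delta /\ forall T U,
    fst T <= t <= snd T -> fst U <= u <= snd U ->
    t0 <= fst T -> snd T <= 1 -> 0 <= fst U -> snd U <= 2 * PI ->
    snd T - fst T < delta -> snd U - fst U < delta ->
    qnorm (E T U) <= eps * (snd T - fst T + (snd U - fst U)) ^ 2.
Proof.
intros ht0 hM hm t u eps ht hu heps.
destruct (hf (X t u) (Y t u)) as [D hD]; [apply cauchy_in_disc; lra|].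
assert (hit : 0 < / t0) by (apply Rinv_0_lt_compat; lra).
(* Each integral will be off by at most [2 * (kernel bound) * 8 e S * (side)], where the kernel
   bounds are [M] and [/ t0]. *)
set (e := eps / (16 * (M + / t0))).
assert (he : 0 < e) by (apply Rdiv_lt_0_compat; lra).
destruct (hD e he) as [d [hd hD']].
(* By the Lipschitz bound, [X] and [Y] then move by less than [3 * (d / 4)]. *)
exists (d / 4); split; [lra|].
intros [t1 t2] [u1 u2]; cbn [fst snd]; intros ht12 hu12 h1 h2 h3 h4 h5 h6.
set (S := t2 - t1 + (u2 - u1)).
set (L := fun t' u' => (f (slice I (X t u) (Y t u)) +
   slice I (X t' u' - X t u) (Y t' u' - Y t u) * D)%quat).
assert (hL : forall t' u', t1 <= t' <= t2 -> u1 <= u' <= u2 ->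
   qnorm (h t' u' - L t' u')%quat <= e * (4 * S)).
{ intros t' u' ht' hu'.
  destruct (cauchy_XY_lipschitz t u t' u') as [lx ly]; [lra|].
  assert (Rabs (t' - t) <= t2 - t1) by (apply Rabs_le; lra).
  assert (Rabs (u' - u) <= u2 - u1) by (apply Rabs_le; lra).
  replace (h t' u' - L t' u')%quat with
    (f (slice I (X t' u') (Y t' u')) - f (slice I (X t u) (Y t u)) -
       slice I (X t' u' - X t u) (Y t' u' - Y t u) * D)%quat
    by (unfold h, L; qring).
  apply Rle_trans with (1 := hD' (X t' u') (Y t' u') ltac:(lra) ltac:(lra)).
  apply Rmult_le_compat_l; unfold S; lra. }
assert (hS : 0 <= S) by (unfold S; lra).
(* The kernel times the increment of [z] in [t]: [m v * (t2 - t1) (c v - a) = (t2 - t1) c v]. *)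
set (G1 := fun v => slice I ((t2 - t1) * (r * cos v)) ((t2 - t1) * (r * sin v))).
assert (b1 : qnorm (qRInt (fun v => m v * (h t2 v - h t1 v))%quat u1 u2 -
   qRInt (fun v => G1 v * D)%quat u1 u2)%quat <= 2 * (M * (8 * e * S) * (u2 - u1))).
{ apply qRInt_close; [lra| | |].
  - intros s hs; apply cauchy_int1_qcont; lra.
  - intros s hs; apply qcont_mult; [|apply qcont_const].
    apply qcont_slice; apply (ex_derive_continuous (V := R_NormedModule)); auto_derive; easy.
  - intros v hv.
    replace (m v * (h t2 v - h t1 v) - G1 v * D)%quat
      with (m v * ((h t2 v - L t2 v) - (h t1 v - L t1 v)))%quat.
    + rewrite qnorm_mult; apply Rmult_le_compat; try apply qnorm_ge0; [apply hm; lra|].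
      apply Rle_trans with (1 := qnorm_minus_triang _ _).
      pose proof (hL t1 v ltac:(lra) hv); pose proof (hL t2 v ltac:(lra) hv); lra.
    + replace (G1 v) with (qscal (t2 - t1) (c v)) by (unfold G1, c, slice; qring).
      rewrite <- cauchy_kernel_mult.
      replace (h t2 v - L t2 v - (h t1 v - L t1 v))%quat
        with ((h t2 v - h t1 v) - (slice I (X t2 v - X t u) (Y t2 v - Y t u) -
               slice I (X t1 v - X t u) (Y t1 v - Y t u)) * D)%quat
        by (unfold L; qring).
      rewrite slice_minus.
      replace (slice I _ _) with
        (qscal (t2 - t1) (slice I (r * cos v - ax) (r * sin v - ay))).
      * generalize (h t2 v) (h t1 v) (m v) (slice I (r * cos v - ax) (r * sin v - ay)).
        intros; qring.
      * unfold X, Y, slice; qring. }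
(* Likewise [(I / s) * s (c u2 - c u1) = I (c u2 - c u1)], in which [s] has disappeared. *)
set (G2 := fun s : R => slice I (- (r * (sin u2 - sin u1))) (r * (cos u2 - cos u1))).
assert (b2 : qnorm (qRInt (fun s => slice I 0 (/ s) * (h s u2 - h s u1))%quat t1 t2 -
   qRInt (fun s => G2 s * D)%quat t1 t2)%quat <= 2 * (/ t0 * (8 * e * S) * (t2 - t1))).
{ apply qRInt_close; [lra| | |].
  - intros s hs; apply cauchy_int2_qcont; lra.
  - intros s hs; apply qcont_const.
  - intros s hs.
    replace (slice I 0 (/ s) * (h s u2 - h s u1) - G2 s * D)%quat
      with (slice I 0 (/ s) * ((h s u2 - L s u2) - (h s u1 - L s u1)))%quat.
    + rewrite qnorm_mult; apply Rmult_le_compat; try apply qnorm_ge0.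
      * apply Rle_trans with (1 := qnorm_slice_le _ _ _ hI).
        rewrite Rabs_R0, Rplus_0_l, Rabs_right by (left; apply Rinv_0_lt_compat; lra).
        apply Rinv_le_contravar; lra.
      * apply Rle_trans with (1 := qnorm_minus_triang _ _).
        pose proof (hL s u1 hs ltac:(lra)); pose proof (hL s u2 hs ltac:(lra)); lra.
    + replace (h s u2 - L s u2 - (h s u1 - L s u1))%quat
        with ((h s u2 - h s u1) - (slice I (X s u2 - X t u) (Y s u2 - Y t u) -
               slice I (X s u1 - X t u) (Y s u1 - Y t u)) * D)%quat
        by (unfold L; qring).
      rewrite slice_minus.
      replace (G2 s) with (slice I 0 (/ s) * slice I (X s u2 - X t u - (X s u1 - X t u))
         (Y s u2 - Y t u - (Y s u1 - Y t u)))%quat.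
      * generalize (slice I 0 (/ s)) (h s u2) (h s u1)
          (slice I (X s u2 - X t u - (X s u1 - X t u)) (Y s u2 - Y t u - (Y s u1 - Y t u))).
        intros; qring.
      * rewrite slice_mult by easy; unfold G2, X, Y; f_equal; field; lra. }
(* The integral of [c] from [u1] to [u2] is [- I (c u2 - c u1)], so the two contributions are
   opposite. *)
assert (e0 : (qRInt (fun v => G1 v * D) u1 u2 + qRInt (fun s => G2 s * D) t1 t2)%quat = RtoQ 0).
{ unfold G1, G2; rewrite (qRInt_slice_mult_r I (fun v => (t2 - t1) * (r * cos v))
    (fun v => (t2 - t1) * (r * sin v))); [|lra| |];
    [|intros; apply (ex_derive_continuous (V := R_NormedModule)); auto_derive; easy
     |intros; apply (ex_derive_continuous (V := R_NormedModule)); auto_derive; easy].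
  rewrite (qRInt_slice_mult_r I (fun _ => - (r * (sin u2 - sin u1)))
    (fun _ => r * (cos u2 - cos u1))); [|lra| |]; [|intros; apply continuous_const..].
  rewrite <- qmult_plus_distr_r, slice_plus, !RInt_const.
  assert (ec : RInt (fun v => (t2 - t1) * (r * cos v)) u1 u2
    = (t2 - t1) * (r * (sin u2 - sin u1))).
  { rewrite <- RInt_cos_scal; apply (RInt_scal (V := R_CompleteNormedModule)).
    apply (ex_RInt_continuous (V := R_CompleteNormedModule)); intros z _.
    apply (ex_derive_continuous (V := R_NormedModule)); auto_derive; easy. }
  assert (es : RInt (fun v => (t2 - t1) * (r * sin v)) u1 u2
    = (t2 - t1) * (r * (cos u1 - cos u2))).
  { rewrite <- RInt_sin_scal; apply (RInt_scal (V := R_CompleteNormedModule)).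
    apply (ex_RInt_continuous (V := R_CompleteNormedModule)); intros z _.
    apply (ex_derive_continuous (V := R_NormedModule)); auto_derive; easy. }
  transitivity (slice I
    ((t2 - t1) * (r * (sin u2 - sin u1)) + (t2 - t1) * - (r * (sin u2 - sin u1)))
    ((t2 - t1) * (r * (cos u1 - cos u2)) + (t2 - t1) * (r * (cos u2 - cos u1))) * D)%quat.
  - rewrite <- ec, <- es; reflexivity.
  - unfold slice; qring. }
unfold E; cbn [fst snd].
set (A1 := qRInt (fun v => m v * (h t2 v - h t1 v))%quat u1 u2) in *.
set (A2 := qRInt (fun s => slice I 0 (/ s) * (h s u2 - h s u1))%quat t1 t2) in *.
set (B1 := qRInt (fun v => G1 v * D)%quat u1 u2) in *.
set (B2 := qRInt (fun v => G2 v * D)%quat t1 t2) in *.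
replace (A1 + A2)%quat with ((A1 - B1) + (A2 - B2))%quat.
2:{ replace (A1 - B1 + (A2 - B2))%quat with (A1 + A2 - (B1 + B2))%quat by qring.
    rewrite e0; generalize (A1 + A2)%quat; intro A; qring. }
apply Rle_trans with (1 := qnorm_triang _ _).
assert (ee : eps = 16 * e * M + 16 * e * / t0) by (unfold e; set (i := / t0) in *; field; lra).
apply Rle_trans with (16 * e * M * S * S + 16 * e * / t0 * S * S);
  [|rewrite ee; right; ring].
apply Rplus_le_compat; [apply Rle_trans with (1 := b1)|apply Rle_trans with (1 := b2)].
- replace (2 * _) with (16 * e * M * S * (u2 - u1)) by ring.
  apply Rmult_le_compat_l; [|unfold S; lra].
  apply Rmult_le_pos; [apply Rmult_le_pos; [apply Rmult_le_pos|]|]; lra.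
- replace (2 * _) with (16 * e * / t0 * S * (t2 - t1)) by ring.
  apply Rmult_le_compat_l; [|unfold S; lra].
  apply Rmult_le_pos; [apply Rmult_le_pos; [apply Rmult_le_pos|]|]; lra.
Qed.

(** A positive [t0] keeps the rectangle away from the pole of [/ t], that is, from the point [a]. *)
Lemma cauchy_E_zero t0 : 0 < t0 < 1 -> E (t0, 1) (0, 2 * PI) = RtoQ 0.
Proof.
intro ht0; pose proof PI_RGT_0.
destruct (qcont_on_bounded m 0 (2 * PI)) as [M [hM hm]];
  [lra|intros s _; apply cauchy_kernel_qcont|].
apply goursat_bisection; cbn [fst snd]; [lra|lra| | |].
- intros t1 t2 t3 J h1 h2 h3 h4; unfold E; cbn [fst snd].
  rewrite (qRInt_Chasles _ t1 t2 t3); [|lra|intros s hs; apply cauchy_int2_qcont; lra].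
  rewrite (qRInt_ext (fun u => m u * (h t3 u - h t1 u))%quat
    (fun u => m u * (h t2 u - h t1 u) + m u * (h t3 u - h t2 u))%quat);
    [|lra|intros; qring].
  rewrite qRInt_plus; [|lra|intros s hs; apply cauchy_int1_qcont; lra
    |intros s hs; apply cauchy_int1_qcont; lra].
  match goal with |- (?a + ?b + (?c + ?d))%quat = _ => generalize a b c d end.
  intros; qring.
- intros T u1 u2 u3 h1 h2 h3 h4; unfold E; cbn [fst snd].
  rewrite (qRInt_Chasles _ u1 u2 u3); [|lra|intros s hs; apply cauchy_int1_qcont; lra].
  rewrite (qRInt_ext (fun t => slice I 0 (/ t) * (h t u3 - h t u1))%quat
    (fun t => slice I 0 (/ t) * (h t u2 - h t u1) + slice I 0 (/ t) * (h t u3 - h t u2))%quat);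
    [|lra|intros; qring].
  rewrite qRInt_plus; [|lra|intros s hs; apply cauchy_int2_qcont; lra
    |intros s hs; apply cauchy_int2_qcont; lra].
  match goal with |- (?a + ?b + (?c + ?d))%quat = _ => generalize a b c d end.
  intros; qring.
- exact (cauchy_local M t0 ht0 hM hm).
Qed.

(** The integrand of the [t] integral vanishes because [u = 0] and [u = 2 PI] give the same
    point. *)
Lemma cauchy_annulus t0 : 0 < t0 < 1 ->
  qRInt (fun u => m u * (h 1 u - h t0 u))%quat 0 (2 * PI) = RtoQ 0.
Proof.
intro ht0; pose proof (cauchy_E_zero t0 ht0) as e; unfold E in e; cbn [fst snd] in e.
rewrite (qRInt_ext (fun t => _ * (h t (2 * PI) - h t 0))%quat
  (fun t => RtoQ 0 * RtoQ 0)%quat), qRInt_mult_l, qmult_0_l, qplus_0_r in e; try easy; try lra.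
- intros s _; apply qcont_const.
- intros t _; unfold h, X, Y; rewrite cos_2PI, sin_2PI, cos_0, sin_0; qring.
Qed.

Lemma cauchy_h_1 u : h 1 u = f (c u).
Proof. unfold h, X, Y, c; do 2 f_equal; ring. Qed.

Lemma cauchy_circle_f_qcont u : qcont (fun u => f (c u)) u.
Proof. apply (qcont_ext (h 1)); [exact cauchy_h_1|apply cauchy_h_qcont; lra]. Qed.

(** The circle is shrunk to [a]: as [t0] tends to 0, [h t0 u] tends to [f a] uniformly in [u].
    Keeping the difference with [f a] inside avoids computing the integral of the kernel [m] by
    itself. *)
Lemma cauchy_centered :
  qRInt (fun u => m u * (f (c u) - f (slice I ax ay)))%quat 0 (2 * PI) = RtoQ 0.
Proof.
pose proof PI_RGT_0 as hpi; apply qnorm_eq0; apply Rle_antisym; [|apply qnorm_ge0].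
apply le_epsilon; intros eps heps; rewrite Rplus_0_l.
destruct (qcont_on_bounded m 0 (2 * PI)) as [M [hM hm]];
  [lra|intros s _; apply cauchy_kernel_qcont|].
destruct (hf ax ay) as [D hD]; [nra|].
destruct (slice_diff_continuous _ _ _ _ _ hI hD (eps / (4 * PI * M))) as [d [hd hd']].
{ apply Rdiv_lt_0_compat; [easy|apply Rmult_lt_0_compat; lra]. }
(* The shrunken circle lies within [2 * t0 < d] of [a] in each coordinate. *)
set (t0 := Rmin (1 / 2) (d / 4)).
assert (ht0 : 0 < t0 < 1 /\ t0 <= d / 4).
{ pose proof (Rmin_l (1 / 2) (d / 4)); pose proof (Rmin_r (1 / 2) (d / 4)).
  assert (0 < t0) by (apply Rmin_glb_lt; lra); unfold t0 in *; lra. }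
rewrite (qRInt_ext _ (fun u => m u * (h 1 u - h t0 u) + m u * (h t0 u - f (slice I ax ay)))%quat);
  [|lra|intros; rewrite cauchy_h_1; qring].
assert (hq : forall u, qcont (fun u => m u * (h t0 u - f (slice I ax ay)))%quat u).
{ intro u; apply qcont_mult; [apply cauchy_kernel_qcont|].
  apply qcont_minus; [apply cauchy_h_qcont; lra|apply qcont_const]. }
rewrite qRInt_plus; [|lra|intros s hs; apply cauchy_int1_qcont; lra|intros s _; apply hq].
rewrite cauchy_annulus, qplus_0_l by lra.
apply Rle_trans with (2 * (M * (eps / (4 * PI * M)) * (2 * PI - 0)));
  [|right; field; lra].
apply qnorm_qRInt_le; [lra|intros s _; apply hq|].
intros s hs; rewrite qnorm_mult.
apply Rmult_le_compat; try apply qnorm_ge0; [now apply hm|left].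
destruct (cauchy_XY_lipschitz 0 s t0 s) as [lx ly]; [lra|].
replace (X 0 s) with ax in lx by (unfold X; ring).
replace (Y 0 s) with ay in ly by (unfold Y; ring).
rewrite !Rminus_0_r, (Rminus_diag s), Rabs_R0, (Rabs_right t0) in * by lra.
apply hd'; lra.
Qed.

(** The inverse of [c u]; the kernel [m u] is the sum of the geometric series with ratio
    [a * inv_c u]. *)
Let inv_c u := slice I (cos u / r) (- sin u / r).

Lemma cauchy_inv_c_pow n u :
  (inv_c u ^ n)%quat = slice I (/ r ^ n * cos (INR n * u)) (- / r ^ n * sin (INR n * u)).
Proof.
induction n as [|n IH].
- cbn [qpow pow INR]; rewrite Rmult_0_l, cos_0, sin_0; unfold slice; qring; field.
- cbn [qpow]; rewrite IH; unfold inv_c; rewrite slice_mult, S_INR by easy.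
  rewrite Rmult_plus_distr_r, Rmult_1_l, cos_plus, sin_plus; cbn [pow].
  pose proof (pow_lt r n (proj1 hr)); f_equal; field; lra.
Qed.

Lemma cauchy_inv_c_qcont n u : qcont (fun u => inv_c u ^ n)%quat u.
Proof.
apply (qcont_ext _ _ _ (fun v => eq_sym (cauchy_inv_c_pow n v))).
apply qcont_slice; apply (ex_derive_continuous (V := R_NormedModule)); auto_derive; easy.
Qed.

Lemma cauchy_inv_c_mult u : (c u * inv_c u)%quat = RtoQ 1.
Proof.
unfold c, inv_c; rewrite slice_mult by easy.
pose proof (sin2_cos2 u) as e; unfold Rsqr in e.
replace (r * cos u * (cos u / r) - r * sin u * (- sin u / r)) with 1
  by (rewrite <- e; field; lra).
replace (r * cos u * (- sin u / r) + r * sin u * (cos u / r)) with 0 by (field; lra).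
unfold slice; qring.
Qed.

Lemma cauchy_inv_c_norm u : qnorm (inv_c u) = / r.
Proof.
pose proof (f_equal qnorm (cauchy_inv_c_mult u)) as e.
rewrite qnorm_mult, qnorm_1 in e.
assert (hc : qnorm (c u) = r).
{ unfold c; rewrite qnorm_slice, cauchy_circle_sqr by easy.
  rewrite <- Rsqr_pow2; apply sqrt_Rsqr; lra. }
rewrite hc in e; apply Rmult_eq_reg_l with r; [|lra]; rewrite e, Rinv_r; lra.
Qed.

Lemma qRInt_inv_c_pow n D : qRInt (fun u => inv_c u ^ n * D)%quat 0 (2 * PI) =
  match n with O => qscal (2 * PI) D | S _ => RtoQ 0 end.
Proof.
pose proof PI_RGT_0 as hpi.
rewrite (qRInt_ext _ (fun u => slice I (/ r ^ n * cos (INR n * u))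
    (- / r ^ n * sin (INR n * u)) * D)%quat); [|lra|intros; now rewrite cauchy_inv_c_pow].
rewrite (qRInt_slice_mult_r I (fun u => / r ^ n * cos (INR n * u))
    (fun u => - / r ^ n * sin (INR n * u))); [|lra| |];
  [|intros; apply (ex_derive_continuous (V := R_NormedModule)); auto_derive; easy..].
destruct n as [|n].
- rewrite (RInt_ext_fun _ (fun _ => 1)) by (intro; cbn [INR pow]; rewrite Rmult_0_l, cos_0; field).
  rewrite (RInt_ext_fun (fun u => - _ * _) (fun _ => 0))
    by (intro; cbn [INR pow]; rewrite Rmult_0_l, sin_0; ring).
  rewrite !RInt_const; unfold slice, scal; cbn; unfold mult; cbn; qring.
- set (k := INR (S n)); assert (hk : 0 < k) by (apply lt_0_INR; lia).
  set (q := / r ^ S n).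
  assert (e1 : RInt (fun u => q * cos (k * u)) 0 (2 * PI) = 0).
  { apply is_RInt_unique.
    replace 0 with (q * / k * sin (k * (2 * PI)) - q * / k * sin (k * 0)) at 2.
    - apply (is_RInt_derive (V := R_CompleteNormedModule) (fun u => q * / k * sin (k * u))).
      + intros x _; auto_derive; [easy|field; lra].
      + intros x _; apply (ex_derive_continuous (V := R_NormedModule)); auto_derive; easy.
    - unfold k; rewrite Rmult_0_r, sin_0.
      replace (INR (S n) * (2 * PI)) with (0 + 2 * INR (S n) * PI) by ring.
      rewrite sin_period, sin_0; ring. }
  assert (e2 : RInt (fun u => - q * sin (k * u)) 0 (2 * PI) = 0).
  { apply is_RInt_unique.
    replace 0 with (q * / k * cos (k * (2 * PI)) - q * / k * cos (k * 0)) at 2.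
    - apply (is_RInt_derive (V := R_CompleteNormedModule) (fun u => q * / k * cos (k * u))).
      + intros x _; auto_derive; [easy|field; lra].
      + intros x _; apply (ex_derive_continuous (V := R_NormedModule)); auto_derive; easy.
    - unfold k; rewrite Rmult_0_r, cos_0.
      replace (INR (S n) * (2 * PI)) with (0 + 2 * INR (S n) * PI) by ring.
      rewrite cos_period, cos_0; ring. }
  transitivity (slice I 0 0 * D)%quat; [|unfold slice; qring].
  apply (f_equal (fun z => z * D)%quat), (f_equal2 (slice I)); [exact e1|exact e2].
Qed.

(** A priori this depends on the slice and on the radius; [coefs_unique] will remove the
    dependence. *)
Definition cauchy_coef (n : nat) : quat :=
  qscal (/ (2 * PI)) (qRInt (fun u => inv_c u ^ n * f (c u))%quat 0 (2 * PI)).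

(** The kernel is cut into a partial geometric sum and the remainder [m u * (a * inv_c u) ^ N].
    Integrated against [f (c u) - f a], the full kernel gives 0, so the partial sum of the series
    misses [f a] only by the remainder, of ratio [qnorm a / r < 1]. *)
Lemma cauchy_series :
  qlim (qsum (fun n => slice I ax ay ^ n * cauchy_coef n)%quat) (f (slice I ax ay)).
Proof.
pose proof PI_RGT_0 as hpi.
set (a := slice I ax ay).
assert (har : qnorm a < r).
{ unfold a; rewrite qnorm_slice by easy.
  rewrite <- (sqrt_Rsqr r) by lra; apply sqrt_lt_1_alt; unfold Rsqr; nra. }
set (g := fun u => (f (c u) - f a)%quat).
assert (hg : forall u, qcont g u).
{ intro u; apply qcont_minus; [apply cauchy_circle_f_qcont|apply qcont_const]. }
destruct (qcont_on_bounded m 0 (2 * PI)) as [M [hM hm]];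
  [lra|intros s _; apply cauchy_kernel_qcont|].
destruct (qcont_on_bounded g 0 (2 * PI)) as [G [hG hgb]]; [lra|intros s _; apply hg|].
assert (hcomm : forall u n, ((a * inv_c u) ^ n)%quat = (a ^ n * inv_c u ^ n)%quat).
{ intros u n; induction n as [|n IH]; cbn [qpow]; [qring|rewrite IH].
  assert (e : (inv_c u * a ^ n)%quat = (a ^ n * inv_c u)%quat).
  { clear IH; induction n as [|n IH]; cbn [qpow]; [qring|].
    replace (inv_c u * (a * a ^ n))%quat with ((inv_c u * a) * a ^ n)%quat by qring.
    replace (inv_c u * a)%quat with (a * inv_c u)%quat
      by (unfold a, inv_c; rewrite !slice_mult by easy; f_equal; ring).
    now rewrite qmult_assoc, IH, <- qmult_assoc. }
  replace (a * inv_c u * (a ^ n * inv_c u ^ n))%quat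
    with (a * (inv_c u * a ^ n) * inv_c u ^ n)%quat by qring.
  rewrite e; qring. }
assert (hker : forall u, (m u * (RtoQ 1 - a * inv_c u))%quat = RtoQ 1).
{ intro u; rewrite <- (cauchy_inv_c_mult u) at 1.
  replace (c u * inv_c u - a * inv_c u)%quat with ((c u - a) * inv_c u)%quat by qring.
  unfold c at 1, a; rewrite slice_minus, <- qmult_assoc, cauchy_kernel_mult.
  apply cauchy_inv_c_mult. }
assert (hgeo : forall u N, qsum (fun n => (a * inv_c u) ^ n)%quat N =
   (m u - m u * (a * inv_c u) ^ N)%quat).
{ intros u L; pose proof (qsum_geom (a * inv_c u)%quat L) as e.
  rewrite <- (qmult_1_l (qsum _ L)), <- (hker u), qmult_assoc.
  replace (_ * qsum _ L)%quat with (RtoQ 1 - (a * inv_c u) ^ L)%quat; [qring|].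
  replace (RtoQ 1 - (a * inv_c u) ^ L)%quat
    with (RtoQ (-1) * ((a * inv_c u) ^ L - RtoQ 1))%quat by qring.
  rewrite <- e; qring. }
(* The integral of the partial geometric sum against [g] is evaluated twice: through the closed form
   ([e1]) and term by term ([e2]). The term [n = 0] produces [f a], hence [0 < N]. *)
assert (key : forall N, (0 < N)%nat ->
  (qsum (fun n => a ^ n * cauchy_coef n)%quat N - f a)%quat =
  qscal (- / (2 * PI)) (qRInt (fun u => m u * (a * inv_c u) ^ N * g u)%quat 0 (2 * PI))).
{ intros L hL.
  assert (hq1 : forall n u, qcont (fun u => inv_c u ^ n * f (c u))%quat u).
  { intros; apply qcont_mult; [apply cauchy_inv_c_qcont|apply cauchy_circle_f_qcont]. }
  assert (hq2 : forall n u, qcont (fun u => inv_c u ^ n * f a)%quat u).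
  { intros; apply qcont_mult; [apply cauchy_inv_c_qcont|apply qcont_const]. }
  assert (hq3 : forall n u, qcont (fun u => inv_c u ^ n * g u)%quat u).
  { intros; apply qcont_mult; [apply cauchy_inv_c_qcont|apply hg]. }
  assert (hq4 : forall u, qcont (fun u => m u * (a * inv_c u) ^ L * g u)%quat u).
  { intro u; apply qcont_mult; [|apply hg]; apply qcont_mult; [apply cauchy_kernel_qcont|].
    apply (qcont_ext (fun u => a ^ L * inv_c u ^ L)%quat); [intro; now rewrite hcomm|].
    apply qcont_mult; [apply qcont_const|apply cauchy_inv_c_qcont]. }
  assert (e1 : qRInt (fun u => qsum (fun n => a ^ n * (inv_c u ^ n * g u))%quat L) 0 (2 * PI) =
    (RtoQ 0 - qRInt (fun u => m u * (a * inv_c u) ^ L * g u)%quat 0 (2 * PI))%quat).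
  { rewrite <- cauchy_centered, <- qRInt_minus; [|lra| |intros s _; apply hq4].
    - apply qRInt_ext; [lra|]; intros u _; fold a; fold (g u).
      rewrite (qsum_ext _ (fun n => (a * inv_c u) ^ n * g u)%quat)
        by (intros; rewrite hcomm; qring).
      rewrite qsum_mult_r, hgeo; qring.
    - intros s _; apply qcont_mult; [apply cauchy_kernel_qcont|apply hg]. }
  assert (e2 : qRInt (fun u => qsum (fun n => a ^ n * (inv_c u ^ n * g u))%quat L) 0 (2 * PI) =
    (qsum (fun n => a ^ n * qRInt (fun u => inv_c u ^ n * f (c u)) 0 (2 * PI)) L
      - qscal (2 * PI) (f a))%quat).
  { rewrite (proj2 (qRInt_qsum (fun n u => a ^ n * (inv_c u ^ n * g u))%quat 0 (2 * PI) L
      ltac:(lra) ltac:(intros n s _; apply qcont_mult; [apply qcont_const|apply hq3]))).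
    rewrite (qsum_ext _ (fun n => a ^ n * qRInt (fun u => inv_c u ^ n * f (c u)) 0 (2 * PI) -
      a ^ n * match n with O => qscal (2 * PI) (f a) | S _ => RtoQ 0 end)%quat).
    - rewrite qsum_minus; f_equal; destruct L as [|L]; [lia|].
      rewrite qsum_S_l, qsum_0; [cbn [qpow]; qring|intros; apply qmult_0_r].
    - intros n _; rewrite <- qRInt_inv_c_pow, qRInt_mult_l;
        [|lra|intros s _; apply hq3].
      rewrite (qRInt_ext (fun u => inv_c u ^ n * g u)%quat
        (fun u => inv_c u ^ n * f (c u) - inv_c u ^ n * f a)%quat);
        [|lra|intros; unfold g; qring].
      rewrite qRInt_minus; [|lra|intros s _; apply hq1|intros s _; apply hq2].
      generalize (qRInt (fun u => inv_c u ^ n * f (c u))%quat 0 (2 * PI)).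
      generalize (qRInt (fun u => inv_c u ^ n * f a)%quat 0 (2 * PI)); intros; qring. }
  rewrite e1 in e2.
  set (P := qRInt (fun u => m u * (a * inv_c u) ^ L * g u)%quat 0 (2 * PI)) in *.
  replace (qscal (- / (2 * PI)) P) with (qscal (/ (2 * PI)) (RtoQ 0 - P)%quat) by qring.
  rewrite e2.
  rewrite (qsum_ext (fun n => a ^ n * cauchy_coef n)%quat (fun n =>
    qscal (/ (2 * PI)) (a ^ n * qRInt (fun u => inv_c u ^ n * f (c u)) 0 (2 * PI))%quat)).
  - rewrite qscal_qsum.
    match goal with |- context [qsum ?u L] => generalize (qsum u L) end.
    intro Q; qring; field; lra.
  - intros n _; unfold cauchy_coef.
    match goal with |- context [qRInt ?u 0 (2 * PI)] => generalize (qRInt u 0 (2 * PI)) end.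
    intros; qring. }
set (t := qnorm a * / r).
assert (ht : 0 <= t < 1).
{ pose proof (qnorm_ge0 a); assert (0 < / r) by (apply Rinv_0_lt_compat; lra).
  split; [unfold t; apply Rmult_le_pos; lra|].
  apply Rmult_lt_reg_r with r; [lra|]; unfold t; rewrite Rmult_assoc, Rinv_l; lra. }
assert (bound : forall N, (0 < N)%nat ->
  qnorm (qsum (fun n => a ^ n * cauchy_coef n) N - f a)%quat <= 2 * M * G * t ^ N).
{ intros L hL; rewrite key, qnorm_scal by easy.
  assert (hi : 0 < / (2 * PI)) by (apply Rinv_0_lt_compat; lra).
  rewrite Rabs_Ropp, Rabs_right by lra.
  apply Rle_trans with (/ (2 * PI) * (2 * (M * t ^ L * G * (2 * PI - 0))));
    [|right; field; lra].
  apply Rmult_le_compat_l; [lra|]; apply qnorm_qRInt_le; [lra| |].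
  - intros u _; apply qcont_mult; [|apply hg]; apply qcont_mult; [apply cauchy_kernel_qcont|].
    apply (qcont_ext (fun u => a ^ L * inv_c u ^ L)%quat); [intro; now rewrite hcomm|].
    apply qcont_mult; [apply qcont_const|apply cauchy_inv_c_qcont].
  - intros u hu; rewrite !qnorm_mult, qnorm_pow, qnorm_mult, cauchy_inv_c_norm; fold t.
    pose proof (pow_le t L (proj1 ht)).
    apply Rmult_le_compat; [|apply qnorm_ge0| |now apply hgb].
    + apply Rmult_le_pos; [apply qnorm_ge0|easy].
    + apply Rmult_le_compat_r; [easy|now apply hm]. }
assert (hl : is_lim_seq (fun N => 2 * M * G * t ^ N) (2 * M * G * 0)).
{ apply (is_lim_seq_scal_l _ (2 * M * G) 0), is_lim_seq_geom; rewrite Rabs_right; lra. }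
rewrite Rmult_0_r in hl; apply is_lim_seq_spec in hl.
intros eps heps; destruct (hl (mkposreal eps heps)) as [K hK]; exists (S K); intros n hn.
apply Rle_lt_trans with (1 := bound n ltac:(lia)).
specialize (hK n ltac:(lia)); cbn in hK; rewrite Rminus_0_r in hK.
now apply Rabs_def2 in hK.
Qed.

End CauchyFormula.

(** * Slice regular functions are power series *)

Lemma Derive_eps (g : R -> R) x a :
  (forall eps, 0 < eps -> exists delta, 0 < delta /\ forall t, Rabs (t - x) < delta ->
     Rabs (g t - g x - (t - x) * a) <= eps * Rabs (t - x)) -> Derive g x = a.
Proof.
intro h; apply is_derive_unique, is_derive_Reals; intros eps heps.
destruct (h (eps / 2)) as [d [hd hd']]; [lra|].
exists (mkposreal d hd); intros t ht htd; cbn in htd.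
specialize (hd' (x + t)); replace (x + t - x) with t in hd' by ring.
specialize (hd' htd); pose proof (Rabs_pos_lt t ht).
replace ((g (x + t) - g x) / t - a) with ((g (x + t) - g x - t * a) / t) by (field; easy).
unfold Rdiv; rewrite Rabs_mult, Rabs_inv.
apply Rmult_lt_reg_r with (Rabs t); [easy|].
rewrite Rmult_assoc, Rinv_l by lra; nra.
Qed.

Lemma qDerive_eps (g : R -> quat) x A :
  (forall eps, 0 < eps -> exists delta, 0 < delta /\ forall t, Rabs (t - x) < delta ->
     qnorm (g t - g x - qscal (t - x) A)%quat <= eps * Rabs (t - x)) -> qDerive g x = A.
Proof.
intro h; unfold qDerive; apply quat_ext; cbn [qre qi qj qk fst snd]; apply Derive_eps;
 intros eps he; destruct (h eps he) as [d [hd hd']]; exists d; split; try easy;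
 intros t ht; apply Rle_trans with (2 := hd' t ht).
- exact (Rabs_qre_le (g t - g x - qscal (t - x) A)%quat).
- exact (Rabs_qi_le (g t - g x - qscal (t - x) A)%quat).
- exact (Rabs_qj_le (g t - g x - qscal (t - x) A)%quat).
- exact (Rabs_qk_le (g t - g x - qscal (t - x) A)%quat).
Qed.

Lemma partial_derivatives (I : quat) f x y A B :
  (forall eps, 0 < eps -> exists delta, 0 < delta /\ forall x' y',
    Rabs (x' - x) < delta -> Rabs (y' - y) < delta ->
    qnorm (f (slice I x' y') - f (slice I x y) -
      (qscal (x' - x) A + qscal (y' - y) B))%quat
      <= eps * (Rabs (x' - x) + Rabs (y' - y))) ->
  slice_dx I f x y = A /\ slice_dy I f x y = B.
Proof.
intro h; split; apply qDerive_eps; intros eps he; destruct (h eps he) as [d [hd hd']];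
  exists d; split; try easy; intros t ht.
- specialize (hd' t y ht); rewrite Rminus_diag, Rabs_R0, Rplus_0_r in hd'.
  replace (qscal (t - x) A) with (qscal (t - x) A + qscal 0 B)%quat by qring; auto.
- specialize (hd' x t); rewrite Rminus_diag, Rabs_R0, Rplus_0_l in hd'.
  replace (qscal (t - y) B) with (qscal 0 A + qscal (t - y) B)%quat by qring; auto.
Qed.

Lemma slice_scal_decomp I u v D : (slice I u v * D)%quat = (qscal u D + qscal v (I * D))%quat.
Proof. unfold slice; qring. Qed.

Lemma slice_diff_partial I f x y D : slice_diff I f x y D ->
  slice_dx I f x y = D /\ slice_dy I f x y = (I * D)%quat.
Proof.
intro h; apply partial_derivatives; intros eps he.
destruct (h eps he) as [d [hd hd']]; exists d; split; [easy|]; intros x' y' hx hy.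
rewrite <- slice_scal_decomp; auto.
Qed.

Lemma norm_pair_bounds (u v : R) :
  Rabs u <= norm (u, v) /\ Rabs v <= norm (u, v) /\ norm (u, v) <= Rabs u + Rabs v.
Proof.
change (norm (u, v)) with (sqrt (Rabs u ^ 2 + Rabs v ^ 2)).
pose proof (Rabs_pos u); pose proof (Rabs_pos v).
split; [|split].
- rewrite <- (sqrt_Rsqr (Rabs u)) at 1 by lra; apply sqrt_le_1_alt; unfold Rsqr; nra.
- rewrite <- (sqrt_Rsqr (Rabs v)) at 1 by lra; apply sqrt_le_1_alt; unfold Rsqr; nra.
- rewrite <- (sqrt_Rsqr (Rabs u + Rabs v)) by lra; apply sqrt_le_1_alt; unfold Rsqr; nra.
Qed.

Lemma filterdiff_partial (F : R * R -> quat) x y l :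
  filterdiff F (locally (x, y)) l ->
  forall eps, 0 < eps -> exists delta, 0 < delta /\ forall x' y',
    Rabs (x' - x) < delta -> Rabs (y' - y) < delta ->
    qnorm (F (x', y') - F (x, y) -
      (qscal (x' - x) (l (1, 0)) + qscal (y' - y) (l (0, 1))))%quat
      <= eps * (Rabs (x' - x) + Rabs (y' - y)).
Proof.
intros [hl hd] eps he.
specialize (hd (x, y) ltac:(intros P hP; exact hP) (mkposreal eps he)).
destruct hd as [d hd']; exists d; split; [apply cond_pos|]; intros x' y' hx hy.
specialize (hd' (x', y') ltac:(split; [exact hx|exact hy])).
cbn [pos] in hd'.
assert (e : l (minus (x', y') (x, y)) =
  (qscal (x' - x) (l (1, 0)) + qscal (y' - y) (l (0, 1)))%quat).
{ transitivity (l (plus (scal (x' - x) (1, 0)) (scal (y' - y) (0, 1)))).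
  - f_equal; unfold minus, plus, scal, opp; cbn; unfold prod_plus, prod_scal, prod_opp; cbn.
    unfold minus, plus, scal, opp, mult; cbn; unfold mult; cbn; f_equal; ring.
  - rewrite (linear_plus l hl), !(linear_scal l hl); reflexivity. }
apply Rle_trans with (eps * norm (x' - x, y' - y)).
- rewrite <- norm_qnorm, <- e; exact hd'.
- apply Rmult_le_compat_l; [lra|apply norm_pair_bounds].
Qed.

Lemma slice_diff_ex_filterdiff I f x y D : imag_unit I -> slice_diff I f x y D ->
  ex_filterdiff (fun p : R * R => f (slice I (fst p) (snd p))) (locally (x, y)).
Proof.
intros hI h; exists (fun p : R * R => slice I (fst p) (snd p) * D)%quat; split.
- split.
  + intros [u v] [u' v']; change (plus (u, v) (u', v')) with (u + u', v + v').
    cbn [fst snd]; rewrite <- slice_plus.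
    change (plus ?a ?b) with (qplus a b); qring.
  + intros k [u v]; change (scal k (u, v)) with (k * u, k * v); cbn [fst snd].
    change (scal k ?a) with (qscal k a); unfold slice; qring.
  + pose proof (qnorm_ge0 D); exists (2 * (qnorm D + 1)); split; [lra|]; intros [u v].
    rewrite norm_qnorm, qnorm_mult; cbn [fst snd].
    pose proof (qnorm_slice_le I u v hI) as hs; destruct (norm_pair_bounds u v) as [h1 [h2 _]].
    assert (aux : forall s u v n d, 0 <= d -> 0 <= u -> s <= u + v -> u <= n -> v <= n ->
      s * d <= 2 * (d + 1) * n).
    { intros s u' v' n d k1 k2 k3 k4 k5; apply Rle_trans with (2 * n * d); [|lra].
      apply Rmult_le_compat_r; lra. }
    exact (aux _ _ _ _ _ (qnorm_ge0 D) (Rabs_pos u) hs h1 h2).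
- intros p hp eps.
  assert (hpe : p = (x, y)).
  { symmetry; apply is_filter_lim_locally_unique; exact hp. }
  subst p; destruct (h (eps / 2)) as [d [hd hd']]; [pose proof (cond_pos eps); lra|].
  exists (mkposreal d hd); intros [x' y'] [hx hy].
  specialize (hd' x' y' hx hy).
  change (minus (x', y') (x, y)) with (x' - x, y' - y); cbn [fst snd].
  rewrite norm_qnorm; apply Rle_trans with (1 := hd').
  destruct (norm_pair_bounds (x' - x) (y' - y)) as [h1 [h2 _]].
  assert (aux : forall e u v n, 0 < e -> u <= n -> v <= n -> e / 2 * (u + v) <= e * n)
    by (intros; nra).
  exact (aux _ _ _ _ (cond_pos eps) h1 h2).
Qed.

(** The Cauchy-Riemann equation [A + I * B = 0] gives [B = I * A], so the differential [u A + v B]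
    is left multiplication of [A] by [u + I v]. *)
Lemma slice_regular_slice_diff Omega f : slice_regular Omega f ->
  forall I x y, imag_unit I -> Omega (slice I x y) ->
  slice_diff I f x y (slice_dx I f x y).
Proof.
intros h I x y hI hO; destruct (h I hI x y hO) as [[l hl] hcr].
pose proof (filterdiff_partial _ _ _ _ hl) as hp; cbn [fst snd] in hp.
destruct (partial_derivatives I f x y _ _ hp) as [ex ey].
rewrite ex, ey in hcr; rewrite ex.
set (A := l (1, 0)) in *; set (B := l (0, 1)) in *.
assert (eB : B = (I * A)%quat).
{ assert (e : (A + I * B)%quat = RtoQ 0).
  { transitivity (qscal 2 (qscal (1 / 2) (A + I * B)))%quat; [qring; field|].
    rewrite hcr; qring. }
  (* Substituting [A + I * B = 0] and [I * I = -1] turns this expression into [B], while expanding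
     it gives [I * A]. *)
  transitivity (I * (A + I * B) - (I * I) * B - I * (RtoQ 0) + (RtoQ 0) * B)%quat.
  - rewrite e, hI; qring.
  - replace (I * (A + I * B) - I * I * B - I * RtoQ 0 + RtoQ 0 * B)%quat
      with (I * A)%quat; [easy|qring]. }
intros eps he; destruct (hp eps he) as [d [hd hd']]; exists d; split; [easy|].
intros x' y' hx hy; rewrite slice_scal_decomp, <- eB; auto.
Qed.

Lemma slice_diff_slice_regular Omega f :
  (forall I x y, imag_unit I -> Omega (slice I x y) -> exists D, slice_diff I f x y D) ->
  slice_regular Omega f.
Proof.
intros h I hI x y hO; destruct (h I x y hI hO) as [D hD]; split.
- now apply slice_diff_ex_filterdiff with D.
- destruct (slice_diff_partial _ _ _ _ _ hD) as [-> ->].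
  replace (D + I * (I * D))%quat with (D + (I * I) * D)%quat by qring.
  rewrite hI; qring.
Qed.

Lemma slice_decomposition (q : quat) : q = slice (slice_unit q) (qre q) (qnorm (qim q)).
Proof.
unfold slice_unit; destruct Req_EM_T as [e|e].
- pose proof (qnorm_eq0 _ e) as e0; rewrite e; unfold slice.
  pose proof (f_equal qi e0) as e1; pose proof (f_equal qj e0) as e2.
  pose proof (f_equal qk e0) as e3; autorewrite with qcoord in e1, e2, e3.
  qring; cbn [qre qi qj qk fst snd]; lra.
- unfold slice; qring; field; easy.
Qed.

Lemma slice_unit_imag q : imag_unit (slice_unit q).
Proof.
unfold slice_unit; destruct Req_EM_T as [e|e]; [apply imag_unit_i|].
apply imag_unit_intro; autorewrite with qcoord; [ring|].
pose proof (qnorm_sqr (qim q)) as h; unfold qdot in h; autorewrite with qcoord in h.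
replace (_ + _) with ((/ qnorm (qim q)) ^ 2 * (0 * 0 + qi q * qi q + qj q * qj q + qk q * qk q))
  by ring.
rewrite <- h; field; easy.
Qed.

Lemma RtoQ_slice I x : RtoQ x = slice I x 0.
Proof. unfold slice; qring. Qed.

(** Cauchy's formula yields one expansion for each slice and radius. All of them represent [f] on a
    common real segment, so their coefficients agree with those of one reference slice and
    radius. *)
Lemma slice_regular_has_coefs f : slice_regular unit_ball f -> exists a, has_coefs f a.
Proof.
intro h.
assert (hf : forall I, imag_unit I -> forall x y, x ^ 2 + y ^ 2 < 1 ->
  exists D, slice_diff I f x y D).
{ intros I hI x y hxy; exists (slice_dx I f x y).
  apply (slice_regular_slice_diff unit_ball); auto; now apply unit_ball_slice. }
set (a := cauchy_coef (0, 1, 0, 0) f (1 / 2)).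
exists a; intros q hq; apply is_series_qlim.
set (I := slice_unit q); set (x := qre q); set (y := qnorm (qim q)).
pose proof (slice_unit_imag q) as hI; fold I in hI.
assert (eq : q = slice I x y) by apply slice_decomposition.
unfold unit_ball in hq; pose proof (qnorm_ge0 q) as hq0.
(* This radius exceeds [qnorm q] and is at least [1 / 2], so real points with [Rabs t < 1 / 2] lie
   in the discs of both expansions. *)
set (r := (1 + qnorm q) / 2).
assert (hr : 0 < r < 1) by (unfold r; lra).
assert (hxy : x ^ 2 + y ^ 2 < r ^ 2).
{ rewrite eq, qnorm_slice in hq0 by easy; rewrite eq in hq; unfold r in *; rewrite eq.
  rewrite qnorm_slice in * by easy.
  pose proof (sqrt_sqrt (x ^ 2 + y ^ 2) ltac:(nra)); nra. }
assert (e : forall n, cauchy_coef I f r n = a n).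
{ apply (coefs_unique _ _ (1 / 2)); [lra|]; intros t ht; exists (f (RtoQ t)).
  assert (t ^ 2 < 1 / 4) by (apply Rabs_def2 in ht; nra).
  assert (1 / 4 < r ^ 2 \/ r ^ 2 <= 1 / 4) by lra.
  split.
  - rewrite (RtoQ_slice I); apply cauchy_series; auto; unfold r; nra.
  - rewrite (RtoQ_slice (0, 1, 0, 0)); apply cauchy_series; auto using imag_unit_i; [lra|].
    nra. }
apply (qlim_ext (qsum (fun n => q ^ n * cauchy_coef I f r n)%quat)).
- intro n; apply qsum_ext; intros; now rewrite e.
- rewrite eq; apply cauchy_series; auto.
Qed.

Lemma slice_comm I x y x' y' : imag_unit I ->
  (slice I x y * slice I x' y')%quat = (slice I x' y' * slice I x y)%quat.
Proof. intro hI; rewrite !slice_mult by easy; f_equal; ring. Qed.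

Lemma unit_ball_conj q : unit_ball q -> unit_ball (qconj q).
Proof. unfold unit_ball; now rewrite qnorm_conj. Qed.

(** Dividing twice by [q - z] gives, on the slice of [z], [f z' - f z = (z' - z) k z'] and
    [k z' - k z = (z' - z) k2 z']. As [k2] is bounded near [z], the error is quadratic and the
    derivative is [k z]. *)
Lemma power_series_slice_diff a I x y : subexponential a -> imag_unit I ->
  unit_ball (slice I x y) ->
  slice_diff I (power_series a) x y (power_series (tail_coef (slice I x y) a) (slice I x y)).
Proof.
intros ha hI hz; set (z := slice I x y) in *; unfold unit_ball in hz.
set (k := tail_coef z a); set (k2 := tail_coef z k).
assert (hk : subexponential k) by now apply tail_coef_subexponential.
assert (hk2 : subexponential k2) by now apply tail_coef_subexponential.
pose proof (qnorm_ge0 z) as hz0.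
set (r := (1 + qnorm z) / 2).
destruct (power_series_bounded k2 r hk2) as [M [hM hM']]; [unfold r; lra|].
(* The first bound keeps [z'] in the ball of radius [r], the second gives [2 * d * M <= eps]. *)
intros eps he; set (d := Rmin ((1 - qnorm z) / 4) (eps / (2 * (M + 1)))).
assert (hd : 0 < d).
{ apply Rmin_glb_lt; [lra|apply Rdiv_lt_0_compat; lra]. }
exists d; split; [easy|]; intros x' y' hx hy.
pose proof (Rmin_l ((1 - qnorm z) / 4) (eps / (2 * (M + 1)))) as hd1; fold d in hd1.
pose proof (Rmin_r ((1 - qnorm z) / 4) (eps / (2 * (M + 1)))) as hd2; fold d in hd2.
set (z' := slice I x' y'); fold z.
assert (ew : (z' - z)%quat = slice I (x' - x) (y' - y)) by apply slice_minus.
rewrite <- ew; set (w := (z' - z)%quat) in *.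
assert (hw : qnorm w <= Rabs (x' - x) + Rabs (y' - y))
  by (rewrite ew; now apply qnorm_slice_le).
assert (hz' : qnorm z' <= r).
{ replace z' with (z + w)%quat by (unfold w; qring).
  apply Rle_trans with (1 := qnorm_triang _ _); unfold r; lra. }
assert (hz1 : qnorm z' < 1) by (unfold r in hz'; lra).
assert (hc : (z' * z)%quat = (z * z')%quat) by now apply slice_comm.
rewrite (quotient_coefs_eval z _ a k z' (tail_coef_quotient z a ha hz) ha hk hz1 hc).
fold w.
replace (w * power_series k z' - w * power_series k z)%quat
  with (w * (power_series k z' - power_series k z))%quat by qring.
rewrite (quotient_coefs_eval z _ k k2 z' (tail_coef_quotient z k hk hz) hk hk2 hz1 hc).
fold w; rewrite !qnorm_mult.
specialize (hM' z' hz'); pose proof (qnorm_ge0 (power_series k2 z')).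
pose proof (qnorm_ge0 w) as hw0.
assert (hwd : qnorm w <= 2 * d) by lra.
assert (hdm : 2 * d * M <= eps).
{ assert (2 * (eps / (2 * (M + 1))) * (M + 1) = eps) by (field; lra); nra. }
rewrite (Rmult_comm eps); apply Rmult_le_compat; [easy| |easy|].
- now apply Rmult_le_pos.
- apply Rle_trans with (2 := hdm); apply Rmult_le_compat; easy.
Qed.

Lemma power_series_slice_regular a : subexponential a ->
  slice_regular unit_ball (power_series a).
Proof.
intro ha; apply slice_diff_slice_regular; intros I x y hI hxy.
exists (power_series (tail_coef (slice I x y) a) (slice I x y)).
now apply power_series_slice_diff.
Qed.

(** * The differential quotient *)

(** Coefficients of a constant function; [shift1] is multiplication by the variable. *)
Definition delta0 (c : quat) (n : nat) : quat := match n with O => c | S _ => RtoQ 0 end.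
Definition shift1 (a : nat -> quat) (n : nat) : quat :=
  match n with O => RtoQ 0 | S m => a m end.

Lemma qconv_delta0 c a n : qconv (delta0 c) a n = (c * a n)%quat.
Proof.
unfold qconv; rewrite qsum_S_l, qsum_0; cbn [delta0]; [|intros; apply qmult_0_l].
rewrite Nat.sub_0_r; qring.
Qed.

Lemma qconv_shift1 u v n : qconv (shift1 u) v n = shift1 (qconv u v) n.
Proof.
destruct n as [|n]; unfold qconv; [cbn [qsum shift1]; qring|].
rewrite qsum_S_l; cbn [shift1]; rewrite qmult_0_l, qplus_0_l; reflexivity.
Qed.

Definition psum (q : quat) (a : nat -> quat) (l : quat) : Prop :=
  qlim (qsum (fun n => q ^ n * a n)%quat) l.

Lemma psum_ext q a b l : (forall n, a n = b n) -> psum q a l -> psum q b l.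
Proof.
intro e; apply qlim_ext; intro n; apply qsum_ext; intros; now rewrite e.
Qed.

Lemma psum_minus q a b l m : psum q a l -> psum q b m ->
  psum q (fun n => a n - b n)%quat (l - m)%quat.
Proof.
intros ha hb; apply qlim_ext with (2 := qlim_minus _ _ _ _ ha hb); intro n.
rewrite <- qsum_minus; apply qsum_ext; intros; qring.
Qed.

Lemma psum_plus q a b l m : psum q a l -> psum q b m ->
  psum q (fun n => a n + b n)%quat (l + m)%quat.
Proof.
intros ha hb; apply qlim_ext with (2 := qlim_plus _ _ _ _ ha hb); intro n.
rewrite <- qsum_plus; apply qsum_ext; intros; qring.
Qed.

Lemma psum_scal q a r l : psum q a l -> psum q (fun n => qscal r (a n)) (qscal r l).
Proof.
intros ha; replace (qscal r l) with (RtoQ r * l)%quat by qring.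
apply qlim_ext with (2 := qlim_mult_l (RtoQ r) _ _ ha); intro n.
rewrite <- qsum_mult_l; apply qsum_ext; intros; qring.
Qed.

Lemma psum_shift1 q a l : psum q a l -> psum q (shift1 a) (q * l)%quat.
Proof.
intro h; unfold psum.
replace (q * l)%quat with (q ^ 0 * shift1 a O + q * l)%quat by (cbn [qpow shift1]; qring).
apply (qlim_qsum_S_l (fun n => q ^ n * shift1 a n)%quat).
apply qlim_ext with (2 := qlim_mult_l q _ _ h); intro n.
rewrite <- qsum_mult_l; apply qsum_ext; intros; cbn [qpow shift1]; qring.
Qed.

Lemma psum_0 q : psum q (fun _ => RtoQ 0) (RtoQ 0).
Proof.
apply qlim_ext with (2 := qlim_const (RtoQ 0)); intro n.
symmetry; apply qsum_0; intros; apply qmult_0_r.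
Qed.

Lemma psum_delta0 q c : psum q (delta0 c) c.
Proof.
assert (e : (q ^ 0 * delta0 c O + RtoQ 0)%quat = c) by (cbn [qpow delta0]; qring).
assert (h : qlim (qsum (fun n => q ^ S n * delta0 c (S n))%quat) (RtoQ 0)).
{ apply (qlim_ext (fun _ => RtoQ 0)); [|apply qlim_const]; intro n.
  symmetry; apply qsum_0; intros; apply qmult_0_r. }
pose proof (qlim_qsum_S_l (fun n => q ^ n * delta0 c n)%quat (RtoQ 0) h) as h'.
cbv beta in h'; rewrite e in h'; exact h'.
Qed.

Lemma psum_power_series q a : subexponential a -> qnorm q < 1 -> psum q a (power_series a q).
Proof. apply power_series_lim. Qed.

Lemma has_coefs_psum f a : has_coefs f a <-> forall q, unit_ball q -> psum q a (f q).
Proof. unfold has_coefs, psum; split; intros h q hq; apply is_series_qlim; auto. Qed.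

Lemma subexponential_mult_l c a : subexponential a -> subexponential (fun n => c * a n)%quat.
Proof.
intros h s hs; destruct (h s hs) as [C hC]; exists (qnorm c * C); intro n.
rewrite qnorm_mult, Rmult_assoc; apply Rmult_le_compat_l; [apply qnorm_ge0|apply hC].
Qed.

Lemma subexponential_delta0 c : subexponential (delta0 c).
Proof.
intros s hs; exists (qnorm c); intros [|n]; cbn [delta0 pow]; [lra|].
rewrite qnorm_0, Rmult_0_l; apply qnorm_ge0.
Qed.

Lemma subexponential_minus a b : subexponential a -> subexponential b ->
  subexponential (fun n => a n - b n)%quat.
Proof.
intros ha hb s hs; destruct (ha s hs) as [A hA]; destruct (hb s hs) as [B hB].
exists (A + B); intro n; apply Rle_trans with ((qnorm (a n) + qnorm (b n)) * s ^ n).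
- apply Rmult_le_compat_r; [apply pow_le; lra|apply qnorm_minus_triang].
- rewrite Rmult_plus_distr_r; apply Rplus_le_compat; auto.
Qed.

Lemma star_psum f g u v q l : has_coefs f u -> has_coefs g v -> psum q (qconv u v) l ->
  star f g q = l.
Proof.
intros hf hg h; apply qSeries_of_qlim.
apply qlim_ext with (2 := h); intro n; apply qsum_ext; intros k _.
rewrite sum_n_qsum; f_equal; apply qsum_ext; intros.
now rewrite (coef_eq f u hf), (coef_eq g v hg).
Qed.

Lemma reg_conj_psum f u q l : has_coefs f u -> psum q (fun n => qconj (u n)) l ->
  reg_conj f q = l.
Proof.
intros hf h; apply qSeries_of_qlim.
apply qlim_ext with (2 := h); intro n; apply qsum_ext; intros k _.
now rewrite (coef_eq f u hf).
Qed.

Definition linear_coef (q0 : quat) (n : nat) : quat :=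
  (shift1 (delta0 (RtoQ 1)) n - delta0 q0 n)%quat.

Lemma linear_has_coefs q0 : has_coefs (fun p => p - q0)%quat (linear_coef q0).
Proof.
apply has_coefs_psum; intros q hq; apply psum_minus; [|apply psum_delta0].
rewrite <- (qmult_1_r q) at 2; apply psum_shift1, psum_delta0.
Qed.

Lemma qconv_linear_coef q0 b n :
  qconv (linear_coef q0) b n = (shift1 b n - q0 * b n)%quat.
Proof.
unfold linear_coef; rewrite qconv_minus_l, qconv_delta0, qconv_shift1; f_equal.
destruct n as [|n]; [easy|]; cbn [shift1]; rewrite qconv_delta0; apply qmult_1_l.
Qed.

Lemma quotient_coefs_shift1 q0 c a k : quotient_coefs q0 c a k <->
  forall n, (a n - delta0 c n)%quat = (shift1 k n - q0 * k n)%quat.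
Proof.
split.
- intros [h0 hS] [|n]; cbn [delta0 shift1]; [rewrite h0|rewrite hS]; qring.
- intro h; split; [|intro n].
  + pose proof (h O) as e; cbn [delta0 shift1] in e.
    replace (a O) with ((a O - c) + c)%quat by qring; rewrite e; qring.
  + pose proof (h (S n)) as e; cbn [delta0 shift1] in e.
    rewrite <- e; qring.
Qed.

(** The existence that gives meaning to the choice in [diff_quotient]. *)
Lemma quotient_is_diff_quotient f a q0 : has_coefs f a -> unit_ball q0 ->
  is_diff_quotient q0 f (power_series (tail_coef q0 a)).
Proof.
intros ha hq0; pose proof (has_coefs_subexponential f a ha) as hsa.
assert (hk : subexponential (tail_coef q0 a)) by now apply tail_coef_subexponential.
split; [now apply power_series_slice_regular|]; intros q hq; symmetry.
apply (star_psum _ _ (linear_coef q0) (tail_coef q0 a)).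
- apply linear_has_coefs.
- now apply power_series_has_coefs.
- apply psum_ext with (fun n => a n - delta0 (f q0) n)%quat.
  + intro n; rewrite qconv_linear_coef; revert n; apply quotient_coefs_shift1.
    rewrite (has_coefs_power_series f a q0 ha hq0); now apply tail_coef_quotient.
  + apply psum_minus; [now apply has_coefs_psum|apply psum_delta0].
Qed.

Lemma is_diff_quotient_coefs f a q0 g : has_coefs f a -> is_diff_quotient q0 f g ->
  exists b, has_coefs g b /\ quotient_coefs q0 (f q0) a b.
Proof.
intros ha [hg hs]; destruct (slice_regular_has_coefs g hg) as [b hb].
exists b; split; [easy|].
pose proof (has_coefs_subexponential g b hb) as hsb.
assert (hl : forall q, unit_ball q -> psum q (fun n => shift1 b n - q0 * b n)%quat
   (q * g q - power_series (fun n => q0 * b n) q)%quat).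
{ intros q hq; apply psum_minus.
  - now apply psum_shift1, has_coefs_psum.
  - now apply psum_power_series; [apply subexponential_mult_l|]. }
apply quotient_coefs_shift1.
apply (has_coefs_unique (fun q => f q - f q0)%quat
  (fun q => q * g q - power_series (fun n => q0 * b n) q)%quat).
- apply has_coefs_psum; intros q hq; apply psum_minus; [now apply has_coefs_psum|].
  apply psum_delta0.
- now apply has_coefs_psum.
- intros q hq; rewrite hs by easy.
  apply (star_psum _ _ (linear_coef q0) b); [apply linear_has_coefs|easy|].
  apply psum_ext with (2 := hl q hq); intro n; now rewrite qconv_linear_coef.
Qed.

Lemma diff_quotient_coefs f a q0 : has_coefs f a -> unit_ball q0 ->
  exists b, has_coefs (diff_quotient q0 f) b /\ quotient_coefs q0 (f q0) a b.
Proof.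
intros ha hq0; apply (is_diff_quotient_coefs f a); [easy|].
unfold diff_quotient; apply epsilon_spec.
exists (power_series (tail_coef q0 a)); now apply quotient_is_diff_quotient.
Qed.

Lemma power_series_ext q a b : (forall n, a n = b n) -> power_series a q = power_series b q.
Proof. intro h; apply quat_ext; apply Series_ext; intro n; now rewrite h. Qed.

(** The difference satisfies [d n = q0 * d (S n)], hence [qnorm (d n) = qnorm q0 ^ m * qnorm (d (n +
    m))] for every [m], which tends to 0 because [d] grows subexponentially. *)
Lemma quotient_coefs_unique q0 c a k k' : unit_ball q0 ->
  subexponential k -> subexponential k' ->
  quotient_coefs q0 c a k -> quotient_coefs q0 c a k' -> forall n, k n = k' n.
Proof.
intros hq0 hk hk' [_ h] [_ h'] n; unfold unit_ball in hq0; pose proof (qnorm_ge0 q0) as hq.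
set (d := fun n => (k n - k' n)%quat).
assert (hd : forall n, d n = (q0 * d (S n))%quat).
{ intro m; pose proof (h m) as e; pose proof (h' m) as e'; unfold d.
  replace (k m) with ((k m - q0 * k (S m)) + q0 * k (S m))%quat by qring.
  replace (k' m) with ((k' m - q0 * k' (S m)) + q0 * k' (S m))%quat by qring.
  rewrite <- e, <- e'; qring. }
assert (e0 : d n = RtoQ 0).
{ destruct (Req_dec (qnorm q0) 0) as [e|e].
  { rewrite hd, (qnorm_eq0 _ e); apply qmult_0_l. }
  destruct (subexponential_geom d (qnorm q0) (subexponential_minus _ _ hk hk'))
    as [C [t [ht [hC hb]]]]; [lra|].
  assert (hm : forall m, qnorm (d n) = qnorm q0 ^ m * qnorm (d (n + m)%nat)).
  { intro m; induction m as [|m IH]; [rewrite Nat.add_0_r; cbn [pow]; ring|].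
    rewrite IH, (hd (n + m)%nat), qnorm_mult, Nat.add_succ_r; cbn [pow]; ring. }
  assert (hle : forall m, qnorm (d n) * qnorm q0 ^ n <= C * t ^ n * t ^ m).
  { intro m; rewrite Rmult_assoc, <- pow_add; apply Rle_trans with (2 := hb (n + m)%nat).
    rewrite (hm m), pow_add; right; ring. }
  assert (hz : qnorm (d n) * qnorm q0 ^ n <= 0).
  { apply (is_lim_seq_le (fun _ => qnorm (d n) * qnorm q0 ^ n) (fun m => C * t ^ n * t ^ m)
      (qnorm (d n) * qnorm q0 ^ n) 0 hle); [apply is_lim_seq_const|].
    replace (Finite 0) with (Finite (C * t ^ n * 0)) by (f_equal; ring).
    apply (is_lim_seq_scal_l _ (C * t ^ n) 0), is_lim_seq_geom; rewrite Rabs_right; lra. }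
  apply qnorm_eq0; pose proof (qnorm_ge0 (d n)).
  assert (0 < qnorm q0 ^ n) by (apply pow_lt; lra); nra. }
replace (k n) with (d n + k' n)%quat by (unfold d; qring); rewrite e0; qring.
Qed.

Lemma slice_diff_ext_ball f g I x y D : imag_unit I -> unit_ball (slice I x y) ->
  (forall q, unit_ball q -> f q = g q) -> slice_diff I g x y D -> slice_diff I f x y D.
Proof.
intros hI hz e h eps he; destruct (h eps he) as [d [hd hd']].
pose proof hz as hz1; unfold unit_ball in hz1.
exists (Rmin d ((1 - qnorm (slice I x y)) / 2)); split; [apply Rmin_glb_lt; lra|].
intros x' y' hx hy.
pose proof (Rmin_l d ((1 - qnorm (slice I x y)) / 2)).
pose proof (Rmin_r d ((1 - qnorm (slice I x y)) / 2)).
rewrite !e; [apply hd'; lra|easy|].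
replace (slice I x' y') with (slice I x y + slice I (x' - x) (y' - y))%quat
  by (rewrite slice_plus; f_equal; ring).
unfold unit_ball; apply Rle_lt_trans with (1 := qnorm_triang _ _).
pose proof (qnorm_slice_le I (x' - x) (y' - y) hI); lra.
Qed.

Lemma cullen_derivative_slice_diff f q D :
  slice_diff (slice_unit q) f (qre q) (qnorm (qim q)) D -> cullen_derivative f q = D.
Proof.
intro h; destruct (slice_diff_partial _ _ _ _ _ h) as [h1 h2].
unfold cullen_derivative; rewrite h1, h2; set (I := slice_unit q).
replace (D - I * (I * D))%quat with (D - (I * I) * D)%quat by qring.
rewrite (slice_unit_imag q : (I * I)%quat = _); qring; field.
Qed.

(** The derivative along the slice of [q0] is the quotient built from tails, evaluated at [q0];
    uniqueness of the quotient identifies it with [b]. *)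
Lemma cullen_derivative_quotient f a b q0 : has_coefs f a -> subexponential b ->
  unit_ball q0 -> quotient_coefs q0 (f q0) a b -> cullen_derivative f q0 = power_series b q0.
Proof.
intros ha hb hq0 hq; pose proof (has_coefs_subexponential f a ha) as hsa.
pose proof (slice_unit_imag q0) as hI.
apply cullen_derivative_slice_diff.
pose proof (slice_decomposition q0) as e.
set (I := slice_unit q0) in *; set (x := qre q0) in *; set (y := qnorm (qim q0)) in *.
replace (power_series b q0) with (power_series (tail_coef q0 a) q0).
- rewrite e in hq0 |- *.
  apply (slice_diff_ext_ball f (power_series a)); auto.
  + intros q h; now apply has_coefs_power_series.
  + now apply power_series_slice_diff.
- apply power_series_ext, (quotient_coefs_unique q0 (f q0) a); auto;
  try (apply tail_coef_subexponential; easy);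
  rewrite (has_coefs_power_series f a q0 ha hq0); now apply tail_coef_quotient.
Qed.

(** * The real differential, and the identity function *)

Definition quat_module : NormedModule R_AbsRing :=
  prod_NormedModule R_AbsRing (prod_NormedModule R_AbsRing
    (prod_NormedModule R_AbsRing R_NormedModule R_NormedModule) R_NormedModule) R_NormedModule.

Lemma locally_quat (q : quat) (P : quat -> Prop) : locally q P <->
  exists d, 0 < d /\ forall p, qnorm (p - q)%quat < d -> P p.
Proof.
split.
- intro h; destruct (@locally_norm_le_locally R_AbsRing quat_module q P h) as [d hd].
  exists d; split; [apply cond_pos|]; intros p hp; apply hd.
  rewrite <- norm_qnorm in hp; exact hp.
- intros [d [hd h]]; apply (@locally_le_locally_norm R_AbsRing quat_module q P).
  exists (mkposreal d hd); intros p hp; apply h.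
  rewrite <- norm_qnorm; exact hp.
Qed.

Lemma filterdiff_id_slice_diff f q0 I x y : imag_unit I -> q0 = slice I x y ->
  filterdiff f (locally q0) (fun h : quat => h) -> slice_diff I f x y (RtoQ 1).
Proof.
intros hI e [_ h] eps he.
specialize (h q0 ltac:(intros P hP; exact hP) (mkposreal eps he)).
apply locally_quat in h as [d [hd hd']]; exists (d / 2); split; [lra|].
intros x' y' hx hy; rewrite qmult_1_r.
pose proof (qnorm_slice_le I (x' - x) (y' - y) hI) as hs.
rewrite <- slice_minus, <- e in hs |- *.
specialize (hd' (slice I x' y') ltac:(lra)); cbn [pos] in hd'.
apply Rle_trans with (eps * qnorm (slice I x' y' - q0)%quat).
- rewrite <- !norm_qnorm; exact hd'.
- apply Rmult_le_compat_l; lra.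
Qed.

Lemma locally_unit_ball q0 (P : quat -> Prop) : unit_ball q0 ->
  (forall q, unit_ball q -> P q) -> locally q0 P.
Proof.
unfold unit_ball; intros hq0 h; apply locally_quat.
exists (1 - qnorm q0); split; [lra|]; intros q hq; apply h.
replace q with ((q - q0) + q0)%quat by qring.
apply Rle_lt_trans with (1 := qnorm_triang _ _); lra.
Qed.

Lemma filterdiff_id_of_eq f q0 : unit_ball q0 -> (forall q, unit_ball q -> f q = q) ->
  filterdiff f (locally q0) (fun h : quat => h).
Proof.
intros hq0 h.
apply (filterdiff_ext_locally (U := quat_module) (V := quat_module) (fun q => q) f).
- apply locally_unit_ball; [easy|]; intros q hq; symmetry; auto.
- apply filterdiff_id.
Qed.

Lemma id_coef_shift1 n : id_coef n = shift1 (delta0 (RtoQ 1)) n.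
Proof. now destruct n as [|[|n]]. Qed.

Lemma psum_id q : psum q id_coef q.
Proof.
apply (psum_ext q (shift1 (delta0 (RtoQ 1)))); [intro; symmetry; apply id_coef_shift1|].
rewrite <- (qmult_1_r q) at 2; apply psum_shift1, psum_delta0.
Qed.

(** At a fixed point, [f - q0 = (q - q0) * b]; subtracting [q - q0 = (q - q0) * 1] leaves
    [f - q = (q - q0) * (b - 1)]. *)
Lemma quotient_coefs_sub_id q0 a b : quotient_coefs q0 q0 a b ->
  quotient_coefs q0 (RtoQ 0) (fun n => a n - id_coef n)%quat
    (fun n => b n - delta0 (RtoQ 1) n)%quat.
Proof.
intros [h0 hS]; split; [|intros [|n]]; cbn [id_coef delta0]; rewrite ?h0, ?hS; qring.
Qed.

Lemma eq_id_of_quotient_zero f a q0 q1 k : has_coefs f a ->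
  (forall q, unit_ball q -> unit_ball (f q)) ->
  quotient_coefs q0 (RtoQ 0) (fun n => a n - id_coef n)%quat k -> subexponential k ->
  unit_ball q0 -> unit_ball q1 -> power_series k q1 = RtoQ 0 ->
  forall q, unit_ball q -> f q = q.
Proof.
intros ha hf hk hsk hq0 hq1 h1 q hq.
assert (e : forall n, a n = id_coef n).
{ apply (rigidity a q0 q1 k); auto; apply (toeplitz_contraction f a ha).
  intros p hp; left; now apply hf. }
apply (qlim_unique (qsum (fun n => q ^ n * a n)%quat)); [now apply has_coefs_lim|].
apply (psum_ext q id_coef); [intro; now rewrite e|apply psum_id].
Qed.

(** * The left quotient *)

Definition one_minus_coef (c : quat) (a : nat -> quat) (n : nat) : quat :=
  (delta0 (RtoQ 1) n - c * a n)%quat.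

Lemma one_minus_conj_star_has_coefs q0 f a : has_coefs f a ->
  has_coefs (one_minus_conj_star q0 f) (one_minus_coef (qconj q0) a).
Proof.
intro ha; apply has_coefs_psum; intros q hq; apply psum_minus; [apply psum_delta0|].
pose proof (subexponential_mult_l (qconj q0) a (has_coefs_subexponential f a ha)) as hs.
rewrite (star_psum (fun _ => qconj q0) f (delta0 (qconj q0)) a q
  (power_series (fun n => qconj q0 * a n)%quat q)).
- now apply psum_power_series.
- apply has_coefs_psum; intros; apply psum_delta0.
- easy.
- apply (psum_ext q (fun n => qconj q0 * a n)%quat);
   [intro; now rewrite qconv_delta0|now apply psum_power_series].
Qed.

Lemma id_has_coefs : has_coefs (fun p => p) id_coef.
Proof. apply has_coefs_psum; intros; apply psum_id. Qed.

Lemma one_minus_coef_id c n :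
  one_minus_coef c id_coef n = (delta0 (RtoQ 1) n - shift1 (delta0 c) n)%quat.
Proof.
unfold one_minus_coef; f_equal; destruct n as [|[|n]]; cbn; qring.
Qed.

(** The regular product [c * q] takes the value [q * c], since coefficients stand to the right of
    the powers. *)
Lemma psum_one_minus_id q c : psum q (one_minus_coef c id_coef) (RtoQ 1 - q * c)%quat.
Proof.
apply (psum_ext q _ _ _ (fun n => eq_sym (one_minus_coef_id c n))).
apply psum_minus; [apply psum_delta0|apply psum_shift1, psum_delta0].
Qed.

Lemma reg_conj_one_minus_has_coefs q0 :
  has_coefs (reg_conj (one_minus_conj_star q0 (fun p => p))) (one_minus_coef q0 id_coef).
Proof.
apply has_coefs_psum; intros q hq.
rewrite (reg_conj_psum _ _ q (RtoQ 1 - q * q0)%quat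
  (one_minus_conj_star_has_coefs q0 _ _ id_has_coefs)).
- apply psum_one_minus_id.
- apply (psum_ext q (one_minus_coef q0 id_coef)); [|apply psum_one_minus_id].
  intro n; rewrite !one_minus_coef_id; destruct n as [|[|n]]; cbn [delta0 shift1]; qring.
Qed.

Lemma qconv_one_minus c v n :
  qconv (one_minus_coef c id_coef) v n = (v n - shift1 (fun n => c * v n)%quat n)%quat.
Proof.
transitivity (qconv (fun n => delta0 (RtoQ 1) n - shift1 (delta0 c) n)%quat v n).
- apply qsum_ext; intros; now rewrite one_minus_coef_id.
- rewrite qconv_minus_l, qconv_delta0, qconv_shift1; f_equal; [apply qmult_1_l|].
  destruct n as [|n]; [easy|apply qconv_delta0].
Qed.

(** The product of [1 - conj q0 * q] and [1 - q0 * q] has real coefficients, the trace and squared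
    norm of [q0]. *)
Lemma symmetrization_one_minus q0 q : unit_ball q ->
  symmetrization (one_minus_conj_star q0 (fun p => p)) q =
  (RtoQ 1 - qscal (2 * qre q0) q + qscal (qnorm q0 ^ 2) (q * q))%quat.
Proof.
intro hq; unfold symmetrization.
apply (star_psum _ _ (one_minus_coef (qconj q0) id_coef) (one_minus_coef q0 id_coef)).
- apply one_minus_conj_star_has_coefs, id_has_coefs.
- apply reg_conj_one_minus_has_coefs.
- apply (psum_ext q _ _ _ (fun n => eq_sym (qconv_one_minus _ _ n))).
  replace (_ + _)%quat with ((RtoQ 1 - q * q0) -
     q * (qconj q0 - q * RtoQ (qnorm q0 ^ 2)))%quat.
  + apply psum_minus; [apply psum_one_minus_id|apply psum_shift1].
    apply (psum_ext q (fun n => delta0 (qconj q0) n -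
      shift1 (delta0 (RtoQ (qnorm q0 ^ 2))) n)%quat).
    * intro n; rewrite one_minus_coef_id, qnorm_sqr; unfold qdot.
      destruct n as [|[|n]]; cbn [delta0 shift1]; qring.
    * apply psum_minus; [apply psum_delta0|apply psum_shift1, psum_delta0].
  + generalize (qnorm q0 ^ 2); intro; qring.
Qed.

(** Only the trace and norm of [q0] matter, so [q0] may be replaced by the points [w] and [w'] of
    its sphere lying in the slice of [q]. There the polynomial factors as [(1 - q w)(1 - q w')], and
    both factors are nonzero by the norms. *)
Lemma symmetrization_one_minus_neq0 q0 q : unit_ball q0 -> unit_ball q ->
  (RtoQ 1 - qscal (2 * qre q0) q + qscal (qnorm q0 ^ 2) (q * q))%quat <> RtoQ 0.
Proof.
intros hq0 hq.
set (I := slice_unit q); pose proof (slice_unit_imag q : imag_unit I) as hI.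
set (w := slice I (qre q0) (qnorm (qim q0))).
set (w' := slice I (qre q0) (- qnorm (qim q0))).
assert (en : qnorm q0 ^ 2 = qre q0 ^ 2 + qnorm (qim q0) ^ 2)
  by (rewrite !qnorm_sqr; unfold qdot; autorewrite with qcoord; ring).
assert (hw : qnorm w < 1 /\ qnorm w' < 1).
{ unfold w, w'; rewrite !qnorm_slice by easy.
  replace ((- qnorm (qim q0)) ^ 2) with (qnorm (qim q0) ^ 2) by ring.
  rewrite <- en, <- Rsqr_pow2, sqrt_Rsqr by apply qnorm_ge0; split; exact hq0. }
assert (hne : forall p, qnorm p < 1 -> (RtoQ 1 - q * p)%quat <> RtoQ 0).
{ intros p hp e; unfold unit_ball in hq.
  assert (e1 : (q * p)%quat = RtoQ 1).
  { replace (q * p)%quat with (RtoQ 1 - (RtoQ 1 - q * p))%quat by qring.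
    rewrite e; qring. }
  apply (f_equal qnorm) in e1; rewrite qnorm_mult, qnorm_1 in e1.
  pose proof (qnorm_ge0 q); pose proof (qnorm_ge0 p); nra. }
replace (_ + _)%quat with ((RtoQ 1 - q * w) * (RtoQ 1 - q * w'))%quat.
- intro e; apply qmult_eq0 in e; [|now apply hne]; revert e; now apply hne.
- assert (c : (w * q)%quat = (q * w)%quat).
  { rewrite (slice_decomposition q); fold I; now apply slice_comm. }
  replace ((RtoQ 1 - q * w) * (RtoQ 1 - q * w'))%quat
    with (RtoQ 1 - q * (w + w') + q * (w * q) * w')%quat by qring.
  rewrite c; replace (q * (q * w) * w')%quat with (q * q * (w * w'))%quat by qring.
  unfold w, w'; rewrite slice_mult, slice_plus, en by easy.
  generalize (qnorm (qim q0)); intro y.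
  replace (qre q0 * - y + y * qre q0) with 0 by ring.
  replace (y + - y) with 0 by ring; unfold slice; qring.
Qed.

(* [K0] and [K1] stand for the values at [q] of [k] and [q0 * k], where
   [f - q = (q - q0) * k]. *)
Lemma left_quotient_one_minus f a q0 k q K0 K1 : has_coefs f a ->
  quotient_coefs q0 (RtoQ 0) (fun n => a n - id_coef n)%quat k -> unit_ball q ->
  psum q k K0 -> psum q (fun n => q0 * k n)%quat K1 ->
  let N := qnorm q0 ^ 2 in
  let s := (RtoQ 1 - qscal (2 * qre q0) q + qscal N (q * q))%quat in
  left_quotient (one_minus_conj_star q0 (fun p => p)) (one_minus_conj_star q0 f) q =
  (/ s * (s - q * (qscal (2 * qre q0) K0 - K1) + qscal N K0 +
     q * (q * qscal N K0 - qscal N K1)))%quat.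
Proof.
intros ha hq hqb h0 h1 N s; unfold left_quotient.
rewrite symmetrization_one_minus by easy; fold N; fold s; f_equal.
apply (star_psum _ _ (one_minus_coef q0 id_coef) (one_minus_coef (qconj q0) a));
  [apply reg_conj_one_minus_has_coefs|now apply one_minus_conj_star_has_coefs|].
apply (psum_ext q _ _ _ (fun n => eq_sym (qconv_one_minus _ _ n))).
assert (ea : forall n, a n = (id_coef n + (shift1 k n - q0 * k n))%quat).
{ intro n; pose proof (proj1 (quotient_coefs_shift1 _ _ _ _) hq n) as e; cbn beta in e.
  rewrite <- e; destruct n as [|n]; cbn [delta0]; qring. }
assert (eN : (qconj q0 * q0)%quat = RtoQ N)
  by (unfold N; rewrite qnorm_sqr; unfold qdot; qring).
assert (eN' : (q0 * qconj q0)%quat = RtoQ N)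
  by (unfold N; rewrite qnorm_sqr; unfold qdot; qring).
(* [conj q0 = 2 Re q0 - q0] expresses this value through [K0] and [K1] alone. *)
assert (hconj : psum q (fun n => qconj q0 * k n)%quat (qscal (2 * qre q0) K0 - K1)%quat).
{ apply (psum_ext q (fun n => qscal (2 * qre q0) (k n) - q0 * k n)%quat); [intro; qring|].
  apply psum_minus; [now apply psum_scal|easy]. }
assert (hA : psum q (fun n => qconj q0 * a n)%quat
  (q * qconj q0 + (q * (qscal (2 * qre q0) K0 - K1) - qscal N K0))%quat).
{ apply (psum_ext q (fun n => shift1 (delta0 (qconj q0)) n +
    (shift1 (fun n => qconj q0 * k n) n - qscal N (k n)))%quat).
  - intro n; rewrite ea, !qmult_plus_distr_l.
    replace (qscal N (k n)) with (RtoQ N * k n)%quat by qring; rewrite <- eN.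
    destruct n as [|[|n]]; cbn [shift1 delta0 id_coef]; qring.
  - apply psum_plus; [apply psum_shift1, psum_delta0|].
    apply psum_minus; [now apply psum_shift1|now apply psum_scal]. }
assert (hf : psum q a (q + (q * K0 - K1))%quat).
{ apply (psum_ext q (fun n => id_coef n + (shift1 k n - q0 * k n))%quat);
    [intro; now rewrite ea|].
  apply psum_plus; [apply psum_id|apply psum_minus; [now apply psum_shift1|easy]]. }
(* With [g = 1 - conj q0 * f], the product [(1 - q0 * q) * g] has the value [g(q) - q (q0 * g)(q)],
   and [q0 * g = q0 - N f]. *)
replace (_ + _)%quat with
  ((RtoQ 1 - (q * qconj q0 + (q * (qscal (2 * qre q0) K0 - K1) - qscal N K0)))
  - q * (q0 - qscal N (q + (q * K0 - K1))))%quat.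
- apply psum_minus; [apply psum_minus; [apply psum_delta0|easy]|apply psum_shift1].
  apply (psum_ext q (fun n => delta0 q0 n - qscal N (a n))%quat).
  + intro n; unfold one_minus_coef.
    replace (qscal N (a n)) with (RtoQ N * a n)%quat by qring; rewrite <- eN'.
    destruct n as [|n]; cbn [delta0]; qring.
  + apply psum_minus; [apply psum_delta0|now apply psum_scal].
- unfold s; generalize N; intro; qring.
Qed.

(** The left side is the value at [q] of [(1 - q q0) * k], namely [sum q^n u k_n]. Writing
    [q^n u = u (u^-1 q u)^n] pulls [u] out and leaves [k] at a conjugate of [q], which has the same
    norm. *)
Lemma psum_conjugate_point q q0 k K0 K1 (u := (RtoQ 1 - q * q0)%quat) :
  unit_ball q -> subexponential k -> u <> RtoQ 0 ->
  psum q k K0 -> psum q (fun n => q0 * k n)%quat K1 ->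
  unit_ball (/ u * q * u)%quat /\
  (K0 - q * K1)%quat = (u * power_series k (/ u * q * u)%quat)%quat.
Proof.
intros hq hk hu h0 h1.
assert (hn : unit_ball (/ u * q * u)%quat).
{ unfold unit_ball in *; rewrite !qnorm_mult.
  pose proof (f_equal qnorm (qinv_l u hu)) as e; rewrite qnorm_mult, qnorm_1 in e.
  replace (qnorm (/ u) * qnorm q * qnorm u) with (qnorm q * (qnorm (/ u) * qnorm u)) by ring.
  rewrite e; lra. }
split; [easy|].
apply (qlim_unique (qsum (fun n => u * ((/ u * q * u) ^ n * k n))%quat)).
- apply (qlim_ext (fun n => qsum (fun n => q ^ n * k n) n -
    q * qsum (fun n => q ^ n * (q0 * k n)) n)%quat).
  + intro n; rewrite <- qsum_mult_l, <- qsum_minus; apply qsum_ext; intros j _.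
    rewrite <- (qmult_assoc u), qpow_conjugation by easy; unfold u.
    replace (q ^ j * (RtoQ 1 - q * q0) * k j)%quat
      with (q ^ j * k j - (q ^ j * q) * (q0 * k j))%quat by qring.
    rewrite <- qpow_S_r; cbn [qpow]; qring.
  + apply qlim_minus; [easy|now apply qlim_mult_l].
- apply (qlim_ext (fun n => u * qsum (fun n => (/ u * q * u) ^ n * k n) n)%quat);
    [intro; now rewrite qsum_mult_l|].
  now apply qlim_mult_l, power_series_lim.
Qed.

Theorem theorem1p9 (f : quat -> quat) (q0 : quat)
  (f_regular : slice_regular unit_ball f)
  (f_maps : forall q : quat, unit_ball q -> unit_ball (f q))
  (q0_in : unit_ball q0)
  (q0_fixed : f q0 = q0) :
  let stmt1 := forall q : quat, unit_ball q -> f q = q in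
  let stmt2 := filterdiff f (locally q0) (fun h : quat => h) in
  let stmt3 := cullen_derivative f q0 = RtoQ 1 in
  let stmt4 := spherical_derivative f q0 = RtoQ 1 in
  let stmt5 := exists q : quat, unit_ball q /\
    diff_quotient q0 f q =
    left_quotient (one_minus_conj_star q0 (fun p : quat => p))
      (one_minus_conj_star q0 f) q in
  (stmt1 <-> stmt2) /\ (stmt1 <-> stmt3) /\ (stmt1 <-> stmt4) /\
  (stmt1 <-> stmt5).
Proof.
intros stmt1 stmt2 stmt3 stmt4 stmt5.
destruct (slice_regular_has_coefs f f_regular) as [a ha].
destruct (diff_quotient_coefs f a q0 ha q0_in) as [b [hb hq]].
pose proof (has_coefs_subexponential _ b hb) as hsb.
set (k := fun n => (b n - delta0 (RtoQ 1) n)%quat).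
assert (hk : quotient_coefs q0 (RtoQ 0) (fun n => a n - id_coef n)%quat k).
{ apply quotient_coefs_sub_id; now rewrite q0_fixed in hq. }
assert (hsk : subexponential k).
{ apply subexponential_minus; [easy|apply subexponential_delta0]. }
assert (hR : forall q, unit_ball q -> diff_quotient q0 f q = (power_series k q + RtoQ 1)%quat).
{ intros q hqb; apply (qlim_unique (qsum (fun n => q ^ n * b n)%quat)).
  - now apply has_coefs_lim.
  - apply (psum_ext q (fun n => k n + delta0 (RtoQ 1) n)%quat); [intro; unfold k; qring|].
    apply psum_plus; [now apply psum_power_series|apply psum_delta0]. }
assert (rigid : forall q1, unit_ball q1 -> diff_quotient q0 f q1 = RtoQ 1 -> stmt1).
{ intros q1 hq1 e p hp; apply (eq_id_of_quotient_zero f a q0 q1 k); auto.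
  rewrite hR in e by easy.
  replace (power_series k q1) with ((power_series k q1 + RtoQ 1) - RtoQ 1)%quat by qring.
  rewrite e; qring. }
(* For the identity, the zero sequence is another quotient of [f - q] by [q - q0]. *)
assert (hid : stmt1 -> forall n, k n = RtoQ 0).
{ intro h1; apply (quotient_coefs_unique q0 (RtoQ 0) (fun n => a n - id_coef n)%quat); auto.
  - intros s hs; exists 0; intro n; rewrite qnorm_0; lra.
  - split; [|intro n]; rewrite (has_coefs_unique f (fun p => p) a id_coef ha id_has_coefs h1);
      qring. }
assert (hid1 : stmt1 -> forall q, unit_ball q -> diff_quotient q0 f q = RtoQ 1).
{ intros h1 q hqb; rewrite hR by easy.
  rewrite (qlim_unique _ _ (RtoQ 0) (psum_power_series q k hsk hqb)); [qring|].
  apply (psum_ext q (fun _ => RtoQ 0)); [intro; now rewrite hid|apply psum_0]. }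
assert (h12 : stmt1 -> stmt2) by (intro h1; now apply filterdiff_id_of_eq).
assert (h23 : stmt2 -> stmt3).
{ intro h2; apply cullen_derivative_slice_diff, (filterdiff_id_slice_diff f q0);
    [apply slice_unit_imag|apply slice_decomposition|exact h2]. }
assert (h31 : stmt3 -> stmt1).
{ intro h3; apply (rigid q0 q0_in).
  rewrite (has_coefs_power_series _ b q0 hb q0_in), <- (cullen_derivative_quotient f a b); auto. }
split; [tauto|split; [tauto|split; split]].
- intro h1; apply hid1; [easy|now apply unit_ball_conj].
- intro h4; apply (rigid (qconj q0)); [now apply unit_ball_conj|exact h4].
- intro h1.
  assert (hz : unit_ball (RtoQ 0)) by (unfold unit_ball; rewrite qnorm_0; lra).
  (* For the identity both sides are constantly 1; the origin is a point common to all cases. *)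
  exists (RtoQ 0); split; [easy|]; rewrite hid1 by easy.
  rewrite (left_quotient_one_minus f a q0 k (RtoQ 0) (RtoQ 0) (RtoQ 0)); auto.
  + pose proof (symmetrization_one_minus_neq0 q0 (RtoQ 0) q0_in hz) as hs.
    rewrite <- (qinv_l _ hs) at 1; f_equal; qring.
  + apply (psum_ext _ (fun _ => RtoQ 0)); [intro; now rewrite hid|apply psum_0].
  + apply (psum_ext _ (fun _ => RtoQ 0)); [intro; rewrite hid; [qring|easy]|apply psum_0].
- intros [q [hqb e]].
  set (K0 := power_series k q); set (K1 := power_series (fun n => q0 * k n)%quat q).
  assert (h0 : psum q k K0) by now apply psum_power_series.
  assert (h1 : psum q (fun n => q0 * k n)%quat K1)
    by now apply psum_power_series; [apply subexponential_mult_l|].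
  rewrite hR, (left_quotient_one_minus f a q0 k q K0 K1) in e by easy; fold K0 in e.
  pose proof (symmetrization_one_minus_neq0 q0 q q0_in hqb) as hs.
  set (s := (RtoQ 1 - qscal (2 * qre q0) q + qscal (qnorm q0 ^ 2) (q * q))%quat) in *.
  apply (f_equal (qmult s)) in e.
  rewrite <- (qmult_assoc s), (qinv_r s hs), qmult_1_l in e.
  assert (hN : qnorm q0 ^ 2 < 1)
    by (unfold unit_ball in q0_in; pose proof (qnorm_ge0 q0); nra).
  (* After clearing the denominator [s], the two sides of the equation differ by exactly
     [(1 - qnorm q0 ^ 2) (K0 - q K1)], whose real factor is positive. *)
  assert (eK : (K0 - q * K1)%quat = RtoQ 0).
  { apply (qmult_eq0 (RtoQ (1 - qnorm q0 ^ 2))).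
    - match type of e with ?l = ?r => transitivity (l - r)%quat end.
      + unfold s; generalize (qnorm q0 ^ 2); intro; qring.
      + rewrite e; match goal with |- (?x - ?x)%quat = _ => generalize x end; intro; qring.
    - intro h; apply (f_equal qre) in h; rewrite !qre_RtoQ in h; lra. }
  set (u := (RtoQ 1 - q * q0)%quat).
  assert (hu : u <> RtoQ 0).
  { intro h; assert (e1 : (q * q0)%quat = RtoQ 1).
    { replace (q * q0)%quat with (RtoQ 1 - u)%quat by (unfold u; qring); rewrite h; qring. }
    apply (f_equal qnorm) in e1; rewrite qnorm_mult, qnorm_1 in e1.
    unfold unit_ball in *; pose proof (qnorm_ge0 q); pose proof (qnorm_ge0 q0); nra. }
  destruct (psum_conjugate_point q q0 k K0 K1 hqb hsk hu h0 h1) as [hq1 e1].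
  rewrite eK in e1; symmetry in e1; apply qmult_eq0 in e1; [|easy].
  exact (eq_id_of_quotient_zero f a q0 _ k ha f_maps hk hsk q0_in hq1 e1).
Qed.
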